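(* Let $n\ge 3$. There exists a constant $C(n)>0$, depending only on $n$, such that for every simple $n$-gon $P\subset\mathbb{R}^2$ and convex $n$-gon $P_c$ obtained from $P$ via the Erdős–Nagy theorem (by a finite sequence of pocket flips), $$\alpha_c(P)+v(P)\le C(n)\,\delta(P),$$ where $\alpha_c(P)=|P\,\Delta\,P_c|$.
   Context: A simple $n$-gon $P\subset\mathbb{R}^2$ is a non-self-crossing closed polygon with cyclically ordered vertices $A_1,\ldots,A_n\in\mathbb{R}^2$, indices read modulo $n$, with $A_i=A_j$ if and only if $i\equiv j\pmod n$. It is convex if the region it bounds is convex. When taking symmetric differences $\Delta$ and Lebesgue measure $|\cdot|$, a simple polygon is identified with the planar region it bounds. Let $O=\frac1n\sum_{i=1}^n A_i$ be the center of mass of the vertices, $l_i=|A_iA_{i+1}|$ the side lengths, $r_i=|OA_i|$ the radii, $L(P)=\sum_{i=1}^n l_i$ the perimeter, $S(P)=\sum_{i=1}^n l_i^2$, and $F(P)=|P|$ the area. The polygonal isoperimetric deficit is $\delta(P)=L^2(P)-4n\tan\frac{\pi}{n}\,F(P)$. The variances of the side lengths and of the radii are $$\sigma_s^2(P)=\frac1n S(P)-\frac1{n^2}L^2(P),\qquad \sigma_r^2(P)=\frac1n\sum_{i=1}^n r_i^2-\frac1{n^2}\Big(\sum_{i=1}^n r_i\Big)^2,$$ and the variation is $v(P)=\sigma_s^2(P)+\sigma_r^2(P)$. Flips. A pocket of a simple polygon is a maximal connected region exterior to the polygon and interior to its convex hull. It is bounded by a subchain of the polygon and a segment (the lid) on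 the boundary of the convex hull joining the two endpoints of that subchain. A flip reflects the subchain bounding one pocket across the line containing the lid (the line of support), leaving the rest of the polygon unchanged; the result is a simple $n$-gon with the same perimeter and greater area. By the Erdős–Nagy theorem, a simple $n$-gon $P$ is transformed by finitely many successive flips into a convex $n$-gon, denoted $P_c$ (with $P_c=P$ if $P$ is already convex). The c-asymmetry index of $P$ is $\alpha_c(P)=|P\,\Delta\,P_c|$. *)

(* Defs.v *)
From HB Require Import structures.
From mathcomp Require Import all_boot all_order all_algebra.
From mathcomp Require Import all_classical all_reals all_analysis.

Set Implicit Arguments.
Unset Strict Implicit.
Unset Printing Implicit Defensive.

Import Order.TTheory GRing.Theory Num.Theory.
Import numFieldNormedType.Exports.

Local Open Scope classical_set_scope.
Local Open Scope ring_scope.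

Section Plane.
Context {R : realType}.
Implicit Types (p q a b : R * R) (X : set (R * R)).

(* The library's norm on R * R is the sup norm; it induces the usual topology
   and bounded sets, but lengths need the Euclidean distance. *)
Definition dot p q : R := p.1 * q.1 + p.2 * q.2.
Definition edist p q : R := Num.sqrt (dot (q - p) (q - p)).

Definition segment p q : set (R * R) :=
  [set (1 - t) *: p + t *: q | t in `[0, 1]].

(* Only meaningful for a != b. *)
Definition reflect_across a b p : R * R :=
  a + (2 * dot (p - a) (b - a) / dot (b - a) (b - a)) *: (b - a) - (p - a).

Definition boundary X : set (R * R) := closure X `\` X°.

Definition convex_hull X : set (R * R) :=
  smallest (fun Y => @convex_set R (R * R)%type Y) X.

Definition area2 X : \bar R :=
  (@lebesgue_measure R \x @lebesgue_measure R)%E X.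

(* All sets measured below are bounded Borel sets, so [fine] loses nothing. *)
Definition area X : R := fine (area2 X).

End Plane.

Definition polygon (R : realType) (n : nat) := 'I_n -> R * R.

Section Polygon.
Context {R : realType} {n : nat}.
Implicit Types (A B : polygon R n) (K : set (R * R)).

(* [ordS] is the successor modulo n on 'I_n. *)
Definition side A (i : 'I_n) : set (R * R) := segment (A i) (A (ordS i)).

Definition curve A : set (R * R) := \bigcup_i side A i.

Definition simple_polygon A : Prop :=
  injective A /\
  forall i j, i != j ->
    side A i `&` side A j `<=`
    [set A i; A (ordS i)] `&` [set A j; A (ordS j)].

(* The bounded components of the complement of the curve, together with the
   curve itself; for a simple polygon there is exactly one such component. *)
Definition region A : set (R * R) :=
  curve A `|`
  [set x | (~` curve A) x /\ bounded_set (connected_component (~` curve A) x)].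

Definition convex_polygon A : Prop :=
  simple_polygon A /\ @convex_set R (R * R)%type (region A).

Definition centroid A : R * R := n%:R^-1 *: \sum_(i < n) A i.

Definition side_length A (i : 'I_n) : R := edist (A i) (A (ordS i)).
Definition radius A (i : 'I_n) : R := edist (centroid A) (A i).

Definition perimeter A : R := \sum_(i < n) side_length A i.
Definition sum_sq_sides A : R := \sum_(i < n) side_length A i ^+ 2.
Definition polygon_area A : R := area (region A).

Definition deficit A : R :=
  perimeter A ^+ 2 - 4 * n%:R * tan (pi / n%:R) * polygon_area A.

Definition side_variance A : R :=
  n%:R^-1 * sum_sq_sides A - (n%:R ^+ 2)^-1 * perimeter A ^+ 2.

Definition radius_variance A : R :=
  n%:R^-1 * (\sum_(i < n) radius A i ^+ 2)
  - (n%:R ^+ 2)^-1 * (\sum_(i < n) radius A i) ^+ 2.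

Definition polygon_variation A : R := side_variance A + radius_variance A.

Definition pocket A K : Prop :=
  let U := (convex_hull (region A))° `\` region A in
  exists2 x, U x & K = connected_component U x.

Definition chain_end (i : 'I_n) (m : nat) : 'I_n := iter m (@ordS n) i.

Definition lid A i m : set (R * R) := segment (A i) (A (chain_end i m)).

(* The pocket K is bounded by the subchain A_i, A_(i+1), ..., A_(i+m) (indices
   modulo n) and by the segment [A_i, A_(i+m)]. *)
Definition pocket_chain A K (i : 'I_n) (m : nat) : Prop :=
  [/\ (1 < m < n)%N,
      boundary K =
        (\bigcup_(k in [set` traject (@ordS n) i m]) side A k) `|` lid A i m &
      lid A i m `<=` boundary (convex_hull (region A))].

(* The endpoints of the subchain lie on the line of support and are fixed. *)
Definition reflect_chain A (i : 'I_n) (m : nat) : polygon R n := fun j =>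
  if j \in traject (@ordS n) i m.+1
  then reflect_across (A i) (A (chain_end i m)) (A j) else A j.

Definition flip A B : Prop :=
  simple_polygon A /\
  exists K i m, [/\ pocket A K, pocket_chain A K i m & B = reflect_chain A i m].

Inductive flips_to : polygon R n -> polygon R n -> Prop :=
| flips_refl A : flips_to A A
| flips_step A B C : flip A B -> flips_to B C -> flips_to A C.

(* P_c is any convex n-gon reached from A by finitely many flips. *)
Definition convexification A Ac : Prop := flips_to A Ac /\ convex_polygon Ac.

Definition c_asymmetry A Ac : R := area (region A `+` region Ac).

End Polygon.

(* Main.v *)
Require Import Defs.
From HB Require Import structures.
From mathcomp Require Import all_boot all_order all_algebra.
From mathcomp Require Import all_classical all_reals all_analysis measurable_realfun.
From mathcomp Require Import ring lra zify.

Set Implicit Arguments.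
Unset Strict Implicit.
Unset Printing Implicit Defensive.

Import Order.TTheory GRing.Theory Num.Theory.
Import numFieldNormedType.Exports.
Import Defs.

Local Open Scope classical_set_scope.
Local Open Scope ring_scope.

(** Write [k = (2 n tan (pi / n))^-1], so that for a closed polygon with perimeter
L, sum of squared sides S and signed area F the deficit is a multiple of
[k L^2 - 2 F].  Turning the j-th vertex by [- j pi / n] makes the sequence of
vertices antiperiodic, and a discrete Wirtinger inequality then bounds the squared
distance to some regular polygon by [S - 4 tan (pi / n) F].  To replace S by
[L^2 / n], move a vertex to the position that makes its two sides equal, which
gains area unless they were equal already; the gain is quantified by comparing
with the polygon in which the vertex is removed, whose constant k is strictly
smaller.  So [n S - L^2] is at most a constant times the deficit when the latter
is small compared with L^2, and the isoperimetric inequality itself follows by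
induction on n from the same estimate applied near the supremum of the area.

If the deficit is small compared with L^2, then P is close to a regular polygon,
hence strictly convex; its region is an intersection of half-planes, it has no
pocket, [P_c = P], and only the variation has to be estimated.  Otherwise every
term is at most a constant times L^2, as flips preserve the perimeter.

Both cases need the area of the region to be [|F|].  The complement of a polygonal
arc is connected, so closing the arc by its last side leaves at most two
components, and the crossing number of a ray jumps by one between them; it is
therefore constant, equal to 1 or -1, on the bounded one.  Integrating it
trapezoid by trapezoid gives the shoelace formula. *)

(** * Closed polygons *)

(** The regular-polygon estimate involves [S], and [L^2 <= n S] goes the wrong way: a small deficit
    does not by itself make [S - 4 tan (pi / n) F] small, so [n S - L^2] must be controlled
    separately. Equalising the two sides at a vertex gains area in proportion to a height, and the
    gain degenerates when the triangle at that vertex is flat. But a flat triangle can be cut off at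
    almost no loss, which would leave a polygon with one vertex less and more area than such a
    polygon can have. This is where the strict growth of the constant with [n] enters. The half
    angle [pi / n] is the right turn because the lowest modes of an antiperiodic sequence have
    exactly this frequency; turned back, they split into frequency 0, a centre, and frequency
    [2 pi / n], a regular polygon. A simple polygon carries no preferred orientation. The value 1 or
    -1 of its crossing number becomes a sign [s] that accompanies every later estimate, and the
    negative case is the mirror image of the positive one. *)

Section PlaneAlgebra.
Context {R : realType}.
Implicit Types (p q a b c u v : R * R) (z : nat -> R * R).

Definition cross u v : R := u.1 * v.2 - u.2 * v.1.

Lemma edistE p q :
  edist p q = Num.sqrt ((q.1 - p.1) ^+ 2 + (q.2 - p.2) ^+ 2).
Proof. by rewrite /edist /dot !expr2. Qed.

Lemma edist_ge0 p q : 0 <= edist p q.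
Proof. exact: sqrtr_ge0. Qed.

Lemma edist_sqr p q :
  edist p q ^+ 2 = (q.1 - p.1) ^+ 2 + (q.2 - p.2) ^+ 2.
Proof. by rewrite edistE sqr_sqrtr// addr_ge0 ?sqr_ge0. Qed.

Lemma edistC p q : edist p q = edist q p.
Proof. by rewrite !edistE; congr Num.sqrt; ring. Qed.

Lemma ler_of_sqr (x y : R) : 0 <= y -> x ^+ 2 <= y ^+ 2 -> x <= y.
Proof.
move=> y0 h; apply: (le_trans (ler_norm x)).
by rewrite -(ger0_norm y0) -ler_sqr ?nnegrE// !real_normK ?num_real.
Qed.

Lemma eqr_of_sqr (x y : R) : 0 <= x -> 0 <= y -> x ^+ 2 = y ^+ 2 -> x = y.
Proof.
by move=> x0 y0 h; apply/le_anti/andP; split; apply: ler_of_sqr; rewrite ?h.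
Qed.

Lemma edist_triangle q p r : edist p r <= edist p q + edist q r.
Proof.
have d1 := edist_sqr p q; have d2 := edist_sqr q r; have d3 := edist_sqr p r.
have n1 := edist_ge0 p q; have n2 := edist_ge0 q r.
apply: ler_of_sqr; first exact: addr_ge0.
set x := edist p q in d1 n1 *; set y := edist q r in d2 n2 *.
suff : (q.1 - p.1) * (r.1 - q.1) + (q.2 - p.2) * (r.2 - q.2) <= x * y.
  by rewrite d3 [(x + y) ^+ 2]sqrrD d1 d2 => h; lra.
apply: ler_of_sqr; first exact: mulr_ge0.
rewrite exprMn d1 d2.
rewrite -subr_ge0.
have := sqr_ge0 ((q.1 - p.1) * (r.2 - q.2) - (q.2 - p.2) * (r.1 - q.1)).
by congr (0 <= _); ring.
Qed.

Lemma edist_eq0 p q : edist p q = 0 -> p = q.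
Proof.
move=> h; have := edist_sqr p q; rewrite h expr0n /= => e.
have s1 := sqr_ge0 (q.1 - p.1); have s2 := sqr_ge0 (q.2 - p.2).
have /eqP : (q.1 - p.1) ^+ 2 = 0 by lra.
have /eqP : (q.2 - p.2) ^+ 2 = 0 by lra.
rewrite !sqrf_eq0 !subr_eq0 => /eqP e2 /eqP e1.
by rewrite [p]surjective_pairing [q]surjective_pairing e1 e2.
Qed.

(** Vertices form a sequence over [nat], and closedness is a separate hypothesis [z n = z 0];
    deleting a vertex then lowers [n] without a change of type. *)
Definition closed_sum (f : R * R -> R * R -> R) (n : nat) z : R :=
  \sum_(0 <= j < n) f (z j) (z j.+1).

Lemma closed_sum_split f i r z : closed_sum f (i.+2 + r)%N z =
  closed_sum f i z + f (z i) (z i.+1) + f (z i.+1) (z i.+2) +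
  closed_sum f r (fun j => z (i.+2 + j)%N).
Proof.
rewrite /closed_sum (big_cat_nat (n := i.+2)) ?leq_addr//.
rewrite [X in X + _ = _]big_nat_recr// [X in X + _ + _ = _]big_nat_recr//.
congr (_ + _); rewrite -{1}[i.+2]add0n big_addn addKn.
by apply: eq_bigr => j _; rewrite addnC addnS.
Qed.

Definition move_vertex z i p : nat -> R * R :=
  fun j => if j == i then p else z j.

Definition drop_vertex z i : nat -> R * R :=
  fun j => if (j < i)%N then z j else z j.+1.

Lemma closed_sum_move f i n z p : (0 < i < n)%N ->
  closed_sum f n (move_vertex z i p) =
  closed_sum f n z - f (z i.-1) (z i) - f (z i) (z i.+1)
  + f (z i.-1) p + f p (z i.+1).
Proof.
case: i => // i; rewrite [i.+1.-1]/= => hin.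
rewrite -(subnKC hin); set r := (n - i.+2)%N.
rewrite (closed_sum_split f i r z) (closed_sum_split f i r (move_vertex _ _ _)).
rewrite /move_vertex eqxx ?(ltn_eqF (ltnSn i)) ?(gtn_eqF (ltnSn _)).
rewrite (_ : closed_sum f i _ = closed_sum f i z); last first.
  by apply: eq_big_nat => j /andP[_ ji]; rewrite !ifF//; lia.
rewrite (_ : closed_sum f r _ = closed_sum f r (fun j => z (i.+2 + j)%N)).
  by ring.
by apply: eq_big_nat => j _; rewrite !ifF//; lia.
Qed.

Lemma closed_sum_drop f i n z : (0 < i < n)%N ->
  closed_sum f n.-1 (drop_vertex z i) =
  closed_sum f n z - f (z i.-1) (z i) - f (z i) (z i.+1)
  + f (z i.-1) (z i.+1).
Proof.
case: i => // i; rewrite [i.+1.-1]/= => hin.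
rewrite -(subnKC hin); set r := (n - i.+2)%N.
rewrite (closed_sum_split f i r z) (_ : (i.+2 + r).-1 = i.+1 + r)%N; last by lia.
rewrite /closed_sum (big_cat_nat (n := i.+1)) ?leq_addr//.
rewrite [X in X + _ = _]big_nat_recr// /drop_vertex ltnSn ltnn.
rewrite (_ : \sum_(0 <= j < i) _ = closed_sum f i z); last first.
  by apply: eq_big_nat => j /andP[_ ji]; rewrite !ifT//; lia.
rewrite (_ : \sum_(i.+1 <= j < _) _ =
    closed_sum f r (fun j => z (i.+2 + j)%N)); first by rewrite /closed_sum /=; ring.
rewrite -{1}[i.+1]add0n big_addn addKn.
apply: eq_big_nat => j _; rewrite !ifF; [|lia|lia].
by congr (f (z _) (z _)); lia.
Qed.

Definition plen (n : nat) z := closed_sum edist n z.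
(** The shoelace sum: twice the signed area when [z] is closed. *)
Definition parea2 (n : nat) z := closed_sum cross n z.
Definition psumsq (n : nat) z := closed_sum (fun p q => edist p q ^+ 2) n z.

Lemma plen_ge0 n z : 0 <= plen n z.
Proof. by apply: sumr_ge0 => j _; exact: edist_ge0. Qed.

Lemma plen_drop n z i : (0 < i < n)%N ->
  plen n.-1 (drop_vertex z i) <= plen n z.
Proof.
move=> hi; rewrite /plen closed_sum_drop//.
by have := edist_triangle (z i) (z i.-1) (z i.+1); lra.
Qed.

Lemma edist_le_plen n z i : (i <= n)%N -> edist (z 0%N) (z i) <= plen n z.
Proof.
move=> hin; apply: (@le_trans _ _ (plen i z)); last first.
  rewrite /plen /closed_sum [leRHS](big_cat_nat (n := i))//= lerDl.
  by apply: sumr_ge0 => j _; exact: edist_ge0.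
elim: i {hin} => [|i ih].
  by rewrite edistE !subrr expr0n addr0 sqrtr0 plen_ge0.
rewrite /plen /closed_sum big_nat_recr//=.
by rewrite (le_trans (edist_triangle (z i) _ _))// lerD2r.
Qed.

End PlaneAlgebra.

(** * A discrete Wirtinger inequality *)

Section DiscreteWirtinger.
Context {R : realType}.
Implicit Types (p q u v : R * R) (z : nat -> R * R).

(** Half of the angle under which a side of the regular [n]-gon is seen from its centre. *)
Definition step_angle (n : nat) : R := pi / n%:R.

Lemma step_angle_gt0 n : (0 < n)%N -> 0 < step_angle n.
Proof. by move=> n0; rewrite divr_gt0 ?pi_gt0// ltr0n. Qed.

Lemma step_angle_total n : (0 < n)%N -> n%:R * step_angle n = pi.
Proof. by move=> n0; rewrite mulrC divfK// pnatr_eq0 -lt0n. Qed.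

Lemma step_angle_lt_pihalf n : (3 <= n)%N -> step_angle n < pi / 2.
Proof.
move=> n3; rewrite /step_angle ltr_pM2l ?pi_gt0// ltf_pV2 ?posrE ?ltr0n//.
  by rewrite ltr_nat.
by apply: leq_trans n3.
Qed.

Lemma cos_step_gt0 n : (3 <= n)%N -> 0 < cos (step_angle n).
Proof.
move=> n3; apply: cos_gt0_pihalf; rewrite step_angle_lt_pihalf// andbT.
have p0 := pi_gt0 R.
have a0 : 0 < step_angle n by apply: step_angle_gt0; lia.
by move: p0 a0; lra.
Qed.

Lemma sin_ge_of_between (a x : R) : 0 < a -> a <= x <= pi - a -> sin a <= sin x.
Proof.
move=> a0 /andP[ax xa]; rewrite -subr_ge0.
have -> : sin x - sin a = 2 * (cos ((x + a) / 2) * sin ((x - a) / 2)).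
  have -> : sin x = sin ((x + a) / 2 + (x - a) / 2) by congr sin; field.
  have -> : sin a = sin ((x + a) / 2 - (x - a) / 2) by congr sin; field.
  by rewrite sinD sinB; ring.
apply: mulr_ge0 => //; apply: mulr_ge0.
  by apply: cos_ge0_pihalf; have := pi_gt0 R; lra.
by apply: sin_ge0_pi; lra.
Qed.

Lemma sin_step_ge n j : (0 < j < n)%N ->
  sin (step_angle n) <= sin (j%:R * step_angle n).
Proof.
move=> /andP[j0 jn]; have n0 : (0 < n)%N by lia.
have a0 := step_angle_gt0 n0; have e := step_angle_total n0.
apply: sin_ge_of_between => //; apply/andP; split.
  by rewrite ler_peMl// ?ler1n// ltW.
rewrite lerBrDr -{2}[step_angle n]mul1r -mulrDl -e ler_pM2r//.
by rewrite natr1 ler_nat.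
Qed.

Lemma sin_step_gt0 n : (1 < n)%N -> 0 < sin (step_angle n).
Proof.
move=> n1; have n0 : (0 < n)%N by lia.
apply: sin_gt0_pi; rewrite step_angle_gt0//= /step_angle.
by rewrite ltr_pdivrMr ?ltr0n// ltr_pMr ?pi_gt0// ltr1n.
Qed.

(* Ground-state substitution: [sin] is positive on the interior nodes and solves
   the recurrence, so dividing by it turns the form into a sum of squares, up to
   terms that telescope and vanish by antiperiodicity.  At both ends [sin]
   vanishes and the convention [x / 0 = 0] makes the identity hold there. *)
Lemma antiperiodic_wirtinger n (y : nat -> R) : (1 < n)%N -> y n = - y 0%N ->
  let a := step_angle n in
  let Q := \sum_(0 <= j < n)
    (cos a * (y j ^+ 2 + y j.+1 ^+ 2) - 2 * y j * y j.+1) in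
  exists b, forall j, (j <= n)%N ->
    (y j - y 0%N * cos (j%:R * a) - b * sin (j%:R * a)) ^+ 2 <=
      (n%:R / sin a) ^+ 2 * Q.
Proof.
move=> n1 yn a Q; have n0 : (0 < n)%N by lia.
pose c := cos a; pose s := sin a.
have s0 : 0 < s := sin_step_gt0 n1.
have sn : s != 0 by rewrite gt_eqF.
have cs : c ^+ 2 + s ^+ 2 = 1 := cos2Dsin2 a.
pose g j := cos (j%:R * a); pose h j := sin (j%:R * a).
have gS j : g j.+1 = c * g j - s * h j.
  by rewrite /g -natr1 mulrDl mul1r cosD /c /s /h; ring.
have hS j : h j.+1 = c * h j + s * g j.
  by rewrite /h -natr1 mulrDl mul1r sinD /c /s /g; ring.
have g0 : g 0%N = 1 by rewrite /g mul0r cos0.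
have h0 : h 0%N = 0 by rewrite /h mul0r sin0.
have gn : g n = -1 by rewrite /g step_angle_total// cospi.
have hn : h n = 0 by rewrite /h step_angle_total// sinpi.
have hs j : (0 < j < n)%N -> s <= h j by exact: sin_step_ge.
(* This choice makes the residual [v] vanish at node 1 as well as at 0 and [n]; the bound on [r]
   starts from there. *)
pose b := (y 1%N - y 0%N * c) / s; exists b.
pose m j := y 0%N * g j + b * h j.
(* [m] and [k] form a discrete cosine-sine pair: one step rotates them by the angle [a]. *)
pose k j := - (y 0%N * h j) + b * g j.
pose v j := y j - m j.
have v0 : v 0%N = 0 by rewrite /v /m g0 h0; ring.
have v1 : v 1%N = 0.
  by rewrite /v /m gS hS g0 h0 /b; field.
have vn : v n = 0 by rewrite /v /m gn hn yn; ring.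
pose r j := v j / h j.
(* The telescoping part. Its first summand collects the terms containing [m], the second is left
   over from completing the square in [r]. *)
pose U j := s * k j * (2 * v j + m j) + s * v j ^+ 2 * (g j / h j).
have step j : (j < n)%N ->
    c * (y j ^+ 2 + y j.+1 ^+ 2) - 2 * y j * y j.+1 =
    h j * h j.+1 * (r j.+1 - r j) ^+ 2 + (U j.+1 - U j).
  move=> jn.
  have mS : m j.+1 = c * m j + s * k j by rewrite /m /k gS hS; ring.
  have mP : m j = c * m j.+1 - s * k j.+1.
    rewrite /m /k gS hS.
    have -> : y 0%N * g j + b * h j =
      (c ^+ 2 + s ^+ 2) * (y 0%N * g j + b * h j) by rewrite cs mul1r.
    by ring.
  have -> : c * (y j ^+ 2 + y j.+1 ^+ 2) - 2 * y j * y j.+1 =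
    c * (v j ^+ 2 + v j.+1 ^+ 2) - 2 * v j * v j.+1 +
    (s * k j.+1 * (2 * v j.+1 + m j.+1) - s * k j * (2 * v j + m j)).
    have sk : s * k j = m j.+1 - c * m j by rewrite mS; ring.
    have sk' : s * k j.+1 = c * m j.+1 - m j by rewrite mP; ring.
    by rewrite sk sk' /v; ring.
  rewrite /U; suff -> : c * (v j ^+ 2 + v j.+1 ^+ 2) - 2 * v j * v j.+1 =
    h j * h j.+1 * (r j.+1 - r j) ^+ 2 +
    (s * v j.+1 ^+ 2 * (g j.+1 / h j.+1) - s * v j ^+ 2 * (g j / h j)) by ring.
  have [j0|j0] := posnP j.
    by rewrite /r j0 v0 v1 h0; ring.
  have hj : h j != 0 by rewrite gt_eqF// (lt_le_trans s0)// hs// j0.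
  have [jn'|jn'] := eqVneq j.+1 n.
    rewrite /r jn' vn hn invr0 !mulr0 !mul0r.
    have e : c * h j + s * g j = 0 by rewrite -hS jn'.
    have -> : c = - (s * g j / h j).
      by apply: (mulIf hj); rewrite mulNr divfK//; lra.
    move: (v j) (h j) (g j) hj => vj hj' gj hj0.
    by rewrite expr0n /=; field.
  have hj' : h j.+1 != 0 by rewrite gt_eqF// (lt_le_trans s0)// hs//; lia.
  have sg : s * g j = h j.+1 - c * h j by rewrite hS; ring.
  have sg' : s * g j.+1 = c * h j.+1 - h j.
    by rewrite gS hS -[X in _ = _ - X]mul1r -cs; ring.
  have -> : s * v j.+1 ^+ 2 * (g j.+1 / h j.+1) =
    v j.+1 ^+ 2 * ((s * g j.+1) / h j.+1) by ring.
  have -> : s * v j ^+ 2 * (g j / h j) = v j ^+ 2 * ((s * g j) / h j) by ring.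
  by rewrite sg sg' /r; field; rewrite hj hj'.
have QE : Q = \sum_(0 <= j < n) h j * h j.+1 * (r j.+1 - r j) ^+ 2.
  rewrite /Q (eq_big_nat _ _ (F2 := fun j =>
    h j * h j.+1 * (r j.+1 - r j) ^+ 2 + (U j.+1 - U j))); last first.
    by move=> j /andP[_ jn]; exact: step.
  rewrite big_split/= telescope_sumr//.
  rewrite /U vn v0 /m /k gn g0 hn h0; ring.
have h_ge0 j : (j <= n)%N -> 0 <= h j.
  case: j => [|j] jn; first by rewrite h0.
  have [->|jn'] := eqVneq j.+1 n; first by rewrite hn.
  by rewrite (le_trans (ltW s0))// hs//; lia.
have term_ge0 j : (j < n)%N -> 0 <= h j * h j.+1 * (r j.+1 - r j) ^+ 2.
  by move=> jn; rewrite mulr_ge0 ?sqr_ge0// mulr_ge0// h_ge0//; lia.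
have Q0 : 0 <= Q.
  by rewrite QE big_nat_cond; apply: sumr_ge0 => j /andP[/andP[_ jn] _]; exact: term_ge0.
(* All summands of [Q] are nonnegative and interior sines are at least [s], so [E] bounds each
   interior increment of [r]. *)
pose E := Num.sqrt Q / s.
have E0 : 0 <= E by rewrite divr_ge0 ?sqrtr_ge0// ltW.
have EQ : E ^+ 2 = Q / s ^+ 2 by rewrite exprMn sqr_sqrtr// exprVn.
have dr j : (0 < j)%N -> (j.+1 < n)%N -> `|r j.+1 - r j| <= E.
  move=> j0 jn; apply: ler_of_sqr => //.
  rewrite real_normK ?num_real// EQ ler_pdivlMr ?exprn_gt0//.
  apply: (@le_trans _ _ (h j * h j.+1 * (r j.+1 - r j) ^+ 2)).
    rewrite mulrC ler_wpM2r ?sqr_ge0//.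
    by rewrite expr2 ler_pM ?(ltW s0) ?hs//; lia.
  rewrite QE (bigD1_seq j)/= ?mem_index_iota ?iota_uniq//; last by lia.
  rewrite lerDl big_nat_cond; apply: sumr_ge0 => i /andP[/andP[_ ij] _].
  exact: term_ge0.
have r_le j : (j.+1 < n)%N -> `|r j.+1| <= j%:R * E.
  elim: j => [|j ih] jn; first by rewrite /r v1 !mul0r normr0.
  rewrite -(subrK (r j.+1) (r j.+2)) (le_trans (ler_normD _ _))//.
  rewrite -natr1 mulrDl mul1r [leRHS]addrC lerD ?dr// ih//; lia.
move=> j jn.
have -> : y j - y 0%N * cos (j%:R * a) - b * sin (j%:R * a) = v j.
  by rewrite /v /m /g /h; ring.
rewrite (_ : _ * Q = (n%:R * E) ^+ 2); last first.
  by rewrite [RHS]exprMn EQ -/s; field.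
have nE : 0 <= n%:R * E by exact: mulr_ge0.
case: j jn => [|j] jn; first by rewrite v0 expr0n sqr_ge0.
have [->|jn'] := eqVneq j.+1 n; first by rewrite vn expr0n sqr_ge0.
rewrite -(real_normK (num_real (v j.+1))) ler_sqr ?nnegrE//.
have hj : 0 < h j.+1 by rewrite (lt_le_trans s0)// hs//; lia.
have -> : v j.+1 = h j.+1 * r j.+1 by rewrite /r mulrC divfK// gt_eqF.
rewrite normrM (ger0_norm (ltW hj)).
apply: (@le_trans _ _ (1 * (j%:R * E))).
  by apply: ler_pM; [exact: ltW|exact: normr_ge0|exact: sin_le1|
    apply: r_le; lia].
by rewrite mul1r ler_wpM2r// ler_nat; lia.
Qed.

End DiscreteWirtinger.

(** * Distance to a regular polygon *)

Section NearRegular.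
Context {R : realType}.
Implicit Types (p q a b c u v : R * R) (z : nat -> R * R).

Definition rotv (t : R) u : R * R :=
  (cos t * u.1 - sin t * u.2, sin t * u.1 + cos t * u.2).

Definition square_deficit n z : R :=
  psumsq n z - 2 * tan (step_angle n) * parea2 n z.

(** The coordinates [Y1], [Y2] of the turned vertices are antiperiodic, and their two quadratic
    forms add up to [cos a] times the square deficit. The discrete Wirtinger inequality puts each
    close to a combination of [cos (j a)] and [sin (j a)]. *)
Lemma near_regular n z : (3 <= n)%N -> z n = z 0%N ->
  0 <= square_deficit n z /\
  exists p q, forall j, (j <= n)%N ->
    edist (q + rotv (j%:R * (2 * step_angle n)) p) (z j) ^+ 2 <=
    (n%:R / sin (step_angle n)) ^+ 2 * square_deficit n z.
Proof.
move=> n3 zn; set a : R := step_angle n.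
have n1 : (1 < n)%N by lia.
have c0 : 0 < cos a := @cos_step_gt0 R n n3.
have s0 : 0 < sin a := @sin_step_gt0 R n n1.
have cs := cos2Dsin2 a.
pose Y1 j := cos (j%:R * a) * (z j).1 + sin (j%:R * a) * (z j).2.
pose Y2 j := - sin (j%:R * a) * (z j).1 + cos (j%:R * a) * (z j).2.
have en : n%:R * a = pi by rewrite step_angle_total//; lia.
have Y1n : Y1 n = - Y1 0%N.
  by rewrite /Y1 en zn cospi sinpi !mul0r cos0 sin0; ring.
have Y2n : Y2 n = - Y2 0%N.
  by rewrite /Y2 en zn cospi sinpi !mul0r cos0 sin0; ring.
have [b1 hb1] := antiperiodic_wirtinger n1 Y1n.
have [b2 hb2] := antiperiodic_wirtinger n1 Y2n.
move: hb1 hb2; rewrite -/a; set Q1 := \sum_(_ <= _ < _) _ => hb1.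
set Q2 := \sum_(_ <= _ < _) _ => hb2.
pose K := (n%:R / sin a) ^+ 2.
have K0 : 0 < K by rewrite exprn_gt0// divr_gt0// ltr0n; lia.
have Q10 : 0 <= Q1.
  by rewrite -(pmulr_rge0 _ K0) (le_trans _ (hb1 0%N _)) ?sqr_ge0.
have Q20 : 0 <= Q2.
  by rewrite -(pmulr_rge0 _ K0) (le_trans _ (hb2 0%N _)) ?sqr_ge0.
have QE : Q1 + Q2 = cos a * square_deficit n z.
  rewrite /Q1 /Q2 -big_split/= /square_deficit mulrBr /psumsq /parea2.
  rewrite (_ : cos a * (2 * tan a * _) = 2 * sin a * closed_sum cross n z).
    rewrite /closed_sum 2!mulr_sumr -sumrB; apply: eq_bigr => j _.
    rewrite edist_sqr /cross /Y1 /Y2.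
    have csj := cos2Dsin2 (j%:R * a).
    rewrite -natr1 mulrDl mul1r cosD sinD.
    move: csj; move: (cos (j%:R * a)) (sin (j%:R * a)) => g h csj.
    rewrite [LHS](_ : _ = cos a * ((g ^+ 2 + h ^+ 2) *
        ((z j).1 ^+ 2 + (z j).2 ^+ 2) + (g ^+ 2 + h ^+ 2) *
        (cos a ^+ 2 + sin a ^+ 2) * ((z j.+1).1 ^+ 2 + (z j.+1).2 ^+ 2)) -
      2 * (g ^+ 2 + h ^+ 2) * (cos a *
        ((z j).1 * (z j.+1).1 + (z j).2 * (z j.+1).2) +
        sin a * ((z j).1 * (z j.+1).2 - (z j).2 * (z j.+1).1))); last by ring.
    by rewrite csj cs; ring.
  by rewrite /tan; field; rewrite gt_eqF.
have D0 : 0 <= square_deficit n z.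
  by rewrite -(pmulr_rge0 _ c0) -QE addr_ge0.
split => //.
(* Turning the approximations back by [j a] yields a constant part, the centre [q], and a part
   rotating by [2 a] per step, started at [p]. *)
exists ((Y1 0%N + b2) / 2, (Y2 0%N - b1) / 2),
  ((Y1 0%N - b2) / 2, (Y2 0%N + b1) / 2) => j jn.
apply: (@le_trans _ _ (K * (Q1 + Q2))); last first.
  by rewrite QE ler_wpM2l ?(ltW K0)// ler_piMl// cos_le1.
rewrite mulrDr (le_trans _ (lerD (hb1 j jn) (hb2 j jn)))//.
rewrite edist_sqr /rotv /=.
have -> : j%:R * (2 * a) = (j%:R * a) + (j%:R * a) by ring.
rewrite cosD sinD; move: (Y1 0%N) (Y2 0%N) => y1 y2; rewrite /Y1 /Y2.
have csj := cos2Dsin2 (j%:R * a).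
move: csj; move: (cos (j%:R * a)) (sin (j%:R * a)) => g h csj.
set e1 := _ - b1 * h; set e2 := _ - b2 * h.
rewrite le_eqVlt; apply/orP; left; apply/eqP.
(* Factors [g ^ 2 + h ^ 2 = 1] are inserted so that both sides agree as polynomials in [g] and
   [h]. *)
have -> : (z j).1 = (g ^+ 2 + h ^+ 2) * (z j).1 by rewrite csj mul1r.
have -> : (z j).2 = (g ^+ 2 + h ^+ 2) * (z j).2 by rewrite csj mul1r.
have -> : (y1 - b2) / 2 = (g ^+ 2 + h ^+ 2) * ((y1 - b2) / 2).
  by rewrite csj mul1r.
have -> : (y2 + b1) / 2 = (g ^+ 2 + h ^+ 2) * ((y2 + b1) / 2).
  by rewrite csj mul1r.
transitivity ((g ^+ 2 + h ^+ 2) * (e1 ^+ 2 + e2 ^+ 2)).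
  by rewrite /e1 /e2; field.
by rewrite csj mul1r.
Qed.

End NearRegular.

(** * The isoperimetric inequality and its stability *)

Section Isoperimetry.
Context {R : realType}.
Implicit Types (p q a b c u v : R * R) (z : nat -> R * R).

(* Heron's formula: [s ^ 2 - b ^ 2] and [b ^ 2 - d ^ 2], for the sum [s] and the
   difference [d] of the two sides at [p]. *)
Lemma heron a p c :
  4 * (cross a p + cross p c - cross a c) ^+ 2 =
  ((edist a p + edist p c) ^+ 2 - edist a c ^+ 2) *
  (edist a c ^+ 2 - (edist a p - edist p c) ^+ 2).
Proof.
have e1 := edist_sqr a p; have e2 := edist_sqr p c; have e3 := edist_sqr a c.
set x := edist a p in e1 *; set y := edist p c in e2 *.
set t := edist a c in e3 *.
have -> : ((x + y) ^+ 2 - t ^+ 2) * (t ^+ 2 - (x - y) ^+ 2) =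
  (x ^+ 2 + y ^+ 2 + 2 * (x * y) - t ^+ 2) *
  (t ^+ 2 - (x ^+ 2 + y ^+ 2) + 2 * (x * y)) by ring.
have -> : (x ^+ 2 + y ^+ 2 + 2 * (x * y) - t ^+ 2) *
  (t ^+ 2 - (x ^+ 2 + y ^+ 2) + 2 * (x * y)) =
  4 * (x ^+ 2 * y ^+ 2) - (t ^+ 2 - (x ^+ 2 + y ^+ 2)) ^+ 2 by ring.
by rewrite e1 e2 e3 /cross; ring.
Qed.

Lemma isosceles_apex a c (s : R) : edist a c <= s ->
  exists p, [/\ edist a p = s / 2, edist p c = s / 2 &
    cross a p + cross p c - cross a c =
      edist a c * Num.sqrt (s ^+ 2 - edist a c ^+ 2) / 2].
Proof.
move=> bs; have b0 := edist_ge0 a c; have s0 : 0 <= s by exact: le_trans bs.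
have eb := edist_sqr a c.
have s20 : 0 <= s / 2 by rewrite divr_ge0.
have [b00|bn0] := eqVneq (edist a c) 0.
  have e := edist_eq0 b00; rewrite b00 e expr0n subr0 mul0r mul0r.
  (* Over a base reduced to a point, every point at distance [s / 2] is an apex and the area
     vanishes. *)
  exists (c.1 + s / 2, c.2); split; last by rewrite /cross; ring.
    by apply: eqr_of_sqr => //; rewrite ?edist_ge0// edist_sqr/=; ring.
  by apply: eqr_of_sqr => //; rewrite ?edist_ge0// edist_sqr/=; ring.
set b := edist a c in b0 bs eb bn0 *.
have Hpos : 0 <= s ^+ 2 - b ^+ 2 by rewrite subr_ge0 ler_sqr ?nnegrE.
set H := Num.sqrt _; have H2 : H ^+ 2 = s ^+ 2 - b ^+ 2 by rewrite sqr_sqrtr.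
(* Ratio of height to base: the apex is the midpoint displaced by [k b = H / 2] along the normal, on
   the side where the signed area increases. *)
pose k := H / (2 * b).
have kb : k * b = H / 2 by rewrite /k; field.
have kb2 : k ^+ 2 * b ^+ 2 = (s ^+ 2 - b ^+ 2) / 4.
  by rewrite -exprMn kb -H2; field.
exists ((a.1 + c.1) / 2 + k * (c.2 - a.2), (a.2 + c.2) / 2 - k * (c.1 - a.1)).
have aux : b ^+ 2 / 4 + k ^+ 2 * b ^+ 2 = (s / 2) ^+ 2 by rewrite kb2; field.
split.
- apply: eqr_of_sqr; rewrite ?edist_ge0// edist_sqr/= -aux eb.
  by field.
- apply: eqr_of_sqr; rewrite ?edist_ge0// edist_sqr/= -aux eb.
  by field.
- transitivity (k * b ^+ 2); last by rewrite expr2 mulrA kb; ring.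
  by rewrite eb /cross/=; field.
Qed.

(* [edist a c * H / 2] is the left-hand side for the isosceles triangle on [a], [c]
   with the same sum of sides. *)
Lemma apex_gain a p c : edist a c <= 1 ->
  let H := Num.sqrt ((edist a p + edist p c) ^+ 2 - edist a c ^+ 2) in
  cross a p + cross p c - cross a c <= H / 2 /\
  cross a p + cross p c - cross a c <=
  edist a c * H / 2 - H * (edist a p - edist p c) ^+ 2 / 4.
Proof.
move=> b1; set b := edist a c in b1 *; set d := edist a p - _.
set s := edist a p + edist p c => H.
have b0 : 0 <= b := edist_ge0 a c.
have bs : b <= s := edist_triangle p a c.
have x0 := edist_ge0 a p; have y0 := edist_ge0 p c.
have db : d ^+ 2 <= b ^+ 2.
  have t1 := edist_triangle c a p; have t2 := edist_triangle a p c.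
  rewrite (edistC c p) in t1; rewrite (edistC p a) in t2.
  rewrite -[d ^+ 2]real_normK ?num_real// ler_sqr ?nnegrE//.
  by rewrite ler_norml /d /b; apply/andP; split; lra.
have Hpos : 0 <= s ^+ 2 - b ^+ 2.
  by rewrite subr_ge0 ler_sqr ?nnegrE//; lra.
have H0 : 0 <= H by exact: sqrtr_ge0.
have H2 : H ^+ 2 = s ^+ 2 - b ^+ 2 by rewrite sqr_sqrtr.
have := heron a p c; rewrite -/s -/b -/d -H2; set T := _ - cross a c => hT.
have d2b : d ^+ 2 / 2 <= b.
  have : b ^+ 2 <= b by rewrite expr2 ler_piMl.
  have := sqr_ge0 d; lra.
(* By Heron, [4 T^2 = H^2 (b^2 - d^2)]; since [b <= 1], the second factor is at most
   [(b - d^2 / 2)^2], which removes the square root. *)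
have main : T <= H * (b - d ^+ 2 / 2) / 2.
  apply: ler_of_sqr; first by rewrite divr_ge0// mulr_ge0// subr_ge0.
  rewrite -(ler_pM2l (_ : 0 < 4 :> R))// hT.
  have -> : 4 * (H * (b - d ^+ 2 / 2) / 2) ^+ 2 = H ^+ 2 * (b - d ^+ 2 / 2) ^+ 2.
    by field.
  rewrite ler_wpM2l ?sqr_ge0// -subr_ge0.
  have -> : (b - d ^+ 2 / 2) ^+ 2 - (b ^+ 2 - d ^+ 2) =
    d ^+ 2 * (1 - b) + (d ^+ 2 / 2) ^+ 2 by field.
  by rewrite addr_ge0 ?sqr_ge0// mulr_ge0 ?sqr_ge0// subr_ge0.
split; last by move: main; lra.
apply: (le_trans main); rewrite ler_pdivrMr// divfK//.
by rewrite ler_piMr//; have := sqr_ge0 d; lra.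
Qed.

(** Two competitors are compared with [z]. Deleting vertex [i.+1] must bring the doubled area down
    to [k], a loss of at least [t], so the height term satisfies [H >= 2 t]. Moving that vertex to
    the isosceles apex gains at least [H d^2 / 4], hence [t d^2 / 2], and the result still cannot
    exceed [M]. *)
Lemma almost_equilateral n z (M k t : R) : (3 <= n)%N -> 0 <= k -> 0 < t ->
  (forall z', z' n = z' 0%N -> plen n z' = 1 -> parea2 n z' <= M) ->
  (forall z', z' n.-1 = z' 0%N ->
    parea2 n.-1 z' <= k * plen n.-1 z' ^+ 2) ->
  z n = z 0%N -> plen n z = 1 -> k + t <= parea2 n z ->
  forall i, (i.+1 < n)%N ->
    (edist (z i) (z i.+1) - edist (z i.+1) (z i.+2)) ^+ 2 <=
    2 * (M - parea2 n z) / t.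
Proof.
move=> n3 k0 t0 hM hk zn z1 hz i hi.
set a := z i; set p := z i.+1; set c := z i.+2.
have iv : (0 < i.+1 < n)%N by [].
have sides_le1 : edist a p + edist p c <= 1.
  rewrite -z1 /plen -(subnKC hi) closed_sum_split -/a -/p -/c.
  have := plen_ge0 i z; rewrite /plen.
  have := plen_ge0 (n - i.+2) (fun j => z (i.+2 + j)%N); rewrite /plen; lra.
have bs := edist_triangle p a c.
have ac1 : edist a c <= 1 by lra.
have [] := apex_gain p ac1.
set H := Num.sqrt _; set T := _ - cross a c => hT1 hT2.
have H0 : 0 <= H by exact: sqrtr_ge0.
have Ht : 2 * t <= H.
  have dz : drop_vertex z i.+1 n.-1 = drop_vertex z i.+1 0%N.
    rewrite /drop_vertex ltnNge (_ : (i.+1 <= n.-1)%N) /=; last by lia.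
    by rewrite prednK ?zn//; lia.
  have := hk _ dz; rewrite {1}/parea2 closed_sum_drop//= -/a -/p -/c.
  have := plen_drop z iv; rewrite z1 => l1.
  have : k * plen n.-1 (drop_vertex z i.+1) ^+ 2 <= k.
    by rewrite ler_piMr// expr_le1// plen_ge0.
  by move: hz hT1; rewrite /T /parea2; lra.
have [q [q1 q2 q3]] := isosceles_apex bs.
have mz : move_vertex z i.+1 q n = move_vertex z i.+1 q 0%N.
  by rewrite /move_vertex/= gtn_eqF.
have ml : plen n (move_vertex z i.+1 q) = 1.
  by rewrite -z1 /plen closed_sum_move//= -/a -/p -/c q1 q2; field.
have := hM _ mz ml; rewrite {1}/parea2 closed_sum_move//= -/a -/p -/c.
rewrite -/(parea2 n z) => hM'.
rewrite ler_pdivlMr//.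
set d2 := (_ - _) ^+ 2 in hT2 *.
have d20 : 0 <= d2 by exact: sqr_ge0.
have : 2 * t * d2 <= H * d2 by rewrite ler_wpM2r.
by move: hT2 hM' q3; rewrite /T -/H; lra.
Qed.

(** The left-hand side does not change when a constant is subtracted from all [l j], so only the
    deviations from [l 0], each at most [n D], contribute. *)
Lemma sum_sq_of_close n (l : nat -> R) (D : R) : (0 < n)%N -> 0 <= D ->
  (forall i, (i.+1 < n)%N -> `|l i - l i.+1| <= D) ->
  n%:R * (\sum_(0 <= j < n) l j ^+ 2) - (\sum_(0 <= j < n) l j) ^+ 2 <=
  n%:R ^+ 4 * D ^+ 2.
Proof.
move=> n0 D0 hD.
pose x j := l j - l 0%N.
have xle j : (j < n)%N -> `|x j| <= j%:R * D.
  elim: j => [|j ih] jn; first by rewrite /x subrr normr0 mul0r.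
  have -> : x j.+1 = x j + (l j.+1 - l j) by rewrite /x; ring.
  rewrite (le_trans (ler_normD _ _))// -natr1 mulrDl mul1r lerD//.
    by apply: ih; lia.
  by rewrite distrC hD.
have cst (C : R) : n%:R * C = \sum_(0 <= j < n) C.
  by rewrite sumr_const_nat subn0 mulr_natl.
have -> : \sum_(0 <= j < n) l j = n%:R * l 0%N + \sum_(0 <= j < n) x j.
  rewrite cst -big_split/=; apply: eq_bigr => j _; rewrite /x; ring.
have -> : \sum_(0 <= j < n) l j ^+ 2 = n%:R * l 0%N ^+ 2 +
    2 * l 0%N * (\sum_(0 <= j < n) x j) + \sum_(0 <= j < n) x j ^+ 2.
  rewrite cst mulr_sumr.
  rewrite -!big_split/=; apply: eq_bigr => j _; rewrite /x; ring.
set X := \sum_(_ <= _ < _) x _; set X2 := \sum_(_ <= _ < _) _.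
apply: (@le_trans _ _ (n%:R * X2)).
  by have := sqr_ge0 X; nra.
have -> : n%:R ^+ 4 * D ^+ 2 = n%:R * (n%:R * (n%:R * D) ^+ 2) :> R by ring.
rewrite ler_wpM2l// /X2 cst.
rewrite big_nat_cond [leRHS]big_nat_cond; apply: ler_sum => j /andP[/andP[_ jn] _].
rewrite -(real_normK (num_real (x j))) ler_sqr ?nnegrE// ?mulr_ge0//.
by rewrite (le_trans (xle _ jn))// ler_wpM2r// ler_nat ltnW.
Qed.

Lemma almost_equilateral_sumsq n z (M k t : R) :
  (3 <= n)%N -> 0 <= k -> 0 < t ->
  (forall z', z' n = z' 0%N -> plen n z' = 1 -> parea2 n z' <= M) ->
  (forall z', z' n.-1 = z' 0%N ->
    parea2 n.-1 z' <= k * plen n.-1 z' ^+ 2) ->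
  z n = z 0%N -> plen n z = 1 -> k + t <= parea2 n z ->
  n%:R * psumsq n z - 1 <= 2 * n%:R ^+ 4 / t * (M - parea2 n z).
Proof.
move=> n3 k0 t0 hM hk zn z1 hz.
have n0 : (0 < n)%N by lia.
have h := almost_equilateral n3 k0 t0 hM hk zn z1 hz.
set e := M - _ in h *.
have e0 : 0 <= e by rewrite subr_ge0; apply: hM.
have D0 : 0 <= 2 * e / t. by apply: divr_ge0; [apply: mulr_ge0|apply: ltW].
have := @sum_sq_of_close n (fun j => edist (z j) (z j.+1))
  (Num.sqrt (2 * e / t)) n0 (sqrtr_ge0 _).
rewrite /= sqr_sqrtr// -/(closed_sum edist n z) -/(plen n z) z1 expr1n.
have -> : 2 * n%:R ^+ 4 / t * e = n%:R ^+ 4 * (2 * e / t) by ring.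
move=> hh; apply: hh => i hi; apply: ler_of_sqr; first exact: sqrtr_ge0.
by rewrite sqr_sqrtr// real_normK ?num_real// h.
Qed.

End Isoperimetry.

(** * The sharp constant and stability *)

Section Stability.
Context {R : realType}.
Implicit Types (p q a b c u v : R * R) (z : nat -> R * R).

(* The best constant for [parea2], which is twice the signed area; a polygon with
   at most two vertices encloses nothing, and this starts the induction. *)
Definition iso_const (n : nat) : R :=
  if (n <= 2)%N then 0 else (2 * n%:R * tan (step_angle n))^-1.

Lemma tan_step_gt0 n : (3 <= n)%N -> 0 < tan (step_angle n : R).
Proof.
by move=> n3; rewrite /tan divr_gt0 ?cos_step_gt0// sin_step_gt0//; lia.
Qed.

Lemma iso_const_gt0 n : (3 <= n)%N -> 0 < iso_const n.
Proof.
move=> n3; rewrite /iso_const leqNgt n3/= invr_gt0 mulr_gt0 ?tan_step_gt0//.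
by rewrite mulr_gt0// ltr0n; lia.
Qed.

Lemma iso_const_ge0 n : 0 <= iso_const n.
Proof.
have [n2|n2] := leqP n 2; first by rewrite /iso_const n2.
exact/ltW/iso_const_gt0.
Qed.

Lemma sin_lt_id (x : R) : 0 < x -> x <= pi -> sin x < x.
Proof.
move=> x0 xpi.
have [c] : exists2 c, c \in `]0, x[%R & sin x - sin 0 = cos c * (x - 0).
  apply: MVT x0 _ _.
  by apply: derivable_within_continuous => t _; exact: derivable_sin.
rewrite in_itv/= sin0 !subr0 => /andP[c0 cx] ->.
rewrite gtr_pMl// -[X in _ < X]cos0 ltr_cos// in_itv/= ?lexx ?pi_ge0//.
by apply/andP; split; lra.
Qed.

(** Monotonicity of [tan x / x]: the slope of the tangent beyond [x] is at least [1 / cos^2 x],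
    which exceeds [tan x / x] because [sin x cos x < x]. *)
Lemma tan_ratio_lt (x y : R) : 0 < x -> x < y -> y < pi / 2 ->
  y * tan x < x * tan y.
Proof.
move=> x0 xy yp.
have cpos t : x <= t <= y -> 0 < cos t.
  by move=> /andP[xt ty]; apply: cos_gt0_pihalf; lra.
have [c cxy] : exists2 c, c \in `]x, y[%R & tan y - tan x =
    (cos c) ^- 2 * (y - x).
  apply: (@MVT R tan (fun t => (cos t) ^- 2)) => // [t|].
    rewrite in_itv/= => /andP[xt ty].
    by apply: is_derive_tan; rewrite gt_eqF// cpos// !ltW.
  apply: derivable_within_continuous => t; rewrite in_itv/= => txy.
  by apply: derivable_tan; rewrite gt_eqF// cpos.
move: cxy; rewrite in_itv/= => /andP[xc cy] e.
have cx : 0 < cos x by rewrite cpos// lexx ltW.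
have cc : 0 < cos c by rewrite cpos// !ltW.
have ccx : cos c <= cos x.
  by rewrite leNgt ltr_cos ?in_itv/=; [rewrite -leNgt ltW|lra|lra].
have h1 : (cos x) ^- 2 <= (cos c) ^- 2.
  by rewrite lef_pV2 ?posrE ?exprn_gt0// ler_sqr ?nnegrE// ltW.
have h2 : tan x < x * (cos x) ^- 2.
  rewrite /tan -exprVn expr2 mulrA ltr_pM2r ?invr_gt0//.
  rewrite ltr_pdivlMr// (le_lt_trans _ (sin_lt_id x0 _))//; last by have := pi_gt0 R; lra.
  by rewrite ler_piMr ?cos_le1// sin_ge0_pi//; have := pi_gt0 R; lra.
have h3 : x * (cos x) ^- 2 * (y - x) <= x * (tan y - tan x).
  rewrite e mulrA ler_wpM2r//; first by rewrite subr_ge0 ltW.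
  by rewrite ler_wpM2l// ltW.
have : tan x * (y - x) < x * (cos x) ^- 2 * (y - x).
  by rewrite ltr_pM2r// subr_gt0.
by move: h3; lra.
Qed.

(** This strict gap bounds from below the cost of deleting a vertex. For [n >= 4] it says that
    [n tan (pi / n)] decreases; for [n = 3] the smaller constant is 0 by convention. *)
Lemma iso_const_lt n : (3 <= n)%N -> iso_const n.-1 < iso_const n.
Proof.
move=> n3; have [n2|n2] := leqP n.-1 2.
  by rewrite {1}/iso_const n2 iso_const_gt0.
rewrite /iso_const leqNgt n2/= leqNgt n3/=.
have t1 := tan_step_gt0 n3; have t2 := tan_step_gt0 n2.
have p1 : (0 : R) < n%:R by rewrite ltr0n; lia.
have p2 : (0 : R) < n.-1%:R by rewrite ltr0n; lia.
rewrite ltf_pV2 ?posrE; [|by do 2 apply: mulr_gt0 => //..].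
rewrite -!mulrA ltr_pM2l//.
have h : (n.-1 < n)%N by lia.
have xy : step_angle n < step_angle n.-1 :> R.
  rewrite /step_angle ltr_pM2l ?pi_gt0// ltf_pV2 ?posrE//.
  by rewrite ltr_nat.
have n0 : (0 < n)%N by lia.
have hh := tan_ratio_lt (step_angle_gt0 n0) xy (step_angle_lt_pihalf n2).
have e1 : n%:R * step_angle n = pi :> R by rewrite step_angle_total//; lia.
have e2 : n.-1%:R * step_angle n.-1 = pi :> R by rewrite step_angle_total//; lia.
rewrite -(ltr_pM2l (_ : 0 < step_angle n * step_angle n.-1 :> R)); last first.
  by rewrite mulr_gt0// step_angle_gt0//; lia.
set t := tan _ in t1 hh *; set t' := tan _ in t2 hh *.
have -> : step_angle n * step_angle n.-1 * (n%:R * t) =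
  (n%:R * step_angle n) * (step_angle n.-1 * t) by ring.
have -> : step_angle n * step_angle n.-1 * (n.-1%:R * t') =
  (n.-1%:R * step_angle n.-1) * (step_angle n * t') by ring.
by rewrite e1 e2 ltr_pM2l ?pi_gt0.
Qed.

(** Nonnegativity of the square deficit. It has [n S] in place of [L^2], so it is the sharp
    inequality for equilateral polygons only; for the others it at least bounds the area. *)
Lemma parea2_le_sumsq n z : (3 <= n)%N -> z n = z 0%N ->
  parea2 n z <= iso_const n * (n%:R * psumsq n z).
Proof.
move=> n3 zn; have [] := near_regular n3 zn.
rewrite /square_deficit => h _; have t0 := tan_step_gt0 n3.
have p1 : (0 : R) < n%:R by rewrite ltr0n; lia.
rewrite /iso_const leqNgt n3/= mulrC ler_pdivlMr; last first.
  by do 2 apply: mulr_gt0 => //.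
rewrite (_ : parea2 n z * _ =
    n%:R * (2 * tan (step_angle n) * parea2 n z)); last by ring.
by rewrite ler_pM2l// -subr_ge0.
Qed.

Lemma psumsq_le n z : psumsq n z <= plen n z ^+ 2.
Proof.
elim: n => [|n ih].
  by rewrite /psumsq /plen /closed_sum !big_geq// expr0n.
have l0 := plen_ge0 n z; have e0 := edist_ge0 (z n) (z n.+1).
move: ih l0; rewrite /psumsq /plen /closed_sum !big_nat_recr//=.
set S := \sum_(_ <= _ < _) _; set L := \sum_(_ <= _ < _) _ => ih l0.
by rewrite sqrrD; have := mulr_ge0 l0 e0; lra.
Qed.

Definition scale_poly (k : R) z : nat -> R * R := fun j => k *: z j.

Lemma plen_scale k n z : 0 <= k -> plen n (scale_poly k z) = k * plen n z.
Proof.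
move=> k0; rewrite /plen /closed_sum mulr_sumr; apply: eq_bigr => j _.
apply: eqr_of_sqr; rewrite ?mulr_ge0 ?edist_ge0//.
by rewrite exprMn !edist_sqr /scale_poly/= /GRing.scale/=; ring.
Qed.

Lemma psumsq_scale k n z : psumsq n (scale_poly k z) = k ^+ 2 * psumsq n z.
Proof.
rewrite /psumsq /closed_sum mulr_sumr; apply: eq_bigr => j _.
by rewrite !edist_sqr /scale_poly/= /GRing.scale/=; ring.
Qed.

Lemma parea2_scale k n z : parea2 n (scale_poly k z) = k ^+ 2 * parea2 n z.
Proof.
rewrite /parea2 /closed_sum mulr_sumr; apply: eq_bigr => j _.
by rewrite /scale_poly /cross/= /GRing.scale/=; ring.
Qed.

Lemma parea2_of_plen0 n z : plen n z = 0 -> parea2 n z = 0.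
Proof.
move=> l0; have e j : (j <= n)%N -> z j = z 0%N.
  move=> jn; apply/esym/edist_eq0/le_anti/andP; split; last exact: edist_ge0.
  by rewrite -l0 edist_le_plen.
rewrite /parea2 /closed_sum big_nat_cond big1// => j /andP[/andP[_ jn] _].
by rewrite (e j (ltnW jn)) (e _ jn) /cross; ring.
Qed.

Lemma isoperimetric_unit n (M : R) :
  (forall z, z n = z 0%N -> plen n z = 1 -> parea2 n z <= M) ->
  forall z, z n = z 0%N -> parea2 n z <= M * plen n z ^+ 2.
Proof.
move=> h z zn; have [l0|ln0] := eqVneq (plen n z) 0.
  by rewrite l0 expr0n mulr0 parea2_of_plen0.
have lp : 0 < plen n z by rewrite lt_neqAle eq_sym ln0 plen_ge0.
have := h (scale_poly (plen n z)^-1 z).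
rewrite plen_scale ?invr_ge0 ?(ltW lp)// mulVf// parea2_scale.
rewrite {1 2}/scale_poly zn => /(_ erefl erefl).
by rewrite exprVn ler_pdivrMl ?exprn_gt0// mulrC.
Qed.

(* Compactness is avoided: [almost_equilateral_sumsq] is applied to a polygon whose
   area is only close to the supremum. *)
Lemma isoperimetric n z : (2 <= n)%N -> z n = z 0%N ->
  parea2 n z <= iso_const n * plen n z ^+ 2.
Proof.
move=> n2; elim: n n2 z => // n ih n2 z zn.
have [n1|n1] := leqP n 1.
  have en : n = 1%N by lia.
  rewrite en /iso_const/= mul0r /parea2 /closed_sum !big_nat_recr//= big_geq//.
  by move: zn; rewrite en => ->; rewrite /cross le_eqVlt; apply/orP; left; apply/eqP; ring.
have n3 : (3 <= n.+1)%N by lia.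
apply: isoperimetric_unit zn => {}z zn z1.
set k := iso_const n.+1.
have k0 : 0 < k := iso_const_gt0 n3.
pose A := [set x | exists z, [/\ z n.+1 = z 0%N, plen n.+1 z = 1 &
  x = parea2 n.+1 z]].
have supA : has_sup A.
  split; first by exists (parea2 n.+1 z), z.
  exists (k * (n.+1%:R * 1)) => _ [z' [zn' z1' ->]].
  rewrite (le_trans (parea2_le_sumsq n3 zn'))// ler_wpM2l ?(ltW k0)//.
  by rewrite ler_wpM2l// (le_trans (psumsq_le _ _))// z1' expr1n.
have hM z' : z' n.+1 = z' 0%N -> plen n.+1 z' = 1 -> parea2 n.+1 z' <= sup A.
  by move=> zn' z1'; apply: ub_le_sup; [exact: supA.2|exists z'].
apply: (le_trans (hM _ zn z1)); rewrite leNgt; apply/negP => kM.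
pose t := k - iso_const n.
have t0 : 0 < t by rewrite subr_gt0 (iso_const_lt n3).
pose C := 2 * n.+1%:R ^+ 4 / t.
have C0 : 0 <= C by rewrite divr_ge0 ?(ltW t0)// mulr_ge0// exprn_ge0.
have kC : 0 < 1 + k * C by rewrite ltr_pwDl// mulr_ge0 ?(ltW k0).
(* A polygon within [e] of the supremum has doubled area at most [k (1 + C e)]; this [e] solves
   [sup A - e = k (1 + C e)], so the strict inequality is contradictory. *)
pose e := (sup A - k) / (1 + k * C).
have e0 : 0 < e by rewrite divr_gt0// subr_gt0.
have eE : e * (1 + k * C) = sup A - k by rewrite divfK// gt_eqF.
have [_ [w [wn w1 ->]] we] := sup_adherent e0 supA.
have kw : iso_const n + t <= parea2 n.+1 w.
  rewrite /t; have : e <= sup A - k.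
    by rewrite -eE ler_peMr ?(ltW e0)// lerDl mulr_ge0// ltW.
  by move: we; lra.
have ihn z' : z' n = z' 0%N -> parea2 n z' <= iso_const n * plen n z' ^+ 2.
  exact: ih.
have := almost_equilateral_sumsq n3 (iso_const_ge0 n) t0 hM ihn wn w1 kw.
rewrite -/C => hS.
have : C * (sup A - parea2 n.+1 w) <= C * e.
  by rewrite ler_wpM2l//; move: we; lra.
have := parea2_le_sumsq n3 wn; rewrite -/k => hF hC.
have : k * (n.+1%:R * psumsq n.+1 w) <= k * (1 + C * e).
  by rewrite ler_wpM2l ?(ltW k0)//; move: hS hC; lra.
by move: eE we hF; lra.
Qed.

(** After scaling to perimeter 1 the sharp inequality supplies [M = k]. The square deficit times [n]
    equals [n S - 1] plus [k^-1] times the deficit in area, whence the constant [C + k^-1]. *)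
Lemma isoperimetric_stability n : (3 <= n)%N ->
  exists e C : R, [/\ 0 < e, 0 < C & forall z, z n = z 0%N -> 0 < plen n z ->
    iso_const n * plen n z ^+ 2 - parea2 n z <= e * plen n z ^+ 2 ->
    n%:R * psumsq n z - plen n z ^+ 2 <=
      C * (iso_const n * plen n z ^+ 2 - parea2 n z) /\
    square_deficit n z <=
      C * (iso_const n * plen n z ^+ 2 - parea2 n z)].
Proof.
move=> n3; have klt := iso_const_lt n3; have k0 := iso_const_gt0 n3.
have n0 : (1 : R) <= n%:R by rewrite ler1n; lia.
have n2 : (2 <= n)%N by lia.
have n2' : (2 <= n.-1)%N by lia.
set k := iso_const n in klt k0 *.
(* Half of the gap: a loss of up to [t] from the optimum still leaves a margin [t] above the
   constant for [n.-1]. *)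
pose t := (k - iso_const n.-1) / 2.
have t0 : 0 < t by rewrite divr_gt0// subr_gt0.
pose C := 2 * n%:R ^+ 4 / t.
have C0 : 0 < C by rewrite divr_gt0// mulr_gt0// exprn_gt0//; lra.
have ki : 0 < k^-1 by rewrite invr_gt0.
exists t, (C + k^-1); split => //; first exact: addr_gt0.
move=> z zn zl hz; set L := plen n z in zl hz *.
have Lu : L != 0 by rewrite gt_eqF.
pose w := scale_poly L^-1 z.
have wn : w n = w 0%N by rewrite /w /scale_poly zn.
have w1 : plen n w = 1 by rewrite plen_scale ?invr_ge0 ?(ltW zl)// mulVf.
have zF : parea2 n z = L ^+ 2 * parea2 n w.
  by rewrite parea2_scale mulrA -exprMn mulfV// expr1n mul1r.
have zS : psumsq n z = L ^+ 2 * psumsq n w.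
  by rewrite psumsq_scale mulrA -exprMn mulfV// expr1n mul1r.
have L2 : 0 < L ^+ 2 by rewrite exprn_gt0.
have hw : k - parea2 n w <= t.
  by rewrite -(ler_pM2r L2) mulrBl [parea2 n w * _]mulrC -zF.
have hkw : iso_const n.-1 + t <= parea2 n w by move: hw; rewrite /t; lra.
have hM z' : z' n = z' 0%N -> plen n z' = 1 -> parea2 n z' <= k.
  move=> zn' z1'; rewrite -[k]mulr1 -(expr1n _ 2) -z1'.
  exact: (isoperimetric n2 zn').
have hk z' : z' n.-1 = z' 0%N ->
    parea2 n.-1 z' <= iso_const n.-1 * plen n.-1 z' ^+ 2.
  exact: (isoperimetric n2').
have := almost_equilateral_sumsq n3 (iso_const_ge0 _) t0 hM hk wn w1 hkw.
rewrite -/C; set d := k - parea2 n w in hw * => hS.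
have d0 : 0 <= d by rewrite subr_ge0 hM.
have -> : k * L ^+ 2 - parea2 n z = L ^+ 2 * d by rewrite zF /d; ring.
have kd : 0 <= k^-1 * d by rewrite mulr_ge0 ?(ltW ki).
have -> : (C + k^-1) * (L ^+ 2 * d) = L ^+ 2 * ((C + k^-1) * d) by ring.
split.
  rewrite zS (_ : _ - _ = L ^+ 2 * (n%:R * psumsq n w - 1)); last by ring.
  by rewrite ler_pM2l//; move: hS kd; lra.
have -> : square_deficit n z = L ^+ 2 * square_deficit n w.
  by rewrite /square_deficit zS zF; ring.
rewrite ler_pM2l//.
have sw0 : 0 <= square_deficit n w := (near_regular n3 wn).1.
apply: (@le_trans _ _ (n%:R * square_deficit n w)); first by rewrite ler_peMl.
have e : n%:R * square_deficit n w = n%:R * psumsq n w - k^-1 * parea2 n w.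
  rewrite /square_deficit /k /iso_const leqNgt n3/= invrK; ring.
have e2 : k^-1 * d = 1 - k^-1 * parea2 n w by rewrite mulrBr mulVf// gt_eqF.
by rewrite e mulrDl e2; move: hS; lra.
Qed.

End Stability.

(** * The complement of a simple closed polygonal line *)

Section ConnectedSets.

Lemma connected_locally_constant (T : topologicalType) (A : set T)
    (P : T -> Prop) : connected A ->
  (forall x, A x -> \forall y \near x, A y -> (P y <-> P x)) ->
  forall x y, A x -> A y -> P x -> P y.
Proof.
move=> cA locA x y Ax Ay Px.
suff /seteqP[_ /(_ y Ay)[]//] : A `&` [set u | P u] = A.
apply: cA; first by exists x.
  exists [set u | A u -> P u]°; first exact: open_interior.
  apply/seteqP; split=> u [Au]; last by move=> /interior_subset/(_ Au).
  move=> Pu; split => //; have := locA u Au.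
  by apply: filterS => v hv Av; apply/hv.
exists (closure (A `&` [set u | P u])); first exact: closed_closure.
apply/seteqP; split=> u [Au]; first by move=> Pu; split=> //; exact: subset_closure.
by move=> /(_ _ (locA u Au))[v [[Av Pv] /(_ Av) uv]]; split=> //; apply/uv.
Qed.

Context {R : realType}.
Implicit Types (p q a b x y : R * R) (U D : set (R * R)).

Lemma openP_box U x : open U -> U x -> exists e : R, 0 < e /\
  forall y, `|y.1 - x.1| < e -> `|y.2 - x.2| < e -> U y.
Proof.
rewrite openE => /[apply]/nbhs_ballP[e /= e0 he]; exists e; split => // y h1 h2.
by apply: he; split => /=; rewrite /ball/= distrC.
Qed.

Lemma segment_continuous p q : continuous (fun t : R => (1 - t) *: p + t *: q).
Proof.
move=> t; apply: cvgD; apply: cvgZr_tmp => //.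
by apply: cvgB => //; exact: cvg_cst.
Qed.

Lemma segment_image p q :
  segment p q = (fun t : R => (1 - t) *: p + t *: q) @` `[0, 1].
Proof. by []. Qed.

Lemma connected_segment p q : connected (segment p q).
Proof.
rewrite segment_image; apply: connected_continuous_connected.
  exact: segment_connected.
by apply: continuous_subspaceT; exact: segment_continuous.
Qed.

Lemma closed_segment p q : closed (segment p q).
Proof.
apply: compact_closed; first exact: norm_hausdorff.
rewrite segment_image; apply: continuous_compact; last exact: segment_compact.
by apply: continuous_subspaceT; exact: segment_continuous.
Qed.

Lemma segment_left p q : segment p q p.
Proof.
by exists 0; rewrite /= ?in_itv/= ?lexx ?ler01// subr0 scale1r scale0r addr0.
Qed.

Lemma segment_right p q : segment p q q.
Proof.
by exists 1; rewrite /= ?in_itv/= ?lexx ?ler01// subrr scale1r scale0r add0r.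
Qed.

Lemma component_of_segment U p q : segment p q `<=` U ->
  connected_component U p q.
Proof.
move=> pqU; exists (segment p q); last exact: segment_right.
by split; [exact: segment_left|exact: pqU|exact: connected_segment].
Qed.

Lemma component_near U x : open U -> U x ->
  \forall y \near x, connected_component U x y.
Proof.
move=> oU Ux; have [e [e0 he]] := openP_box oU Ux.
apply/nbhs_ballP; exists e => //= y [/= h1 h2].
apply: component_of_segment => _ [t /= tI <-].
have t1 : `|t| <= 1 by rewrite ger0_norm; move: tI; rewrite in_itv/= => /andP[].
rewrite /ball/= distrC in h1; rewrite /ball/= distrC in h2.
have aux (u v : R) : (1 - t) * u + t * v - u = t * (v - u) by ring.
by apply: he => /=; rewrite /GRing.scale/= aux normrM (le_lt_trans (ler_piMl _ t1)).
Qed.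

Lemma open_component U x : open U -> open (connected_component U x).
Proof.
move=> oU; rewrite openE => y Cy.
have Uy := connected_component_sub Cy.
apply: filterS (component_near oU Uy) => w; exact: connected_component_trans Cy.
Qed.

End ConnectedSets.

(** * Cutting an open connected set along a segment *)

Section Slit.
Context {R : realType}.
Implicit Types (p q x y : R * R) (U D : set (R * R)).
Variables (a b : R * R).
Hypothesis ab : a != b.

Let d1 := b.1 - a.1.
Let d2 := b.2 - a.2.
Let n2 := d1 ^+ 2 + d2 ^+ 2.

(* Coordinates in which the slit is [0, 1] x {0}. *)
Definition slit_point (t h : R) : R * R :=
  (a.1 + t * d1 - h * d2, a.2 + t * d2 + h * d1).
Definition along x : R :=
  ((x.1 - a.1) * d1 + (x.2 - a.2) * d2) / n2.
Definition across x : R :=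
  ((x.2 - a.2) * d1 - (x.1 - a.1) * d2) / n2.

Let n2_gt0 : 0 < n2.
Proof.
rewrite lt_neqAle addr_ge0 ?sqr_ge0// andbT eq_sym.
apply: contra_neq ab => h.
have s1 := sqr_ge0 d1; have s2 := sqr_ge0 d2.
have /eqP : d1 ^+ 2 = 0 by move: h; rewrite /n2; lra.
have /eqP : d2 ^+ 2 = 0 by move: h; rewrite /n2; lra.
rewrite !sqrf_eq0 !subr_eq0 => /eqP e2 /eqP e1.
by rewrite [a]surjective_pairing [b]surjective_pairing e1 e2.
Qed.

Lemma slit_pointK x : slit_point (along x) (across x) = x.
Proof.
rewrite [RHS]surjective_pairing /slit_point /along /across /n2.
have := n2_gt0; rewrite /n2 => n20.
by congr pair; field; rewrite gt_eqF.
Qed.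

Lemma along_point t h : along (slit_point t h) = t.
Proof.
by rewrite /along /n2 /slit_point/=; have := n2_gt0; rewrite /n2 => n20;
  field; rewrite gt_eqF.
Qed.

Lemma across_point t h : across (slit_point t h) = h.
Proof.
by rewrite /across /n2 /slit_point/=; have := n2_gt0; rewrite /n2 => n20;
  field; rewrite gt_eqF.
Qed.

Lemma slit_point_segment t :
  (1 - t) *: a + t *: b = slit_point t 0.
Proof.
by rewrite [LHS]surjective_pairing /slit_point/=; congr pair;
  rewrite /d1 /d2/= /GRing.scale/=; ring.
Qed.

Lemma slit_segmentP x : segment a b x <-> across x = 0 /\ 0 <= along x <= 1.
Proof.
split => [[t /= + <-]|[h0 t01]].
  by rewrite in_itv/= slit_point_segment across_point along_point.
exists (along x); first by rewrite /= in_itv.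
by rewrite slit_point_segment -h0 slit_pointK.
Qed.

Lemma segment_slit_points t1 h1 t2 h2 x :
  segment (slit_point t1 h1) (slit_point t2 h2) x -> exists2 s, 0 <= s <= 1 &
  x = slit_point ((1 - s) * t1 + s * t2) ((1 - s) * h1 + s * h2).
Proof.
move=> [s /= sI <-]; exists s; first by move: sI; rewrite in_itv.
by rewrite [LHS]surjective_pairing /slit_point/=; congr pair;
  rewrite /GRing.scale/=; ring.
Qed.

Lemma open_slit_box D t h : open D -> D (slit_point t h) ->
  exists2 r : R, 0 < r & forall t' h', `|t' - t| < r -> `|h' - h| < r ->
    D (slit_point t' h').
Proof.
move=> oD /(openP_box oD)[e [e0 he]].
pose N := `|d1| + `|d2| + 1.
have N0 : 0 < N by rewrite ltr_wpDl// addr_ge0.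
exists (e / N); first exact: divr_gt0.
move=> t' h' ht hh; apply: he => /=.
  rewrite [X in `|X|](_ : _ = (t' - t) * d1 - (h' - h) * d2); last by ring.
  rewrite (le_lt_trans (ler_normB _ _))// !normrM.
  rewrite (@le_lt_trans _ _ (e / N * (`|d1| + `|d2|)))//.
    by rewrite mulrDr lerD// ler_wpM2r// ltW.
  rewrite mulrAC ltr_pdivrMr// ltr_pM2l//; rewrite /N; lra.
rewrite [X in `|X|](_ : _ = (t' - t) * d2 + (h' - h) * d1); last by ring.
rewrite (le_lt_trans (ler_normD _ _))// !normrM.
rewrite (@le_lt_trans _ _ (e / N * (`|d2| + `|d1|)))//.
  by rewrite mulrDr lerD// ler_wpM2r// ltW.
rewrite mulrAC ltr_pdivrMr// ltr_pM2l//; rewrite /N; lra.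
Qed.

Lemma near_slit_point t h (r : R) : 0 < r ->
  \forall y \near slit_point t h, `|along y - t| < r /\ `|across y - h| < r.
Proof.
move=> r0.
pose N := `|d1| + `|d2| + 1.
have N0 : 0 < N by rewrite ltr_wpDl// addr_ge0.
pose e := r * n2 / N.
have e0 : 0 < e by rewrite divr_gt0// mulr_gt0.
apply/nbhs_ballP; exists e => //= y [/=]; rewrite /ball/= => h1 h2.
rewrite distrC in h1; rewrite distrC in h2.
have eN : e * (`|d1| + `|d2|) < r * n2.
  rewrite /e mulrAC ltr_pdivrMr// ltr_pM2l ?mulr_gt0// /N; lra.
rewrite -{1}(along_point t h) -{2}(across_point t h) /along /across.
split.
  rewrite -mulrBl normrM (gtr0_norm (_ : 0 < n2^-1)) ?invr_gt0//.
  rewrite ltr_pdivrMr// (le_lt_trans _ eN)// [leRHS]mulrDr.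
  rewrite [X in `|X|](_ : _ = (y.1 - (slit_point t h).1) * d1 +
    (y.2 - (slit_point t h).2) * d2); last by ring.
  by rewrite (le_trans (ler_normD _ _))// !normrM lerD// ler_wpM2r// ltW.
rewrite -mulrBl normrM (gtr0_norm (_ : 0 < n2^-1)) ?invr_gt0//.
rewrite ltr_pdivrMr// (le_lt_trans _ eN)// [leRHS]mulrDr.
rewrite [X in `|X|](_ : _ = (y.2 - (slit_point t h).2) * d1 -
  (y.1 - (slit_point t h).1) * d2); last by ring.
by rewrite (le_trans (ler_normB _ _))// !normrM lerD// ler_wpM2r// ltW.
Qed.

End Slit.

Lemma convex_comb_lt (R : realType) (r s u v : R) : 0 <= s <= 1 ->
  u < r -> v < r -> (1 - s) * u + s * v < r.
Proof.
move=> /andP[s0 s1] ur vr.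
apply: (@le_lt_trans _ _ (Num.max u v)); last by rewrite gt_max ur.
have h1 : (1 - s) * u <= (1 - s) * Num.max u v.
  by rewrite ler_wpM2l ?subr_ge0// le_max lexx.
have h2 : s * v <= s * Num.max u v by rewrite ler_wpM2l// le_max lexx orbT.
by move: h1 h2; lra.
Qed.

Section SlitSides.
Context {R : realType}.
Implicit Types (p q x y : R * R) (U : set (R * R)).
Variables (a b : R * R) (D : set (R * R)).
Hypotheses (ab : a != b) (oD : open D) (cD : connected D).

Let pt := slit_point a b.
Let U := D `\` segment a b.

Lemma open_slit_complement : open U.
Proof. by apply: openI => //; apply: closed_openC; exact: closed_segment. Qed.

(** Each half of a small box centred on the line of the slit is convex and misses the slit; the sign
    [s] selects the half. *)
Lemma half_box t : D (pt t 0) -> exists2 r : R, 0 < r &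
  forall s t1 h1 t2 h2, `|s| = 1 -> `|t1 - t| < r -> `|t2 - t| < r ->
    0 < h1 < r -> 0 < h2 < r ->
    connected_component U (pt t1 (s * h1)) (pt t2 (s * h2)).
Proof.
move=> /(open_slit_box oD)[r r0 hr]; exists r => // s t1 h1 t2 h2 s1.
rewrite !ltr_norml => /andP[t1l t1r] /andP[t2l t2r] /andP[h10 h1r] /andP[h20 h2r].
apply: component_of_segment => _ /segment_slit_points[c c01 ->].
have c01' := c01; move: c01' => /andP[c0 c1].
have -> : (1 - c) * (s * h1) + c * (s * h2) = s * ((1 - c) * h1 + c * h2) by ring.
have hpos : 0 < (1 - c) * h1 + c * h2.
  have := @convex_comb_lt R 0 c (- h1) (- h2) c01.
  by rewrite !oppr_lt0 => /(_ h10 h20); lra.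
split.
  apply: hr; last first.
    by rewrite subr0 normrM s1 mul1r gtr0_norm// convex_comb_lt.
  have := convex_comb_lt c01 t1r t2r.
  have := @convex_comb_lt R r c (t - t1) (t - t2) c01.
  move=> /(_ _ _)/= k1 k2; rewrite ltr_norml; apply/andP; split.
    by have := k1 ltac:(lra) ltac:(lra); lra.
  by move: k2; lra.
move=> /(slit_segmentP ab)[+ _]; rewrite across_point//.
move/eqP; rewrite mulf_eq0 (gt_eqF hpos) orbF => /eqP s0.
by move/eqP: s1; rewrite s0 normr0 eq_sym oner_eq0.
Qed.

(** A germ on the normal rather than a fixed point, because the admissible distance from the slit
    varies with [t]. *)
Definition reaches x (s t : R) := exists2 r : R, 0 < r &
  forall h, 0 < h < r -> connected_component U x (pt t (s * h)).

Lemma reaches_move x s t (r : R) t1 t2 : `|s| = 1 -> 0 < r ->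
  (forall s t1 h1 t2 h2, `|s| = 1 -> `|t1 - t| < r -> `|t2 - t| < r ->
    0 < h1 < r -> 0 < h2 < r ->
    connected_component U (pt t1 (s * h1)) (pt t2 (s * h2))) ->
  `|t1 - t| < r -> `|t2 - t| < r -> reaches x s t1 -> reaches x s t2.
Proof.
move=> s1 r0 hr ht1 ht2 [r1 r10 hr1]; exists r => // h hh.
pose k := Num.min r r1 / 2.
have m0 : 0 < Num.min r r1 by rewrite lt_min r0.
have kr : k < Num.min r r1 by rewrite /k; lra.
have k0 : 0 < k by rewrite /k; lra.
move: kr; rewrite lt_min => /andP[kr kr1].
apply: (connected_component_trans (y := pt t1 (s * k))).
  by apply: hr1; rewrite k0.
by apply: hr => //; rewrite k0.
Qed.

Lemma reaches_along x s (l r : R) t1 t2 : `|s| = 1 ->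
  (forall t, l <= t <= r -> D (pt t 0)) -> l <= t1 <= r -> l <= t2 <= r ->
  reaches x s t1 -> reaches x s t2.
Proof.
move=> s1 hD h1 h2.
apply: (@connected_locally_constant _ `[l, r]%classic (reaches x s)).
- exact: segment_connected.
- move=> t; rewrite /= in_itv/= => /hD/half_box[e e0 he].
  apply/nbhs_ballP; exists e => //= u; rewrite /ball/= distrC => ut _.
  have tt : `|t - t| < e by rewrite subrr normr0.
  by split; apply: reaches_move he _ _.
- by rewrite /= in_itv.
- by rewrite /= in_itv.
Qed.

(** A component whose closure missed the slit would be open and closed in [D], hence all of [D], yet
    the midpoint of the slit lies in [D] and not in the component. *)
Lemma component_touches_slit x : D (pt (1 / 2) 0) -> U x ->
  exists t s, [/\ 0 <= t <= 1, D (pt t 0), `|s| = 1 & reaches x s t].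
Proof.
move=> Dm Ux; have oU := open_slit_complement.
have [t [t01 Dt ht]] : exists t, [/\ 0 <= t <= 1, D (pt t 0) &
    closure (connected_component U x) (pt t 0)].
  apply: contrapT => nt.
  have ED : connected_component U x = D.
    apply: cD.
    - by exists x; exact: connected_component_refl.
    - exists (connected_component U x); first exact: open_component.
      by rewrite setIidr// => y /connected_component_sub[].
    - exists (closure (connected_component U x)); first exact: closed_closure.
      apply/seteqP; split => [y Cy|y [Dy cy]].
        split; last exact: subset_closure.
        by have [] := connected_component_sub Cy.
      have Uy : U y.
        split => // /(slit_segmentP ab)[y0 y01]; apply: nt.
        by exists (along a b y); split => //; rewrite /pt -y0 slit_pointK.
      have [w [Cw yw]] := cy _ (component_near oU Uy).
      by apply: connected_component_trans Cw _; exact: connected_component_sym.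
  have : connected_component U x (pt (1 / 2) 0) by rewrite ED.
  move=> /connected_component_sub[_]; apply.
  by apply/slit_segmentP => //; rewrite across_point// along_point//; split=> //; lra.
have [r r0 hr] := open_slit_box oD Dt.
have [r' r'0 hr'] := half_box Dt.
pose e := Num.min r r' / 2.
have m0 : 0 < Num.min r r' by rewrite lt_min r0.
have em : e < Num.min r r' by rewrite /e; lra.
have e0 : 0 < e by rewrite /e; lra.
move: em; rewrite lt_min => /andP[er er'].
have [y [Cy [yt]]] := ht _ (near_slit_point ab t 0 e0).
rewrite subr0 => yh.
have yt' : `|along a b y - t| < r' by exact: lt_trans er'.
have yE := slit_pointK ab y.
have [_ ny] := connected_component_sub Cy.
have tt : `|t - t| < r' by rewrite subrr normr0.
(* Here [y] is on the line of the slit but beyond one of its ends, so it can be lifted to either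
   side; side 1 is taken. *)
have [h0|hn0] := eqVneq (across a b y) 0.
  exists t, 1; split => //; first exact: normr1.
  apply: (reaches_move (normr1 _) r'0 hr' yt' tt).
  exists e => // h /andP[h00 he].
  apply: connected_component_trans Cy _; rewrite -{1}yE mul1r.
  apply: component_of_segment => _ /segment_slit_points[c c01 ->].
  rewrite h0 mulr0 add0r; have /andP[c0 c1] := c01.
  have -> : (1 - c) * along a b y + c * along a b y = along a b y by ring.
  split.
    apply: hr; first exact: lt_trans er.
    rewrite subr0 ger0_norm; last by rewrite mulr_ge0// ltW.
    by rewrite (le_lt_trans (ler_piMl _ c1)) ?(lt_trans he)// ltW.
  move=> /(slit_segmentP ab); rewrite along_point// across_point// => -[_ y01].
  by apply: ny; apply/slit_segmentP.
have sn : `|Num.sg (across a b y)| = 1 by rewrite normr_sg hn0.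
exists t, (Num.sg (across a b y)); split => //.
apply: (reaches_move sn r'0 hr' yt' tt).
exists e => // h /andP[h00 he].
apply: connected_component_trans Cy _; rewrite -{1}yE.
rewrite {1}[across a b y]numEsg; apply: hr' => //.
  by rewrite normr_gt0 hn0 (lt_trans yh).
by rewrite h00 (lt_trans he).
Qed.

(** The side first reached is followed along the slit to its midpoint. There are two sides, so at
    most two components; the ends of the slit may lie outside [D]. *)
Lemma two_sides x : (forall t, 0 < t < 1 -> D (pt t 0)) -> U x ->
  exists2 s, `|s| = 1 & reaches x s (1 / 2).
Proof.
move=> hD Ux.
have Dm : D (pt (1 / 2) 0) by apply: hD; lra.
have [t [s [t01 Dt s1 xt]]] := component_touches_slit Dm Ux.
exists s => //.
apply: (@reaches_along x s (Num.min t (1 / 2)) (Num.max t (1 / 2)) t) xt => //.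
- move=> u; rewrite ge_min le_max => /andP[tu ut].
  have [->//|ut'] := eqVneq u t.
  apply: hD; case/orP: tu; case/orP: ut; move: ut'; rewrite neq_lt; lra.
- by rewrite ge_min le_max lexx.
- by rewrite ge_min le_max lexx !orbT.
Qed.

(** The end [b] of the slit is now interior to [D], and one can walk around it from one side to the
    other. *)
Lemma slit_complement_connected : (forall t, 0 < t <= 1 -> D (pt t 0)) ->
  connected U.
Proof.
move=> hD.
have hD' t : 0 < t < 1 -> D (pt t 0).
  by move=> /andP[t0 t1]; apply: hD; rewrite t0 ltW.
have D1 : D (pt 1 0) by apply: hD; lra.
have [r r0 hr] := open_slit_box oD D1.
have [r' r'0 hr'] := half_box D1.
pose e := Num.min r r' / 2.
have m0 : 0 < Num.min r r' by rewrite lt_min r0.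
have em : e < Num.min r r' by rewrite /e; lra.
have e0 : 0 < e by rewrite /e; lra.
move: em; rewrite lt_min => /andP[er er'].
(* The line [along = 1 + e] lies beyond the free end and so misses the slit; whichever side is
   reached, it leads to the same point. *)
have side x : U x -> connected_component U x (pt (1 + e) e).
  move=> Ux; have [s s1 xs] := two_sides hD' Ux.
  have {xs} : reaches x s 1.
    apply: (@reaches_along x s (1 / 2) 1 (1 / 2)) xs => //; [|lra|lra].
    by move=> t t12; apply: hD; lra.
  move=> xs; have [||k k0 hk] := reaches_move s1 r'0 hr' _ _ xs (t2 := 1 + e).
  - by rewrite subrr normr0.
  - by rewrite addrAC subrr add0r gtr0_norm.
  pose l := Num.min e k / 2.
  have l0 : 0 < Num.min e k by rewrite lt_min e0.
  have lm : l < Num.min e k by rewrite /l; lra.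
  have lp : 0 < l by rewrite /l; lra.
  move: lm; rewrite lt_min => /andP[le lk].
  have hl : 0 < l < k by rewrite lp.
  apply: connected_component_trans (hk l hl) _.
  apply: component_of_segment => _ /segment_slit_points[c c01 ->].
  have /andP[c0 c1] := c01.
  have -> : (1 - c) * (1 + e) + c * (1 + e) = 1 + e by ring.
  have /andP[sl1 sl2] : -e < s * l < e.
    by rewrite -ltr_norml normrM s1 mul1r gtr0_norm.
  split.
    apply: hr; first by rewrite addrAC subrr add0r gtr0_norm.
    rewrite subr0 ltr_norml.
    have k1 := @convex_comb_lt R r c (s * l) e c01.
    have k2 := @convex_comb_lt R r c (- (s * l)) (- e) c01.
    have := k1 ltac:(lra) ltac:(lra); have := k2 ltac:(lra) ltac:(lra).
    by move=> ? ?; apply/andP; split; lra.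
  move=> /(slit_segmentP ab); rewrite along_point// => -[_ /andP[_]].
  by rewrite gerDl leNgt e0.
have [U0|/set0P[x Ux]] := eqVneq U set0; first by rewrite U0; exact: connected0.
suff -> : U = connected_component U x by exact: component_connected.
apply/seteqP; split => [y Uy|]; last exact: connected_component_sub.
apply: connected_component_trans (side x Ux) _.
exact/connected_component_sym/side.
Qed.

End SlitSides.

(** * The signed crossing number of a horizontal ray *)

Section CrossingNumber.
Context {R : realType}.
Implicit Types (p q x y : R * R) (z : nat -> R * R).

(* Signed crossing of the edge [p, q] with the horizontal ray going right from
   [x]; an edge contains its lower endpoint but not its upper one.  The last
   factor says that the edge meets the line of the ray to the right of [x]. *)
Definition crossing p q x : R :=
  ((x.2 < q.2)%R%:R - (x.2 < p.2)%R%:R) *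
  (0 < cross (q - p) (x - p) * (q.2 - p.2))%R%:R.

(* Moving [x] vertically past the height of a vertex [p] changes the crossings
   with both edges at [p]; the correction below compensates this, and cancels
   when summed along a closed polygon. *)
Definition vertex_term (x0 : R * R) p x : R :=
  (x0.1 < p.1)%R%:R * (x.2 < p.2)%R%:R.

Definition corrected_crossing x0 p q x : R :=
  crossing p q x - (vertex_term x0 q x - vertex_term x0 p x).

Lemma near_sign_affine (al be ga : R) (x0 : R * R) :
  al * x0.1 + be * x0.2 + ga != 0 ->
  \forall x \near x0, (0 < al * x.1 + be * x.2 + ga) =
                      (0 < al * x0.1 + be * x0.2 + ga).
Proof.
have cf : (fun x : R * R => al * x.1 + be * x.2 + ga) @ x0 -->
    al * x0.1 + be * x0.2 + ga.
  apply: cvgD; last exact: cvg_cst.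
  by apply: cvgD; (apply: cvgM; first exact: cvg_cst); [exact: cvg_fst|exact: cvg_snd].
rewrite neq_lt => /orP[h|h].
  near=> x.
  have hx : al * x.1 + be * x.2 + ga < 0 by near: x; exact: (cvgr_lt _ cf).
  by rewrite !ltNge !ltW.
near=> x.
have hx : 0 < al * x.1 + be * x.2 + ga by near: x; exact: (cvgr_gt _ cf).
by rewrite h hx.
Unshelve. all: by end_near. Qed.

Lemma near_below x0 p : p.2 != x0.2 ->
  \forall x \near x0, (x.2 < p.2) = (x0.2 < p.2).
Proof.
move=> h; have := @near_sign_affine 0 (-1) p.2 x0.
rewrite mul0r add0r mulN1r addrC subr_eq0 => /(_ h).
apply: filterS => x; rewrite mul0r add0r mulN1r.
by rewrite [- x.2 + _]addrC !subr_gt0.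
Qed.

Lemma cross_affine p q x : cross (q - p) (x - p) * (q.2 - p.2) =
  - (q.2 - p.2) ^+ 2 * x.1 + ((q.1 - p.1) * (q.2 - p.2)) * x.2 +
  ((q.2 - p.2) ^+ 2 * p.1 - (q.1 - p.1) * (q.2 - p.2) * p.2).
Proof. by rewrite /cross/=; ring. Qed.

Lemma ratio_itv (u v : R) : 0 <= u -> u <= v -> 0 < v -> 0 <= u / v <= 1.
Proof. by move=> u0 uv v0; rewrite divr_ge0 ?(ltW v0)//= ler_pdivrMr// mul1r. Qed.

Lemma segment_of_coord p q x (t : R) : 0 <= t <= 1 ->
  x.1 = p.1 + t * (q.1 - p.1) -> x.2 = p.2 + t * (q.2 - p.2) ->
  segment p q x.
Proof.
move=> t01 e1 e2; exists t; first by rewrite /= in_itv.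
rewrite [LHS]surjective_pairing [RHS]surjective_pairing/= /GRing.scale/=.
by congr pair; rewrite ?e1 ?e2; ring.
Qed.

(** If one endpoint is at the height of [x0], the last factor of the crossing is locally the
    comparison of abscissas in [vertex_term], so the jumps cancel. If both are, the edge is
    horizontal and both ends lie on the same side of [x0], so their terms cancel each other.
    Otherwise all signs that matter are locally constant. *)
Lemma corrected_crossing_near x0 p q : ~ segment p q x0 ->
  \forall x \near x0,
    corrected_crossing x0 p q x = corrected_crossing x0 p q x0.
Proof.
move=> npq.
have np : p.2 = x0.2 -> p.1 != x0.1.
  move=> e2; apply/eqP => e1; apply: npq.
  by apply: (@segment_of_coord _ _ _ 0); rewrite ?e1 ?e2 ?lexx ?ler01//; ring.
have nq : q.2 = x0.2 -> q.1 != x0.1.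
  move=> e2; apply/eqP => e1; apply: npq.
  by apply: (@segment_of_coord _ _ _ 1); rewrite ?e1 ?e2 ?lexx ?ler01//; ring.
have near_right : cross (q - p) (x0 - p) * (q.2 - p.2) != 0 ->
  \forall x \near x0, (0 < cross (q - p) (x - p) * (q.2 - p.2)) =
                      (0 < cross (q - p) (x0 - p) * (q.2 - p.2)).
  rewrite cross_affine => /near_sign_affine; apply: filterS => x.
  by rewrite -!cross_affine.
rewrite /corrected_crossing /crossing /vertex_term.
have [ep|hp] := eqVneq p.2 x0.2; have [eq|hq] := eqVneq q.2 x0.2.
- have ab : (x0.1 < q.1) = (x0.1 < p.1).
    have {}np := np ep; have {}nq := nq eq.
    have [e|e] := eqVneq q.1 p.1; first by rewrite e.
    apply/idP/idP => h; rewrite ltNge; apply/negP => h'; apply: npq.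
      have qp : q.1 - p.1 > 0 by lra.
      apply: (@segment_of_coord _ _ _ ((x0.1 - p.1) / (q.1 - p.1))).
      - by apply: ratio_itv; lra.
      - by field; rewrite gt_eqF.
      - by rewrite ep eq; ring.
    have pq : p.1 - q.1 > 0 by lra.
    apply: (@segment_of_coord _ _ _ ((p.1 - x0.1) / (p.1 - q.1))).
    - by apply: ratio_itv; lra.
    - by field; rewrite gt_eqF.
    - by rewrite ep eq; ring.
  by near=> x; rewrite ab ep eq; ring.
- have a1 := np ep.
  have e : cross (q - p) (x0 - p) * (q.2 - p.2) =
      (q.2 - p.2) ^+ 2 * (p.1 - x0.1) by rewrite /cross/= ep; ring.
  have d2 : 0 < (q.2 - p.2) ^+ 2.
    by rewrite lt_neqAle sqr_ge0 andbT eq_sym sqrf_eq0 subr_eq0 ep.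
  have ne : cross (q - p) (x0 - p) * (q.2 - p.2) != 0.
    by rewrite e mulf_neq0 ?subr_eq0// gt_eqF.
  near=> x.
  rewrite (near (near_right ne) x)//.
  have -> : (0 < cross (q - p) (x0 - p) * (q.2 - p.2)) = (x0.1 < p.1).
    by rewrite e pmulr_rgt0// subr_gt0.
  by rewrite (near (near_below hq) x)//; ring.
- have a1 := nq eq.
  have e : cross (q - p) (x0 - p) * (q.2 - p.2) =
      (q.2 - p.2) ^+ 2 * (q.1 - x0.1) by rewrite /cross/= eq; ring.
  have d2 : 0 < (q.2 - p.2) ^+ 2.
    by rewrite lt_neqAle sqr_ge0 andbT eq_sym sqrf_eq0 subr_eq0 eq eq_sym.
  have ne : cross (q - p) (x0 - p) * (q.2 - p.2) != 0.
    by rewrite e mulf_neq0 ?subr_eq0// gt_eqF.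
  near=> x.
  rewrite (near (near_right ne) x)//.
  have -> : (0 < cross (q - p) (x0 - p) * (q.2 - p.2)) = (x0.1 < q.1).
    by rewrite e pmulr_rgt0// subr_gt0.
  by rewrite (near (near_below hp) x)//; ring.
- have [uu|nu] := eqVneq (x0.2 < q.2) (x0.2 < p.2).
    near=> x.
    rewrite (near (near_below hp) x)// (near (near_below hq) x)// uu; ring.
  have ne : cross (q - p) (x0 - p) * (q.2 - p.2) != 0.
    have dn : q.2 - p.2 != 0.
      by apply: contra_neq nu => /eqP; rewrite subr_eq0 => /eqP ->.
    rewrite mulf_neq0//; apply/eqP => c0; apply: npq.
    apply: (@segment_of_coord _ _ _ ((x0.2 - p.2) / (q.2 - p.2))).
    - case: (ltP x0.2 q.2) nu; case: (ltP x0.2 p.2) => // h1 h2 _.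
        by apply: ratio_itv; lra.
      by rewrite -mulrNN -invrN; apply: ratio_itv; lra.
    - by move: c0; rewrite /cross/= => c0; apply: (mulIf dn);
        rewrite mulrDl mulrAC divfK//; lra.
    - by rewrite divfK//; ring.
  near=> x.
  by rewrite (near (near_below hp) x)// (near (near_below hq) x)//
    (near (near_right ne) x).
Unshelve. all: by end_near. Qed.

Definition crossing_number n z x : R := closed_sum (fun p q => crossing p q x) n z.

Lemma crossing_number_corrected n z x0 x : z n = z 0%N ->
  crossing_number n z x =
  closed_sum (fun p q => corrected_crossing x0 p q x) n z.
Proof.
move=> zn; rewrite /crossing_number /closed_sum /corrected_crossing sumrB.
rewrite (telescope_sumr (fun j => vertex_term x0 (z j) x))//.
by rewrite zn subrr subr0.
Qed.

Definition polyline n z : set (R * R) :=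
  \bigcup_(j in [set j | (j < n)%N]) segment (z j) (z j.+1).

Lemma near_forall_ord n (x0 : R * R) (P : 'I_n -> R * R -> Prop) :
  (forall j, \forall x \near x0, P j x) -> \forall x \near x0, forall j, P j x.
Proof. move=> h; exact: (@filter_forall _ _ P (nbhs x0) _ h). Qed.

Lemma crossing_number_near n z x0 : z n = z 0%N -> ~ polyline n z x0 ->
  \forall x \near x0, crossing_number n z x = crossing_number n z x0.
Proof.
move=> zn nx.
have : \forall x \near x0, forall j : 'I_n,
    corrected_crossing x0 (z j) (z j.+1) x =
    corrected_crossing x0 (z j) (z j.+1) x0.
  apply: near_forall_ord => j; apply: corrected_crossing_near => jx.
  by apply: nx; exists j => //=.
apply: filterS => x hx; rewrite !(crossing_number_corrected x0 _ zn).
by rewrite /closed_sum !big_mkord; apply: eq_bigr => j _; exact: hx.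
Qed.

(** Positive [h] is to the left of the oriented edge, negative [h] to the right. On a horizontal
    edge the crossing is zero and the jump comes from the vertex terms alone. *)
Lemma crossing_jump p q : p != q ->
  let m := slit_point p q (1 / 2) 0 in
  exists2 r : R, 0 < r & forall h, 0 < h < r ->
    corrected_crossing m p q (slit_point p q (1 / 2) h) =
    corrected_crossing m p q (slit_point p q (1 / 2) (- h)) + 1.
Proof.
move=> pq m.
have [d0|dn] := eqVneq (q.2 - p.2) 0.
  exists 1 => // h /andP[h0 _].
  have q2 : q.2 = p.2 by move/eqP: d0; rewrite subr_eq0 => /eqP.
  have d1 : q.1 - p.1 != 0.
    apply: contra_neq pq => /eqP; rewrite subr_eq0 => /eqP q1.
    by rewrite [p]surjective_pairing [q]surjective_pairing q1 q2.
  have cr0 x : crossing p q x = 0 by rewrite /crossing q2 subrr mul0r.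
  have vq x : vertex_term m q x = (0 < q.1 - p.1)%R%:R * (x.2 < p.2)%R%:R.
    rewrite /vertex_term q2 (_ : (m.1 < q.1) = (0 < q.1 - p.1))//.
    by rewrite /m /=; apply/idP/idP; lra.
  have vp x : vertex_term m p x = (q.1 - p.1 < 0)%R%:R * (x.2 < p.2)%R%:R.
    rewrite /vertex_term (_ : (m.1 < p.1) = (q.1 - p.1 < 0))//.
    by rewrite /m /= d0; apply/idP/idP; lra.
  have below k : ((slit_point p q (1 / 2) k).2 < p.2) = (k * (q.1 - p.1) < 0).
    by rewrite /slit_point/= d0; apply/idP/idP; lra.
  rewrite /corrected_crossing !cr0 !vq !vp !below mulNr oppr_lt0 pmulr_rgt0//.
  rewrite pmulr_rlt0//; case: (ltgtP (q.1 - p.1) 0) d1 => //= _ _; ring.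
(* Within this distance the height moves by less than half of that of the edge, so it stays between
   the heights of [p] and [q]. *)
pose r := `|q.2 - p.2| / (2 * (`|q.1 - p.1| + 1)).
have N0 : 0 < 2 * (`|q.1 - p.1| + 1) by rewrite mulr_gt0// ltr_wpDl.
have r0 : 0 < r by rewrite divr_gt0 ?normr_gt0.
have below k : `|k| < r ->
    ((slit_point p q (1 / 2) k).2 < p.2) = (q.2 - p.2 < 0) /\
    ((slit_point p q (1 / 2) k).2 < q.2) = (0 < q.2 - p.2).
  rewrite /r ltr_pdivlMr// => kr.
  have /andP[k1 k2] : - (`|q.2 - p.2| / 2) < k * (q.1 - p.1) < `|q.2 - p.2| / 2.
    by rewrite -ltr_norml normrM; have := normr_ge0 k; move: kr; lra.
  move: k1 k2; rewrite /slit_point/=.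
  have [dp|dp] := ltP 0 (q.2 - p.2); first rewrite gtr0_norm// => k1 k2.
    by split; apply/idP/idP; lra.
  rewrite ler0_norm// => k1 k2; have d0 : q.2 - p.2 < 0 by rewrite lt_neqAle dn.
  by split; apply/idP/idP; lra.
exists r => // h /andP[h0 hr].
have [p1 q1] := below h ltac:(by rewrite gtr0_norm).
have [p2 q2] := below (- h) ltac:(by rewrite normrN gtr0_norm).
rewrite /corrected_crossing /crossing /vertex_term p1 q1 p2 q2.
have n0 : 0 < (q.1 - p.1) ^+ 2 + (q.2 - p.2) ^+ 2.
  by rewrite ltr_wpDl ?sqr_ge0// lt_neqAle sqr_ge0 andbT eq_sym sqrf_eq0.
have e k : (0 < cross (q - p) (slit_point p q (1 / 2) k - p) * (q.2 - p.2)) =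
    (0 < k * (q.2 - p.2)).
  rewrite (_ : _ * _ = ((q.1 - p.1) ^+ 2 + (q.2 - p.2) ^+ 2) *
    (k * (q.2 - p.2))); last by rewrite /cross/slit_point/=; field.
  by rewrite pmulr_rgt0.
rewrite !e mulNr oppr_gt0 pmulr_rgt0// pmulr_rlt0//.
by case: (ltgtP (q.2 - p.2) 0) dn => //= _ _; ring.
Qed.

End CrossingNumber.

(** * The faces of a simple closed polygon *)

Section Jordan.
Context {R : realType}.
Implicit Types (p q x y : R * R) (z : nat -> R * R).

Lemma closed_polyline n z : closed (polyline n z).
Proof.
apply: closed_bigcup => [|j _]; last exact: closed_segment.
exact: finite_II.
Qed.

Lemma open_polylineC n z : open (~` polyline n z).
Proof. exact/closed_openC/closed_polyline. Qed.

Lemma polylineS n z :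
  polyline n.+1 z = polyline n z `|` segment (z n) (z n.+1).
Proof.
apply/seteqP; split => [x [j /= jn jx]|x [[j /= jn jx]|nx]].
- have [jn'|jn'] := ltnP j n; first by left; exists j.
  by right; have <- : j = n by lia.
- by exists j => //=; apply: ltn_trans jn _.
- by exists n => /=.
Qed.

Definition simple_seq n z :=
  (forall i j, (i < n)%N -> (j < n)%N -> z i = z j -> i = j) /\
  (forall i j, (i < n)%N -> (j < n)%N -> i <> j ->
    segment (z i) (z i.+1) `&` segment (z j) (z j.+1) `<=`
    [set z i; z i.+1] `&` [set z j; z j.+1]).

Lemma slit_point0_l p q : slit_point p q 0 0 = p.
Proof. by rewrite /slit_point !mul0r !addr0 subr0 -surjective_pairing. Qed.

Lemma slit_point1_r p q : slit_point p q 1 0 = q.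
Proof.
rewrite /slit_point !mul0r !mul1r subr0 addr0 [RHS]surjective_pairing.
by congr pair; ring.
Qed.

Lemma slit_point_inj p q t t' : p != q ->
  slit_point p q t 0 = slit_point p q t' 0 -> t = t'.
Proof. by move=> pq /(congr1 (along p q)); rewrite !along_point. Qed.

Lemma slit_point_in_segment p q (t : R) : 0 <= t <= 1 ->
  segment p q (slit_point p q t 0).
Proof. by move=> t01; exists t; rewrite ?slit_point_segment//= in_itv. Qed.

Section SimpleClosed.
Variables (n : nat) (z : nat -> R * R).
Hypotheses (n3 : (3 <= n)%N) (zn : z n = z 0%N) (sz : simple_seq n z).

Lemma consecutive_neq i : (i < n)%N -> z i != z i.+1.
Proof.
move=> i_n; apply/eqP => e; have [zi _] := sz.
have [e'|ne] := eqVneq i.+1 n.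
  have : i = 0%N by apply: zi => //; [lia|rewrite e e' zn].
  by lia.
have : i = i.+1 by apply: zi => //; lia.
by lia.
Qed.

(** Each new edge meets the previous arc at its starting point only, so removing it from the
    complement is a slit with a free end. *)
Lemma polylineC_connected k : (k < n)%N -> connected (~` polyline k z).
Proof.
elim: k => [|k ih] kn.
  rewrite (_ : polyline 0 z = set0); last by apply/seteqP; split => [x []|].
  rewrite setC0.
  rewrite (_ : setT = connected_component [set: R * R] 0); last first.
    by apply/seteqP; split => // x _; exact: component_of_segment.
  exact: component_connected.
rewrite polylineS setCU -setDE.
apply: slit_complement_connected.
- by apply: consecutive_neq; lia.
- exact: open_polylineC.
- by apply: ih; lia.
move=> t /andP[t0 t1] [j /= jk jx]; have [zi zs] := sz.
have pq : z k != z k.+1 by apply: consecutive_neq; lia.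
have [] := zs k j _ _ _ (slit_point (z k) (z k.+1) t 0).
- by lia.
- by lia.
- by lia.
- by split => //; apply: slit_point_in_segment; rewrite ltW.
move=> [/= e|/= e].
  by move: t0; rewrite (slit_point_inj pq (etrans e (esym (slit_point0_l _ _)))) ltxx.
rewrite e => -[/= e'|/= e'].
  by have := zi _ _ _ _ e'; lia.
by have := zi _ _ _ _ e'; lia.
Qed.

Let p := z n.-1.
Let q := z n.

Lemma polyline_last : polyline n z = polyline n.-1 z `|` segment p q.
Proof. by rewrite /p /q -{1}(prednK (_ : 0 < n)%N) ?polylineS ?prednK//; lia. Qed.

Lemma last_edge_neq : p != q.
Proof.
have h : (n.-1 < n)%N by lia.
by have := consecutive_neq h; rewrite prednK//; lia.
Qed.

Lemma last_edge_interior (t : R) : 0 < t < 1 ->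
  (~` polyline n.-1 z) (slit_point p q t 0).
Proof.
move=> /andP[t0 t1] [j /= jk jx]; have [zi zs] := sz.
have pq := last_edge_neq.
have ns : n.-1.+1 = n by lia.
have [] := zs n.-1 j _ _ _ (slit_point p q t 0).
- by lia.
- by lia.
- by lia.
- by rewrite ns; split => //; apply: slit_point_in_segment; rewrite !ltW.
rewrite ns -/p -/q => -[/= e|/= e] _.
  by move: t0; rewrite (slit_point_inj pq (etrans e (esym (slit_point0_l _ _)))) ltxx.
by move: t1; rewrite (slit_point_inj pq (etrans e (esym (slit_point1_r _ _)))) ltxx.
Qed.

Lemma crossing_number_component x y :
  connected_component (~` polyline n z) x y ->
  crossing_number n z x = crossing_number n z y.
Proof.
move=> xy.
have Ux : (~` polyline n z) x.
  by have := connected_component_sub (connected_component_sym xy).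
apply/esym; apply: (connected_locally_constant
  (component_connected (A := ~` polyline n z) (x := x))
  (P := fun y => crossing_number n z y = crossing_number n z x)
  _ (connected_component_refl Ux) xy) => // u /connected_component_sub Uu.
near=> v => _.
suff -> : crossing_number n z v = crossing_number n z u by [].
by near: v; apply: crossing_number_near.
Unshelve. all: by end_near. Qed.

(** The last edge has no free end, and both its sides may survive as components. They are
    represented by two points facing each other across its midpoint, where only the contribution of
    this edge jumps. *)
Lemma two_faces : exists pl mi, [/\
  crossing_number n z pl = crossing_number n z mi + 1 &
  forall x, (~` polyline n z) x ->
    connected_component (~` polyline n z) x pl \/
    connected_component (~` polyline n z) x mi].
Proof.
have pq := last_edge_neq.
have oD : open (~` polyline n.-1 z) by exact: open_polylineC.
have UE : ~` polyline n z = ~` polyline n.-1 z `\` segment p q.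
  by rewrite polyline_last setCU setDE.
set m := slit_point p q (1 / 2) 0.
have Dm : (~` polyline n.-1 z) m by apply: last_edge_interior; lra.
have nearm : \forall x \near m, forall j : 'I_n.-1,
    corrected_crossing m (z j) (z j.+1) x =
    corrected_crossing m (z j) (z j.+1) m.
  apply: near_forall_ord => j; apply: corrected_crossing_near => jx.
  by apply: Dm; exists j => /=.
have [r1 r10 h1] := open_slit_box (open_interior _) nearm.
have [r2 r20 h2] := crossing_jump pq.
have [r3 r30 h3] := half_box pq oD Dm.
(* Below [r1] the other edges contribute a constant, below [r2] the last one jumps, below [r3] the
   half boxes are connected. *)
pose h := Num.min r1 (Num.min r2 r3) / 2.
have m0 : 0 < Num.min r1 (Num.min r2 r3) by rewrite !lt_min r10 r20.
have h0 : 0 < h by rewrite /h; lra.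
have : h < Num.min r1 (Num.min r2 r3) by rewrite /h; lra.
rewrite !lt_min => /and3P[hr1 hr2 hr3].
exists (slit_point p q (1 / 2) h), (slit_point p q (1 / 2) (- h)); split.
  have split_last x : crossing_number n z x =
      closed_sum (fun u v => corrected_crossing m u v x) n.-1 z +
      corrected_crossing m p q x.
    rewrite (crossing_number_corrected m _ zn) /closed_sum.
    have e : n = n.-1.+1 by rewrite prednK// (leq_trans _ n3).
    by rewrite {1}e big_nat_recr//= -e.
  have const k : `|k| < r1 ->
      closed_sum (fun u v => corrected_crossing m u v (slit_point p q (1 / 2) k)) n.-1 z =
      closed_sum (fun u v => corrected_crossing m u v m) n.-1 z.
    move=> kr; have := h1 (1 / 2) k; rewrite subrr normr0 subr0 => /(_ r10 kr).
    move=> /interior_subset hk; rewrite /closed_sum !big_mkord.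
    by apply: eq_bigr => j _; exact: hk.
  rewrite !split_last !const ?normrN ?gtr0_norm//.
  by rewrite h2 ?h0// addrA.
move=> x; rewrite UE => Ux.
have nn : (n.-1 < n)%N by rewrite ltn_predL (leq_trans _ n3).
have [s s1 [r r0 xs]] :=
  two_sides pq oD (polylineC_connected nn) last_edge_interior Ux.
pose k := Num.min r h / 2.
have k0 : 0 < Num.min r h by rewrite lt_min r0.
have kp : 0 < k by rewrite /k; lra.
have : k < Num.min r h by rewrite /k; lra.
rewrite lt_min => /andP[kr kh].
have tt : `|1 / 2 - 1 / 2| < r3 by rewrite subrr normr0.
have xm : connected_component (~` polyline n.-1 z `\` segment p q) x
    (slit_point p q (1 / 2) (s * h)).
  apply: connected_component_trans (xs k _) _; first by rewrite kp.
  by apply: h3 => //; rewrite ?kp ?h0// (lt_trans kh).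
move: s1 xm => /eqP; rewrite eqr_norml ler01 andbT => /orP[]/eqP ->.
  by rewrite [1 * h]mul1r => xm; left.
by rewrite [-1 * h]mulN1r => xm; right.
Qed.

Variable M : R.
Hypothesis zM : forall j, `|(z j).1| <= M /\ `|(z j).2| <= M.

(** Above or below all vertices no edge spans the height of [x], and to their right no edge is met.
    To their left edges are met, but with the correction based at [x] itself all vertices have
    weight one and every summand cancels. *)
Lemma crossing_number_far x : M < `|x.1| \/ M < `|x.2| ->
  crossing_number n z x = 0.
Proof.
case; last first.
  move=> xM; apply: big1_seq => j _; rewrite /crossing.
  have [_ /ler_normlP[a3 a4]] := zM j.
  have [_ /ler_normlP[b3 b4]] := zM j.+1.
  rewrite (_ : (x.2 < (z j.+1).2) = (x.2 < (z j).2)) ?subrr ?mul0r//.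
  by move: xM; rewrite ltr_normr => /orP[h|h]; apply/idP/idP; lra.
move=> xM; rewrite (crossing_number_corrected x x zn) /closed_sum.
apply: big1_seq => j _; rewrite /corrected_crossing /crossing /vertex_term.
have [/ler_normlP[a1 a2] _] := zM j.
have [/ler_normlP[b1 b2] _] := zM j.+1.
move: (z j) (z j.+1) a1 a2 b1 b2 => u v a1 a2 b1 b2.
move: xM; rewrite ltr_normr => /orP[h|h].
  rewrite (_ : (x.1 < v.1) = false); last by apply/negbTE; rewrite -leNgt; lra.
  rewrite (_ : (x.1 < u.1) = false); last by apply/negbTE; rewrite -leNgt; lra.
  rewrite !mul0r !subr0; have [uv|uv] := eqVneq (x.2 < v.2) (x.2 < u.2).
    by rewrite uv subrr mul0r.
  rewrite (_ : (0 < _) = false) ?mulr0//; apply/negbTE; rewrite -leNgt.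
  rewrite /cross /=.
  move: uv; case: (ltP x.2 u.2) => uu; case: (ltP x.2 v.2) => vv // _.
    rewrite mulr_ge0_le0//; last by lra.
    have k1 := mulr_ge0 (_ : 0 <= u.2 - x.2) (_ : 0 <= x.1 - v.1).
    have k2 := mulr_ge0 (_ : 0 <= x.2 - v.2) (_ : 0 <= x.1 - u.1).
    by have := k1 ltac:(lra) ltac:(lra); have := k2 ltac:(lra) ltac:(lra); lra.
  rewrite mulr_le0_ge0//; last by lra.
  have k1 := mulr_ge0 (_ : 0 <= x.2 - u.2) (_ : 0 <= x.1 - v.1).
  have k2 := mulr_ge0 (_ : 0 <= v.2 - x.2) (_ : 0 <= x.1 - u.1).
  by have := k1 ltac:(lra) ltac:(lra); have := k2 ltac:(lra) ltac:(lra); lra.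
rewrite (_ : x.1 < v.1); last by lra.
rewrite (_ : x.1 < u.1); last by lra.
rewrite !mul1r; have [uv|uv] := eqVneq (x.2 < v.2) (x.2 < u.2).
  by rewrite uv !subrr mul0r subrr.
rewrite (_ : (0 < _)) ?mulr1 ?subrr//.
rewrite /cross /=.
move: uv; case: (ltP x.2 u.2) => uu; case: (ltP x.2 v.2) => vv // _.
  rewrite nmulr_lgt0; last by lra.
  have k1 := mulr_gt0 (_ : 0 < u.2 - x.2) (_ : 0 < v.1 - x.1).
  have k2 := mulr_ge0 (_ : 0 <= x.2 - v.2) (_ : 0 <= u.1 - x.1).
  by have := k1 ltac:(lra) ltac:(lra); have := k2 ltac:(lra) ltac:(lra); lra.
rewrite pmulr_lgt0; last by lra.
have k1 := mulr_ge0 (_ : 0 <= x.2 - u.2) (_ : 0 <= v.1 - x.1).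
have k2 := mulr_gt0 (_ : 0 < v.2 - x.2) (_ : 0 < u.1 - x.1).
by have := k1 ltac:(lra) ltac:(lra); have := k2 ltac:(lra) ltac:(lra); lra.
Qed.

End SimpleClosed.
End Jordan.

Section Faces.
Context {R : realType}.
Implicit Types (p q x y : R * R) (z : nat -> R * R).

Lemma bounded_setP (B : set (R * R)) :
  bounded_set B <-> exists M : R, forall x, B x -> `|x.1| <= M /\ `|x.2| <= M.
Proof.
split=> [[M [Mr hM]]|[M hM]].
  exists (M + 1) => x Bx; have := hM (M + 1) _ x Bx; rewrite ltrDl => /(_ ltr01).
  by rewrite /= prod_normE ge_max => /andP[].
exists M; split; first exact: num_real.
move=> K MK x /hM[x1 x2] /=; rewrite prod_normE ge_max.
by rewrite !(le_trans _ (ltW MK)).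
Qed.

Lemma polyline_box n z (M : R) x :
  (forall j, `|(z j).1| <= M /\ `|(z j).2| <= M) -> polyline n z x ->
  `|x.1| <= M /\ `|x.2| <= M.
Proof.
move=> zM [j /= _ [t /= tI <-]]; move: tI; rewrite in_itv/= => /andP[t0 t1].
have [a1 a2] := zM j; have [b1 b2] := zM j.+1.
have M0 : 0 <= M by exact: le_trans a1.
have aux (u v : R) : `|u| <= M -> `|v| <= M -> `|(1 - t) * u + t * v| <= M.
  move=> uM vM; rewrite (le_trans (ler_normD _ _))// !normrM.
  rewrite (ger0_norm t0) ger0_norm ?subr_ge0//.
  have h1 := ler_wpM2l (_ : 0 <= 1 - t) uM; have h2 := ler_wpM2l t0 vM.
  by have := h1 ltac:(rewrite subr_ge0; exact: t1); lra.
by rewrite /= /GRing.scale/=; split; apply: aux.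
Qed.

Variables (n : nat) (z : nat -> R * R) (M : R).
Hypotheses (n3 : (3 <= n)%N) (zn : z n = z 0%N).
Hypothesis zM : forall j, `|(z j).1| <= M /\ `|(z j).2| <= M.

Lemma unbounded_component_right (t : R) : M < t ->
  ~ bounded_set (connected_component (~` polyline n z) (t, 0)).
Proof.
move=> Mt /bounded_setP[K hK].
pose t' := Num.max t (K + 1).
have : connected_component (~` polyline n z) (t, 0) (t', 0).
  apply: component_of_segment => _ [s /= sI <-] /(polyline_box zM)[+ _].
  move: sI; rewrite in_itv/= => /andP[s0 s1].
  rewrite /GRing.scale/= => /ler_normlP[_].
  have tt : t <= t' by rewrite le_max lexx.
  have := ler_wpM2l s0 tt; lra.
move=> /hK[/= /ler_normlP[_ k] _].
have : K + 1 <= t' by rewrite le_max lexx orbT.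
by lra.
Qed.

Lemma crossing_number_unbounded x :
  (~` polyline n z) x ->
  ~ bounded_set (connected_component (~` polyline n z) x) ->
  crossing_number n z x = 0.
Proof.
move=> Ux nb.
have [y xy yM] : exists2 y, connected_component (~` polyline n z) x y &
    M < `|y.1| \/ M < `|y.2|.
  apply: contrapT => ne; apply: nb; apply/bounded_setP; exists M => y xy.
  by split; rewrite leNgt; apply/negP => h; apply: ne; exists y; auto.
by rewrite (crossing_number_component zn xy); exact: crossing_number_far zM _ _.
Qed.

(** One of the two faces contains a far point and has number 0; bounded components must be the other
    face. The sign records on which side of the last edge the unbounded face lies. *)
Lemma crossing_number_bounded : simple_seq n z ->
  exists2 s : R, s = 1 \/ s = -1 & forall x, (~` polyline n z) x ->
    bounded_set (connected_component (~` polyline n z) x) ->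
    crossing_number n z x = s.
Proof.
move=> sz; have [pl [mi [jump faces]]] := two_faces n3 zn sz.
pose f : R * R := (M + 1, 0).
have Mf : M < M + 1 by rewrite ltrDl.
have nbf := unbounded_component_right Mf.
have Uf : (~` polyline n z) f.
  by move=> /(polyline_box zM)[/ler_normlP[_ /=]]; lra.
have wf : crossing_number n z f = 0 by exact: crossing_number_unbounded.
have excl x y : connected_component (~` polyline n z) f y ->
    connected_component (~` polyline n z) x y ->
    ~ bounded_set (connected_component (~` polyline n z) x).
  move=> fy xy; rewrite (same_connected_component xy).
  by rewrite -(same_connected_component fy).
case: (faces f Uf) => fy; have := crossing_number_component zn fy; rewrite wf => w0.
  exists (-1); first by right.
  move=> x Ux bx; case: (faces x Ux) => xy; first by case: (excl _ _ fy xy bx).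
  by rewrite (crossing_number_component zn xy); move: jump; rewrite -w0; lra.
exists 1; first by left.
move=> x Ux bx; case: (faces x Ux) => xy; last by case: (excl _ _ fy xy bx).
by rewrite (crossing_number_component zn xy) jump -w0 add0r.
Qed.

End Faces.

(** * The shoelace formula *)

Section PlaneMeasure.
Context {R : realType}.
Implicit Types (p q x y : R * R) (z : nat -> R * R) (U : set (R * R)).

Definition rat_box (a b c d : rat) : set (R * R) :=
  `]ratr a, ratr b[%classic `*` `]ratr c, ratr d[%classic.

(** An open set is a countable union of boxes with rational corners, which belong to the product
    sigma-algebra; boxes not contained in [U] are replaced by the empty set. *)
Lemma measurable_open_plane U : open U -> measurable U.
Proof.
move=> oU.
rewrite (_ : U = \bigcup_a \bigcup_b \bigcup_c \bigcup_d
   (if `[< rat_box a b c d `<=` U >] then rat_box a b c d else set0)); last first.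
  apply/seteqP; split=> [x Ux|x [a _ [b _ [c _ [d _]]]]]; last first.
    by case: asboolP => // /(_ x).
  have [e [e0 he]] := openP_box oU Ux.
  have rat_between (u v : R) : u < v -> exists r : rat, u < ratr r < v.
    by move=> /rat_in_itvoo[r]; rewrite in_itv; exists r.
  have [a /andP[a1 a2]] := rat_between (x.1 - e) x.1 ltac:(lra).
  have [b /andP[b1 b2]] := rat_between x.1 (x.1 + e) ltac:(lra).
  have [c /andP[c1 c2]] := rat_between (x.2 - e) x.2 ltac:(lra).
  have [d /andP[d1 d2]] := rat_between x.2 (x.2 + e) ltac:(lra).
  exists a => //; exists b => //; exists c => //; exists d => //.
  rewrite asboolT; first by split; rewrite /= in_itv/= ?a2 ?c2.
  move=> y [/=]; rewrite !in_itv/= => /andP[y1 y2] /andP[y3 y4].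
  by apply: he; rewrite ltr_norml; apply/andP; split; lra.
do 4 (apply: bigcupT_measurable_rat => ?).
case: asboolP => // _; apply: measurableX; exact: measurable_itv.
Qed.

(** Horizontal sections are used because those of a trapezoid are intervals with one fixed end. *)
Lemma area_swap (X : set (R * R)) : measurable X ->
  area2 X = (\int[lebesgue_measure]_y lebesgue_measure (ysection X y))%E.
Proof.
move=> mX; rewrite /area2.
rewrite (product_measure_unique (m' := (lebesgue_measure \x^ lebesgue_measure)%E))//.
by move=> A B mA mB; exact: product_measure2E.
Qed.

Lemma measurable_closed_plane U : closed U -> measurable U.
Proof.
move=> cU; rewrite -[U]setCK; apply: measurableC.
by apply: measurable_open_plane; rewrite openC.
Qed.

(** A horizontal segment lies in a null line; any other has at most one point at each height. *)
Lemma area_segment p q : area2 (segment p q) = 0%E.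
Proof.
have mS : measurable (segment p q).
  by apply: measurable_closed_plane; exact: closed_segment.
have [e|ne] := eqVneq p.2 q.2.
  apply/eqP; rewrite eq_le measure_ge0 andbT.
  apply: (@le_trans _ _ (area2 ([set: R] `*` [set p.2]))).
    rewrite /area2; apply: le_measure; rewrite ?inE//.
      by apply: measurableX.
    move=> _ [t _ <-]; split => //=; rewrite /GRing.scale/= e; ring.
  by rewrite /area2 product_measure1E//= lebesgue_measure_set1 mule0.
rewrite area_swap//; apply: integral0_eq => y _.
apply/eqP; rewrite eq_le measure_ge0 andbT.
pose t := (y - p.2) / (q.2 - p.2).
rewrite -(lebesgue_measure_set1 ((1 - t) * p.1 + t * q.1)).
apply: le_measure; rewrite ?inE//; first exact: measurable_ysection.
move=> x; rewrite /ysection/= inE => -[u _ e].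
have qp : q.2 - p.2 != 0 by rewrite subr_eq0 eq_sym.
have := congr1 snd e; have := congr1 fst e; rewrite /= /GRing.scale/= => <- ey.
suff -> : t = u by [].
by rewrite /t -ey; field.
Qed.

Lemma area_polyline n z : area2 (polyline n z) = 0%E.
Proof.
elim: n => [|n ih].
  rewrite (_ : polyline 0 z = set0); last by apply/seteqP; split => [x []|].
  exact: measure0.
rewrite polylineS /area2 measureU0//.
- by apply: measurable_closed_plane; exact: closed_polyline.
- by apply: measurable_closed_plane; exact: closed_segment.
- exact: area_segment.
Qed.

Lemma crossing_swap p q x : crossing q p x = - crossing p q x.
Proof.
rewrite /crossing (_ : cross (p - q) (x - q) * (p.2 - q.2) =
  cross (q - p) (x - p) * (q.2 - p.2)); last by rewrite /cross/=; ring.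
by rewrite -mulNr opprB.
Qed.

Lemma crossing1P p q x : crossing p q x = 1 <->
  p.2 <= x.2 < q.2 /\ x.1 < p.1 + (q.1 - p.1) / (q.2 - p.2) * (x.2 - p.2).
Proof.
have side : p.2 < q.2 -> (0 < cross (q - p) (x - p) * (q.2 - p.2)) =
    (x.1 < p.1 + (q.1 - p.1) / (q.2 - p.2) * (x.2 - p.2)).
  move=> pq; have d0 : 0 < q.2 - p.2 by rewrite subr_gt0.
  rewrite pmulr_lgt0// (_ : cross _ _ = (q.2 - p.2) *
    (p.1 + (q.1 - p.1) / (q.2 - p.2) * (x.2 - p.2) - x.1)); last first.
    by rewrite /cross/=; field; rewrite gt_eqF.
  by rewrite pmulr_rgt0// subr_gt0.
rewrite /crossing; split.
  case: (ltP x.2 q.2) => h1; case: (ltP x.2 p.2) => h2 /=;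
    rewrite ?subrr ?subr0 ?sub0r ?mul0r ?mul1r ?mulN1r.
  - by move/eqP; rewrite eq_sym oner_eq0.
  - rewrite -side ?(le_lt_trans h2)//; case: (0 < _) => //=.
    by move/eqP; rewrite eq_sym oner_eq0.
  - case: (0 < _) => /=; last by rewrite oppr0 => /eqP; rewrite eq_sym oner_eq0.
    by move=> ?; exfalso; lra.
  - by move/eqP; rewrite eq_sym oner_eq0.
move=> [/andP[h1 h2]]; rewrite -side ?(le_lt_trans h1)// => ->.
by rewrite h2 ltNge h1 /= subr0 mul1r.
Qed.

(* The points between the line x = -M and the edge [p, q], if the edge goes up;
   empty if it goes down. *)
Definition trapezoid (M : R) p q : set (R * R) :=
  [set x | - M <= x.1 /\ crossing p q x = 1].

Lemma measurable_affine_gt0 (al be ga : R) :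
  measurable [set x : R * R | 0 < al * x.1 + be * x.2 + ga].
Proof.
apply: measurable_open_plane; rewrite openE => x /= x0.
have : al * x.1 + be * x.2 + ga != 0 by rewrite gt_eqF.
move=> /near_sign_affine h; near=> y.
suff : (0 < al * y.1 + be * y.2 + ga) = (0 < al * x.1 + be * x.2 + ga).
  by rewrite x0.
by near: y.
Unshelve. all: by end_near. Qed.

Lemma measurable_affine_ge0 (al be ga : R) :
  measurable [set x : R * R | 0 <= al * x.1 + be * x.2 + ga].
Proof.
have := measurableC (measurable_affine_gt0 (- al) (- be) (- ga)).
congr measurable; apply/seteqP; split => x /=; last by move=> ? ?; lra.
by move=> /negP; rewrite -leNgt; lra.
Qed.

Lemma measurable_trapezoid M p q : measurable (trapezoid M p q).
Proof.
pose X (y : R) : R := p.1 + (q.1 - p.1) / (q.2 - p.2) * (y - p.2).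
rewrite (_ : trapezoid M p q = [set x | - M <= x.1] `&` [set x | p.2 <= x.2] `&`
  ([set x | x.2 < q.2] `&` [set x | x.1 < X x.2])); last first.
  apply/seteqP; split => x.
    by move=> [? /crossing1P[/andP[]]].
  by move=> [[? xp] [xq ?]]; split => //; apply/crossing1P; split => //; apply/andP.
pose k := (q.1 - p.1) / (q.2 - p.2).
apply: measurableI; apply: measurableI.
- have := measurable_affine_ge0 1 0 M; congr measurable.
  by apply/seteqP; split => x /= h; lra.
- have := measurable_affine_ge0 0 1 (- p.2); congr measurable.
  by apply/seteqP; split => x /= h; lra.
- have := measurable_affine_gt0 0 (- 1) q.2; congr measurable.
  by apply/seteqP; split => x /= h; lra.
- have := measurable_affine_gt0 (- 1) k (p.1 - k * p.2); congr measurable.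
  by apply/seteqP; split => x /=; rewrite /X -/k => h; lra.
Qed.

(** The section at height [y] is [[- M, X y[], of length [X y + M], since [X y] is a convex
    combination of [p.1] and [q.1]. The maximum with 0 covers descending edges. *)
Lemma area_trapezoid (M : R) p q : - M <= p.1 -> - M <= q.1 ->
  area2 (trapezoid M p q) =
  (Num.max 0 (q.2 - p.2) * ((p.1 + q.1) / 2 + M))%:E.
Proof.
move=> pM qM; have [qp|pq] := leP q.2 p.2.
  rewrite max_l ?subr_le0// mul0r (_ : trapezoid M p q = set0) ?[LHS]measure0//.
  apply/seteqP; split => // x [_ /crossing1P[/andP[h1 h2] _]].
  by move: (lt_le_trans h2 qp); rewrite ltNge h1.
rewrite max_r ?subr_ge0 ?ltW// area_swap; last exact: measurable_trapezoid.
have d0 : 0 < q.2 - p.2 by rewrite subr_gt0.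
pose k := (q.1 - p.1) / (q.2 - p.2).
pose X (y : R) : R := p.1 + k * (y - p.2).
have kd : k * (q.2 - p.2) = q.1 - p.1 by rewrite /k divfK// gt_eqF.
have XM (y : R) : p.2 <= y <= q.2 -> 0 <= X y + M.
  move=> /andP[y1 y2]; rewrite -(pmulr_rge0 _ d0).
  have -> : (q.2 - p.2) * (X y + M) =
    (q.2 - y) * (p.1 + M) + (y - p.2) * (q.1 + M).
    rewrite /X; have -> : q.1 = p.1 + k * (q.2 - p.2) by rewrite kd; ring.
    by ring.
  by rewrite addr_ge0// mulr_ge0//; lra.
transitivity (\int[lebesgue_measure]_(t in `[p.2, q.2[) (X t + M)%:E)%E.
  rewrite [RHS]integral_mkcond; apply: eq_integral => y _.
  have [hy|hy] := boolP (p.2 <= y < q.2).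
    rewrite patchE mem_set; last by rewrite /= in_itv.
    rewrite (_ : ysection _ y = `[- M, X y[%classic); last first.
      apply/seteqP; split => x; rewrite /ysection/= inE.
        by move=> [/= xM /crossing1P[_ /= xX]]; rewrite in_itv/= xM.
      rewrite in_itv/= => /andP[xM xX]; split => //; apply/crossing1P.
      by split.
    rewrite lebesgue_measure_itv/= lte_fin.
    have := XM y _; move: hy => /andP[hy1 hy2]; rewrite hy1 (ltW hy2) => /(_ isT).
    case: ltP => h h'; first by rewrite -EFinB opprK.
    by congr _%:E; lra.
  rewrite patchE memNset; last by rewrite /= in_itv/=; exact/negP.
  rewrite (_ : ysection _ y = set0) ?measure0//.
  apply/seteqP; split => x //; rewrite /ysection/= inE.
  by move=> [/= xM /crossing1P[/= hy' _]]; rewrite hy' in hy.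
pose G (y : R) : R := (p.1 + M) * y + (k / 2) * (y - p.2) ^+ 2.
have dG (t : R) : is_derive t 1 G (X t + M).
  rewrite /G /X; apply: is_derive_eq.
  by rewrite /GRing.scale/=; field.
have cX : continuous (fun t : R => X t + M).
  move=> u; apply: cvgD; last exact: cvg_cst.
  apply: cvgD; first exact: cvg_cst.
  apply: cvgM; first exact: cvg_cst.
  by apply: cvgB => //; exact: cvg_cst.
have cG : continuous G.
  by move=> u; apply/differentiable_continuous/derivable1_diffP/ex_derive.
transitivity (\int[lebesgue_measure]_(t in `[p.2, q.2]) (X t + M)%:E)%E.
  apply: integral_itv_bndo_bndc.
  have mX := continuous_measurable_fun cX.
  have mE := (measurable_EFinP _ _).2 mX.
  exact: measurable_funS mE.
transitivity ((G q.2)%:E - (G p.2)%:E)%E; first apply: continuous_FTC2 => //.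
- exact: continuous_subspaceT.
- split; first by move=> t _; exact: ex_derive.
    by apply: cvg_at_right_filter; exact: cG.
  by apply: cvg_at_left_filter; exact: cG.
- by move=> t _; rewrite derive1E; exact: derive_val.
rewrite -EFinB; congr _%:E; rewrite /G.
have -> : q.1 = p.1 + k * (q.2 - p.2) by rewrite kd; ring.
by field.
Qed.

End PlaneMeasure.

(** * From crossing numbers to the enclosed area *)

Section AreaOfPolygon.
Context {R : realType}.
Implicit Types (p q x : R * R) (z : nat -> R * R) (A : set (R * R)).

Lemma unbounded_along_ray A x (v : R * R) : v.1 != 0 \/ v.2 != 0 ->
  (forall t, 0 <= t -> A (x + t *: v)) -> ~ bounded_set (connected_component A x).
Proof.
move=> v0 hA /bounded_setP[K hK].
have Ax t : 0 <= t -> connected_component A x (x + t *: v).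
  move=> t0; apply: component_of_segment => _ [s /= + <-].
  rewrite in_itv/= => /andP[s0 s1].
  have -> : (1 - s) *: x + s *: (x + t *: v) = x + (s * t) *: v.
    by rewrite scalerDr scalerA addrA -scalerDl subrK scale1r.
  by apply: hA; exact: mulr_ge0.
have big (a b : R) : b != 0 ->
    exists2 t : R, 0 <= t & K < `|a + t * b|.
  move=> b0; have nb : 0 < `|b| by rewrite normr_gt0.
  exists ((`|K| + `|a| + 1) / `|b|).
    by rewrite divr_ge0// addr_ge0// addr_ge0.
  rewrite addrC (lt_le_trans _ (lerB_normD _ _))// normrM gtr0_norm.
    by rewrite divfK ?gt_eqF//; have := ler_norm K; lra.
  by rewrite divr_gt0// ltr_wpDl// addr_ge0.
case: v0 => [/big|/big].
- move=> /(_ x.1)[t t0]; have [+ _] := hK _ (Ax t t0).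
  by rewrite /= /GRing.scale/= => h1 h2; have := lt_le_trans h2 h1; rewrite ltxx.
- move=> /(_ x.2)[t t0]; have [_ +] := hK _ (Ax t t0).
  by rewrite /= /GRing.scale/= => h1 h2; have := lt_le_trans h2 h1; rewrite ltxx.
Qed.

Definition filled n z : set (R * R) := polyline n z `|`
  [set x | (~` polyline n z) x /\
    bounded_set (connected_component (~` polyline n z) x)].

(** The complement is a union of unbounded components, each of them open. *)
Lemma closed_filled n z : closed (filled n z).
Proof.
rewrite -[filled n z]setCK; apply: open_closedC; rewrite openE => x nx.
have Ux : (~` polyline n z) x by move=> px; apply: nx; left.
have nb : ~ bounded_set (connected_component (~` polyline n z) x).
  by move=> bx; apply: nx; right.
near=> y; have xy : connected_component (~` polyline n z) x y.
  by near: y; apply: component_near => //; exact: open_polylineC.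
case; first exact: (connected_component_sub xy).
by move=> [_]; rewrite -(same_connected_component xy).
Unshelve. all: by end_near. Qed.

Lemma measurable_filled n z : measurable (filled n z).
Proof. by apply: measurable_closed_plane; exact: closed_filled. Qed.

(** A point outside the box escapes to infinity along a coordinate ray that avoids the curve. *)
Lemma filled_box n z (M : R) x :
  (forall j, `|(z j).1| <= M /\ `|(z j).2| <= M) -> filled n z x ->
  `|x.1| <= M /\ `|x.2| <= M.
Proof.
move=> zM [|[_ bx]]; first exact: polyline_box.
have M0 : 0 <= M by have [] := zM 0%N => + _; exact: le_trans.
have out (v : R * R) : v.1 != 0 \/ v.2 != 0 -> (forall t : R, 0 <= t ->
    M < `|x.1 + t * v.1| \/ M < `|x.2 + t * v.2|) -> False.
  move=> v0 hv; apply: (unbounded_along_ray v0 _ bx) => t /hv h.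
  move=> /(polyline_box zM)/=; rewrite /GRing.scale/= => -[h1 h2].
  by case: h; rewrite ltNge ?h1 ?h2.
split; rewrite leNgt; apply/negP; rewrite ltr_normr => /orP[] h.
- apply: (out (1, 0)) => [|t t0]; first by left; rewrite oner_neq0.
  by left; rewrite /= mulr1 ltr_normr; apply/orP; left; lra.
- apply: (out (-1, 0)) => [|t t0]; first by left; rewrite oppr_eq0 oner_neq0.
  by left; rewrite /= ltr_normr; apply/orP; right; lra.
- apply: (out (0, 1)) => [|t t0]; first by right; rewrite oner_neq0.
  by right; rewrite /= mulr1 ltr_normr; apply/orP; left; lra.
- apply: (out (0, -1)) => [|t t0]; first by right; rewrite oppr_eq0 oner_neq0.
  by right; rewrite /= ltr_normr; apply/orP; right; lra.
Qed.

(** Integration of an identity between counting functions that holds off a null set. It is written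
    with sums on both sides so that no difference of possibly infinite measures occurs. *)
Lemma measure_cover d (T : measurableType d) (mu : {measure set T -> \bar R})
    (n : nat) (F G : nat -> set T) (A N : set T) :
  (forall j, measurable (F j)) -> (forall j, measurable (G j)) ->
  measurable A -> measurable N -> mu N = 0%E ->
  (forall w, ~ N w -> \sum_(0 <= j < n) \1_(F j) w =
    \1_A w + \sum_(0 <= j < n) \1_(G j) w :> R) ->
  (\sum_(0 <= j < n) mu (F j) = mu A + \sum_(0 <= j < n) mu (G j))%E.
Proof.
move=> mF mG mA mN N0 h.
have mind (H : set T) : measurable H ->
    measurable_fun [set: T] (fun w => (\1_H w : R)%:E).
  move=> mH; apply/measurable_EFinP.
  exact: measurable_indic.
have msum (H : nat -> set T) : (forall j, measurable (H j)) ->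
    measurable_fun [set: T] (fun w => \sum_(0 <= j < n) (\1_(H j) w : R)%:E)%E.
  by move=> mH; apply: emeasurable_sum => j; exact: mind.
have sum_ge0 (H : nat -> set T) w :
    (0 <= \sum_(0 <= j < n) (\1_(H j) w : R)%:E)%E.
  by apply: sume_ge0 => j _; rewrite lee_fin.
have int_sum (H : nat -> set T) : (forall j, measurable (H j)) ->
    (\sum_(0 <= j < n) mu (H j) =
     \int[mu]_w \sum_(0 <= j < n) (\1_(H j) w)%:E)%E.
  move=> mH; rewrite ge0_integral_sum//.
  - by apply: eq_bigr => j _; rewrite integral_indic// setIT.
  - by move=> j; exact: mind.
rewrite (int_sum F mF) (int_sum G mG) -[A in mu A]setIT -integral_indic//.
rewrite -ge0_integralD => [|//|w _|||]; [|by rewrite lee_fin|exact: mind|by []|exact: msum].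
apply: ge0_ae_eq_integral => //.
- exact: msum.
- by apply: emeasurable_funD; [exact: mind|exact: msum].
- by move=> w _; rewrite adde_ge0// lee_fin.
exists N; split => // w /= /not_implyP[_ nx]; apply: contrapT => Nx; apply: nx.
by rewrite !sumEFin h// EFinD.
Qed.

Lemma area_cover n (F G : nat -> set (R * R)) (A N : set (R * R)) :
  (forall j, measurable (F j)) -> (forall j, measurable (G j)) ->
  measurable A -> measurable N -> area2 N = 0%E ->
  (forall x, ~ N x -> \sum_(0 <= j < n) \1_(F j) x =
    \1_A x + \sum_(0 <= j < n) \1_(G j) x :> R) ->
  (\sum_(0 <= j < n) area2 (F j) = area2 A + \sum_(0 <= j < n) area2 (G j))%E.
Proof.
move=> mF mG mA mN N0 h.
exact: (@measure_cover _ _ (@lebesgue_measure R \x @lebesgue_measure R)%E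
  n F G A N mF mG mA mN N0 h).
Qed.

Lemma edge_crossing_indic (M : R) p q x : - M <= x.1 ->
  crossing p q x = \1_(trapezoid M p q) x - \1_(trapezoid M q p) x.
Proof.
move=> xM; rewrite !indicE.
have e1 : (x \in trapezoid M p q) = (crossing p q x == 1).
  by apply/idP/eqP; rewrite inE; [case|split].
have e2 : (x \in trapezoid M q p) = (crossing p q x == -1).
  apply/idP/eqP; rewrite inE /trapezoid /= (crossing_swap p q).
    by move=> [_ /eqP]; rewrite eqr_oppLR => /eqP.
  by move=> ->; rewrite opprK.
rewrite e1 e2 /crossing.
have n1 : (1 == -1 :> R) = false by apply/negbTE; rewrite -subr_eq0 opprK; apply/eqP; lra.
have n1' : (-1 == 1 :> R) = false by rewrite eq_sym.
have z1 : (0 == 1 :> R) = false by rewrite eq_sym oner_eq0.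
have z2 : (0 == -1 :> R) = false by rewrite eq_sym oppr_eq0 oner_eq0.
by case: (_ < q.2); case: (_ < p.2); case: (0 < _);
  rewrite /= ?subrr ?subr0 ?sub0r ?mulr0 ?mul0r ?mulr1 ?eqxx ?n1 ?n1' ?z1 ?z2
    /= ?subr0 ?sub0r ?subrr.
Qed.

Lemma trapezoid_sum n z (M : R) : z n = z 0%N ->
  closed_sum (fun p q => (q.2 - p.2) * ((p.1 + q.1) / 2 + M)) n z =
  parea2 n z / 2.
Proof.
move=> zn; apply: (mulIf (_ : (2 : R) != 0)) => //; rewrite divfK//.
rewrite /parea2 /closed_sum mulr_suml.
(* Each doubled trapezoid term exceeds [cross] by an increment of [x y + 2 M y], which telescopes
   along a closed polygon. *)
have -> : \sum_(0 <= j < n) cross (z j) (z j.+1) =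
    \sum_(0 <= j < n) (cross (z j) (z j.+1) +
      (((z j.+1).1 * (z j.+1).2 + 2 * M * (z j.+1).2) -
       ((z j).1 * (z j).2 + 2 * M * (z j).2))).
  have := telescope_sumr (fun j => (z j).1 * (z j).2 + 2 * M * (z j).2) (leq0n n).
  by rewrite zn subrr => tele; rewrite [RHS]big_split/= tele addr0.
by apply: eq_bigr => j _; rewrite /cross; field.
Qed.

(** Off the curve, trapezoids of ascending edges minus those of descending ones count the crossing
    number, which is [s] inside and 0 outside. *)
Lemma area_filled n z (M : R) : (3 <= n)%N -> z n = z 0%N ->
  (forall j, `|(z j).1| <= M /\ `|(z j).2| <= M) -> simple_seq n z ->
  exists2 s : R, s = 1 \/ s = -1 & area (filled n z) = s * (parea2 n z / 2).
Proof.
move=> n3 zn zM sz.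
have [s s1 hs] := crossing_number_bounded n3 zn zM sz.
exists s => //.
pose F j := trapezoid M (z j) (z j.+1); pose G j := trapezoid M (z j.+1) (z j).
have FG x : ~ polyline n z x ->
    \sum_(0 <= j < n) \1_(F j) x - \sum_(0 <= j < n) \1_(G j) x =
    s * \1_(filled n z) x :> R.
  move=> nx; have [xM|xM] := leP (- M) x.1.
    rewrite -sumrB -(eq_bigr _ (fun j _ => edge_crossing_indic _ _ xM)).
    rewrite -[LHS]/(crossing_number n z x) indicE.
    have [bx|nb] := pselect (bounded_set (connected_component (~` polyline n z) x)).
      by rewrite (hs _ nx bx) mem_set ?mulr1//; right.
    rewrite (crossing_number_unbounded zn zM nx nb) memNset ?mulr0//.
    by case=> // -[].
  rewrite indicE memNset; last first.
    by move=> /(filled_box zM)[/ler_normlP[]]; lra.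
  rewrite !big1_seq ?subrr ?mulr0// => j _; rewrite indicE memNset//;
    by move=> [] /=; rewrite leNgt xM.
have mF j : measurable (F j) by exact: measurable_trapezoid.
have mG j : measurable (G j) by exact: measurable_trapezoid.
have mA := measurable_filled n z.
have mN : measurable (polyline n z).
  by apply: measurable_closed_plane; exact: closed_polyline.
have zM' j : - M <= (z j).1 by have [/ler_normlP[]] := zM j; lra.
have EF : (\sum_(0 <= j < n) area2 (F j) =
    (\sum_(0 <= j < n) Num.max 0 ((z j.+1).2 - (z j).2) *
      (((z j).1 + (z j.+1).1) / 2 + M))%:E)%E.
  by rewrite -sumEFin; apply: eq_bigr => j _; exact: area_trapezoid.
have EG : (\sum_(0 <= j < n) area2 (G j) =
    (\sum_(0 <= j < n) Num.max 0 ((z j).2 - (z j.+1).2) *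
      (((z j.+1).1 + (z j).1) / 2 + M))%:E)%E.
  by rewrite -sumEFin; apply: eq_bigr => j _; exact: area_trapezoid.
move: EF EG; set SF := (X in _ = X%:E -> _); set SG := (X in _ -> _ = X%:E -> _).
move=> EF EG.
have SFG : SF - SG = parea2 n z / 2.
  rewrite -(trapezoid_sum M zn) /SF /SG /closed_sum -sumrB; apply: eq_bigr => j _.
  rewrite [(z j.+1).1 + _]addrC -mulrBl; congr (_ * _).
  have [h|h] := leP (z j.+1).2 (z j).2.
    by rewrite max_l ?max_r ?subr_ge0 ?subr_le0//; ring.
  by rewrite max_r ?max_l ?subr_ge0 ?subr_le0 ?(ltW h)//; ring.
(* For [s = -1] the families [F] and [G] exchange roles, so that the area again appears as a
   positive summand. *)
rewrite /area -SFG; case: s1 => s1; move: FG; rewrite s1 => FG.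
  have := area_cover mF mG mA mN (area_polyline n z) (n := n).
  move=> h; have {}h : SF%:E = (area2 (filled n z) + SG%:E)%E.
    by rewrite -EF -EG; apply: h => x /FG; lra.
  move: h; case: (area2 _) => [r||] //= [->]; lra.
have := area_cover mG mF mA mN (area_polyline n z) (n := n).
move=> h; have {}h : SG%:E = (area2 (filled n z) + SF%:E)%E.
  by rewrite -EF -EG; apply: h => x /FG; lra.
by move: h; case: (area2 _) => [r||] //= [->]; lra.
Qed.

End AreaOfPolygon.

(** * Nearly regular polygons *)

Section SignedStability.
Context {R : realType}.
Implicit Types (p q u v : R * R) (z : nat -> R * R).

Definition mirror u : R * R := (u.1, - u.2).

Lemma edist_mirror p q : edist (mirror p) (mirror q) = edist p q.
Proof. by rewrite !edistE /=; congr Num.sqrt; ring. Qed.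

Lemma plen_mirror n z : plen n (mirror \o z) = plen n z.
Proof. by apply: eq_bigr => j _; exact: edist_mirror. Qed.

Lemma psumsq_mirror n z : psumsq n (mirror \o z) = psumsq n z.
Proof. by apply: eq_bigr => j _; rewrite /= edist_mirror. Qed.

Lemma parea2_mirror n z : parea2 n (mirror \o z) = - parea2 n z.
Proof.
rewrite /parea2 /closed_sum -sumrN; apply: eq_bigr => j _.
by rewrite /cross/=; ring.
Qed.

Lemma mirror_rotv q t p :
  mirror (q + rotv t p) = mirror q + rotv (- t) (mirror p).
Proof.
rewrite /mirror /rotv cosN sinN /=; apply/pair_equal_spec; split; rewrite /=; ring.
Qed.

Lemma mirrorK : involutive mirror.
Proof. by move=> [a b]; rewrite /mirror/= opprK. Qed.

Lemma isoperimetric_signed n z (s : R) : (2 <= n)%N -> z n = z 0%N ->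
  s = 1 \/ s = -1 -> s * parea2 n z <= iso_const n * plen n z ^+ 2.
Proof.
move=> n2 zn [->|->]; first by rewrite mul1r; exact: isoperimetric.
rewrite mulN1r -parea2_mirror -plen_mirror; apply: isoperimetric => //.
by rewrite /= zn.
Qed.

(** Mirroring negates the signed area and reverses rotations, which reduces [s = -1] to [s = 1]. The
    factor [1 + K] accounts for passing from the square deficit to squared distances. *)
Lemma stability_signed n : (3 <= n)%N ->
  exists e C : R, [/\ 0 < e, 0 < C & forall (s : R) z, s = 1 \/ s = -1 ->
    z n = z 0%N -> 0 < plen n z ->
    let d := iso_const n * plen n z ^+ 2 - s * parea2 n z in
    d <= e * plen n z ^+ 2 ->
    n%:R * psumsq n z - plen n z ^+ 2 <= C * d /\
    exists p q, forall j, (j <= n)%N ->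
      edist (q + rotv (s * (j%:R * (2 * step_angle n))) p) (z j) ^+ 2 <= C * d].
Proof.
move=> n3; have [e [C [e0 C0 H]]] := isoperimetric_stability n3 (R := R).
have n0 : (0 : R) < n%:R by rewrite ltr0n; lia.
have s0 : 0 < sin (step_angle n : R) by apply: sin_step_gt0; lia.
pose K : R := (n%:R / sin (step_angle n)) ^+ 2.
have K0 : 0 < K by rewrite exprn_gt0// divr_gt0.
have aux z (d : R) : z n = z 0%N -> 0 <= d ->
    n%:R * psumsq n z - plen n z ^+ 2 <= C * d -> square_deficit n z <= C * d ->
    n%:R * psumsq n z - plen n z ^+ 2 <= C * (1 + K) * d /\
    exists p q, forall j, (j <= n)%N ->
      edist (q + rotv (j%:R * (2 * step_angle n)) p) (z j) ^+ 2 <= C * (1 + K) * d.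
  move=> zn d0 h1 h2; have Cd : 0 <= C * d by rewrite mulr_ge0// ltW.
  have KCd : 0 <= K * (C * d) by rewrite mulr_ge0// ltW.
  split; first by move: h1; lra.
  have [_ [p [q pq]]] := near_regular n3 zn; exists p, q => j jn.
  apply: (le_trans (pq j jn)); rewrite -/K.
  apply: (@le_trans _ _ (K * (C * d))); first by rewrite ler_pM2l.
  by lra.
exists e, (C * (1 + K)); split => //; first by rewrite mulr_gt0// addr_gt0.
move=> s z s1 zn zl d dle.
have d0 : 0 <= d.
  by rewrite subr_ge0; apply: isoperimetric_signed => //; lia.
case: s1 @d dle d0 => ->.
  move=> d dle d0; have [|h1 h2] := H z zn zl; first by move: dle; rewrite /d mul1r.
  rewrite -[parea2 n z]mul1r -/d in h1 h2.
  have [k1 [p [q pq]]] := aux z d zn d0 h1 h2.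
  by split => //; exists p, q => j jn; rewrite mul1r; exact: pq.
move=> d dle d0.
have mzn : (mirror \o z) n = (mirror \o z) 0%N by rewrite /= zn.
have dE : iso_const n * plen n z ^+ 2 - - parea2 n z = d by rewrite /d mulN1r.
have := H (mirror \o z) mzn; rewrite plen_mirror parea2_mirror psumsq_mirror.
rewrite dE => /(_ zl dle)[h1 h2].
have := aux (mirror \o z) d mzn d0; rewrite plen_mirror psumsq_mirror.
move=> /(_ h1 h2)[k1 [p [q pq]]]; split => //.
exists (mirror p), (mirror q) => j jn.
rewrite -edist_mirror mirror_rotv !mirrorK mulN1r opprK.
exact: pq.
Qed.

Lemma edist_coord p q (E : R) : 0 <= E -> edist p q ^+ 2 <= E ^+ 2 ->
  `|q.1 - p.1| <= E /\ `|q.2 - p.2| <= E.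
Proof.
move=> E0; rewrite edist_sqr => h.
have h1 := sqr_ge0 (q.1 - p.1); have h2 := sqr_ge0 (q.2 - p.2).
split; apply: ler_of_sqr => //; rewrite real_normK ?num_real//; lra.
Qed.

Lemma edist_rotv q t p : edist q (q + rotv t p) = edist 0 p.
Proof.
apply: eqr_of_sqr; rewrite ?edist_ge0// !edist_sqr /rotv/=.
have := cos2Dsin2 t; move: (cos t) (sin t) => x y xy.
by rewrite !subr0 -[RHS]mul1r -xy; ring.
Qed.

Lemma rotv_turn n (s : R) p : (0 < n)%N -> s = 1 \/ s = -1 ->
  rotv (s * (n%:R * (2 * step_angle n))) p =
  rotv (s * (0%:R * (2 * step_angle n))) p.
Proof.
move=> n0 s1; rewrite (_ : n%:R * (2 * step_angle n) = pi *+ 2).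
  rewrite /rotv mul0r mulr0 cos0 sin0.
  by case: s1 => ->; rewrite ?mulN1r ?[1 * (_ *+ 2)]mul1r ?cosN ?sinN cos2pi sin2pi ?oppr0.
by rewrite mulrCA step_angle_total// mulr2n; ring.
Qed.

(** The sum is fixed by the rotation through [th], while identity minus this rotation has
    determinant [4 sin^2 a], which is nonzero. *)
Lemma sum_rotv0 n (s : R) p : (3 <= n)%N -> s = 1 \/ s = -1 ->
  (\sum_(j < n) rotv (s * (j%:R * (2 * step_angle n))) p).1 = 0 /\
  (\sum_(j < n) rotv (s * (j%:R * (2 * step_angle n))) p).2 = 0.
Proof.
move=> n3 s1; set a := step_angle n.
pose f j := rotv (s * (j%:R * (2 * a))) p.
pose th := s * (2 * a).
have fS j : f j.+1 = rotv th (f j).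
  rewrite /f (_ : s * (j.+1%:R * (2 * a)) = th + s * (j%:R * (2 * a))).
    by rewrite /rotv cosD sinD /=; congr pair; ring.
  by rewrite -natr1 /th; ring.
have fn : f n = f 0%N.
  by apply: rotv_turn => //; lia.
have S1 : (\sum_(j < n) f j).1 = \sum_(j < n) (f j).1.
  by apply: (big_morph fst) => // x y.
have S2 : (\sum_(j < n) f j).2 = \sum_(j < n) (f j).2.
  by apply: (big_morph snd) => // x y.
pose X := \sum_(j < n) (f j).1; pose Y := \sum_(j < n) (f j).2.
have shift (g : R * R -> R) : \sum_(j < n) g (f j.+1) = \sum_(j < n) g (f j).
  have := telescope_sumr (fun j => g (f j)) (leq0n n).
  by rewrite big_mkord fn subrr sumrB => /eqP; rewrite subr_eq0 => /eqP.
have cE : cos th = 1 - 2 * sin a ^+ 2.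
  have -> : cos th = cos (a + a).
    by rewrite /th; case: s1 => ->; rewrite ?mulN1r ?mul1r ?cosN; congr (cos _); ring.
  by rewrite cosD -!expr2 cos2sin2; ring.
have sE : sin th ^+ 2 = 1 - cos th ^+ 2 by exact: sin2cos2.
have XE : X = cos th * X - sin th * Y.
  rewrite {1}/X -(shift fst) /X /Y 2!mulr_sumr -sumrB.
  by apply: eq_bigr => j _; rewrite fS.
have YE : Y = sin th * X + cos th * Y.
  rewrite {1}/Y -(shift snd) /X /Y 2!mulr_sumr -big_split.
  by apply: eq_bigr => j _; rewrite fS.
have sa : sin a != 0 by rewrite gt_eqF// sin_step_gt0//; lia.
have k0 : 4 * sin a ^+ 2 != 0 by rewrite mulf_neq0// expf_neq0.
have kE : (1 - cos th) ^+ 2 + sin th ^+ 2 = 4 * sin a ^+ 2.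
  by rewrite sE cE; ring.
have XE' : (1 - cos th) * X = - (sin th * Y) by rewrite mulrBl mul1r {1}XE; ring.
have YE' : (1 - cos th) * Y = sin th * X by rewrite mulrBl mul1r {1}YE; ring.
rewrite S1 S2 -/X -/Y; split; apply: (mulfI k0); rewrite mulr0 -kE mulrDl.
  rewrite expr2 -mulrA XE' mulrN mulrCA YE'; ring.
rewrite expr2 -mulrA YE' mulrCA XE'; ring.
Qed.

Section NearRegularPolygon.
Variables (n : nat) (P : polygon R n) (s : R) (p q : R * R) (E : R).
Hypotheses (n3 : (3 <= n)%N) (s1 : s = 1 \/ s = -1) (E0 : 0 <= E).

Let w (j : nat) := q + rotv (s * (j%:R * (2 * step_angle n))) p.

(** The regular polygon has its centroid at [q], so that of [P] is within [E] of [q] in each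
    coordinate, hence within [2 E], and every radius is within [3 E] of [rho]. A variance is at most
    the mean square deviation from any constant. *)
Lemma radius_variance_le : (forall j : 'I_n, edist (w j) (P j) ^+ 2 <= E ^+ 2) ->
  radius_variance P <= 9 * E ^+ 2.
Proof.
move=> hw; have n0 : (0 : R) < n%:R by rewrite ltr0n; lia.
have nu : n%:R != 0 :> R by rewrite gt_eqF.
set c := centroid P.
have coord := fun j => edist_coord E0 (hw j).
have [z1 z2] := sum_rotv0 p n3 s1.
have S1 (f : 'I_n -> R * R) : (\sum_j f j).1 = \sum_j (f j).1.
  by apply: (big_morph fst) => // x y.
have S2 (f : 'I_n -> R * R) : (\sum_j f j).2 = \sum_j (f j).2.
  by apply: (big_morph snd) => // x y.
have z1' : \sum_(j < n) (rotv (s * (j%:R * (2 * step_angle n))) p).1 = 0.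
  by rewrite -S1.
have z2' : \sum_(j < n) (rotv (s * (j%:R * (2 * step_angle n))) p).2 = 0.
  by rewrite -S2.
have avg (g : 'I_n -> R) : (forall j, `|g j| <= E) ->
    `|n%:R^-1 * \sum_j g j| <= E.
  move=> hg; rewrite normrM ger0_norm ?invr_ge0 ?(ltW n0)// ler_pdivrMl//.
  rewrite (le_trans (ler_norm_sum _ _ _))//.
  rewrite (le_trans (ler_sum _ (fun j _ => hg j)))//.
  by rewrite sumr_const card_ord mulr_natl.
have c1 : `|c.1 - q.1| <= E.
  have -> : c.1 - q.1 = n%:R^-1 * \sum_j ((P j).1 - (w j).1).
    rewrite sumrB (_ : \sum_(j < n) (w j).1 = n%:R * q.1); last first.
      rewrite (eq_bigr (fun j : 'I_n => q.1 +
        (rotv (s * (j%:R * (2 * step_angle n))) p).1))//.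
      by rewrite big_split z1' /= addr0 sumr_const card_ord mulr_natl.
    have -> : c.1 = n%:R^-1 * \sum_j (P j).1.
      by rewrite /c /centroid -S1.
    by field.
  by apply: avg => j; have [] := coord j.
have c2 : `|c.2 - q.2| <= E.
  have -> : c.2 - q.2 = n%:R^-1 * \sum_j ((P j).2 - (w j).2).
    rewrite sumrB (_ : \sum_(j < n) (w j).2 = n%:R * q.2); last first.
      rewrite (eq_bigr (fun j : 'I_n => q.2 +
        (rotv (s * (j%:R * (2 * step_angle n))) p).2))//.
      by rewrite big_split z2' /= addr0 sumr_const card_ord mulr_natl.
    have -> : c.2 = n%:R^-1 * \sum_j (P j).2.
      by rewrite /c /centroid -S2.
    by field.
  by apply: avg => j; have [] := coord j.
have cq : edist q c <= 2 * E.
  apply: ler_of_sqr; first by rewrite mulr_ge0.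
  rewrite edist_sqr exprMn.
  have h1 : (c.1 - q.1) ^+ 2 <= E ^+ 2.
    by rewrite -real_normK ?num_real// ler_sqr ?nnegrE.
  have h2 : (c.2 - q.2) ^+ 2 <= E ^+ 2.
    by rewrite -real_normK ?num_real// ler_sqr ?nnegrE.
  by have := sqr_ge0 E; lra.
pose rho := edist 0 p.
have qw j : edist q (w j) = rho by exact: edist_rotv.
have rj j : `|radius P j - rho| <= 3 * E.
  have wp : edist (w j) (P j) <= E by apply: ler_of_sqr.
  have t1 := edist_triangle q c (P j); have t2 := edist_triangle (w j) q (P j).
  have t3 := edist_triangle c q (w j); have t4 := edist_triangle (P j) c (w j).
  rewrite (edistC c q) in t1; rewrite (edistC (P j)) in t4.
  by rewrite /radius -/c ler_norml -(qw j); apply/andP; split; lra.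
have -> : radius_variance P = n%:R^-1 * (\sum_j (radius P j - rho) ^+ 2) -
    (n%:R^-1 * \sum_j (radius P j - rho)) ^+ 2.
  rewrite /radius_variance sumrB sumr_const card_ord -mulr_natl.
  have -> : \sum_j (radius P j - rho) ^+ 2 =
      \sum_j radius P j ^+ 2 - 2 * rho * \sum_j radius P j + n%:R * rho ^+ 2.
    have -> : n%:R * rho ^+ 2 = \sum_(j < n) rho ^+ 2.
      by rewrite sumr_const card_ord mulr_natl.
    by rewrite mulr_sumr -sumrB -big_split/=; apply: eq_bigr => j _; ring.
  by field.
apply: (@le_trans _ _ (n%:R^-1 * (\sum_j (radius P j - rho) ^+ 2))).
  by rewrite gerBl sqr_ge0.
rewrite ler_pdivrMl// (le_trans (ler_sum _ (_ : forall j, xpredT j ->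
    (radius P j - rho) ^+ 2 <= 9 * E ^+ 2)))//.
  move=> j _; rewrite -real_normK ?num_real//.
  have -> : 9 * E ^+ 2 = (3 * E) ^+ 2 by ring.
  by rewrite ler_sqr ?nnegrE// mulr_ge0.
by rewrite sumr_const card_ord -[leLHS]mulr_natl.
Qed.

End NearRegularPolygon.

End SignedStability.

(** * Polygons close to a regular one are strictly convex *)

Section NearRegularConvex.
Context {R : realType}.
Implicit Types (p q u v : R * R).

(** Twice the area of a triangle inscribed in the unit circle, with vertices at the angles 0, [2 A]
    and [2 B]. *)
Lemma sin_triple_product (A B : R) :
  sin (2 * (B - A)) + sin (2 * A) - sin (2 * B) =
  4 * sin A * (sin B * sin (B - A)).
Proof.
have dbl (x : R) : sin (2 * x) = 2 * (sin x * cos x).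
  by rewrite (_ : 2 * x = x + x) ?sinD; ring.
rewrite !dbl sinB cosB.
have hA : cos A ^+ 2 = 1 - sin A ^+ 2 by exact: cos2sin2.
have hB : cos B ^+ 2 = 1 - sin B ^+ 2 by exact: cos2sin2.
have -> : 2 * ((sin B * cos A - cos B * sin A) * (cos B * cos A + sin B * sin A)) =
  2 * (sin B * cos B * (cos A ^+ 2 - sin A ^+ 2) +
       sin A * cos A * (sin B ^+ 2 - cos B ^+ 2)) by ring.
by rewrite hA hB; ring.
Qed.

Lemma sin_sign (s x : R) : s = 1 \/ s = -1 -> s * sin (s * x) = sin x.
Proof. by case=> ->; rewrite ?mul1r// !mulN1r sinN opprK. Qed.

Lemma cross_rotv p q (T X Y : R) :
  cross (q + rotv X p - (q + rotv T p)) (q + rotv Y p - (q + rotv T p)) =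
  (p.1 ^+ 2 + p.2 ^+ 2) * (sin (Y - X) + sin (X - T) - sin (Y - T)).
Proof. by rewrite !sinB /cross /rotv /=; ring. Qed.

Lemma mul_perturb (x y x' y' a b : R) : `|x| <= a -> `|y| <= a ->
  `|x' - x| <= b -> `|y' - y| <= b -> `|x' * y' - x * y| <= 2 * a * b + b ^+ 2.
Proof.
move=> xa ya hx hy.
have -> : x' * y' - x * y = x * (y' - y) + y * (x' - x) + (x' - x) * (y' - y).
  by ring.
have h1 : `|x * (y' - y)| <= a * b by rewrite normrM ler_pM.
have h2 : `|y * (x' - x)| <= a * b by rewrite normrM ler_pM.
have h3 : `|(x' - x) * (y' - y)| <= b * b by rewrite normrM ler_pM.
rewrite (le_trans (ler_normD _ _))//.
by have := ler_normD (x * (y' - y)) (y * (x' - x)); lra.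
Qed.

Lemma cross_perturb u v u' v' (a b : R) :
  `|u.1| <= a -> `|u.2| <= a -> `|v.1| <= a -> `|v.2| <= a ->
  `|u'.1 - u.1| <= b -> `|u'.2 - u.2| <= b ->
  `|v'.1 - v.1| <= b -> `|v'.2 - v.2| <= b ->
  `|cross u' v' - cross u v| <= 4 * a * b + 2 * b ^+ 2.
Proof.
move=> u1 u2 v1 v2 h1 h2 h3 h4.
have k1 := mul_perturb u1 v2 h1 h4; have k2 := mul_perturb u2 v1 h2 h3.
rewrite /cross (_ : _ - _ - _ = (u'.1 * v'.2 - u.1 * v.2) -
  (u'.2 * v'.1 - u.2 * v.1)); last by ring.
by rewrite (le_trans (ler_normB _ _))//; lra.
Qed.

(** The sign [s] is the orientation; every edge strictly separates the other vertices from its outer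
    side. *)
Definition strictly_convex n (s : R) (P : polygon R n) :=
  forall i j, j != i -> j != ordS i ->
    0 < s * cross (P (ordS i) - P i) (P j - P i).

Section Polygon.
Variables (n : nat) (P : polygon R n) (s : R) (p q : R * R) (E : R).
Hypotheses (n3 : (3 <= n)%N) (s1 : s = 1 \/ s = -1) (E0 : 0 <= E).

Let a : R := step_angle n.
Let w (j : nat) := q + rotv (s * (j%:R * (2 * a))) p.

(** The triangle has area factor [4 sin a sin B sin (B - a)], where [B] is a multiple of [a].
    Excluding the two ends of the edge keeps both sines at least [sin a] in absolute value, and they
    have the same sign. *)
Lemma regular_cross (i j : 'I_n) : j != i -> j != ordS i ->
  4 * sin a ^+ 3 * edist 0 p ^+ 2 <= s * cross (w (ordS i) - w i) (w j - w i).
Proof.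
move=> ji jSi; have sa : 0 < sin a by apply: sin_step_gt0; lia.
have wS : w (ordS i) = w i.+1.
  have [e|ne] := eqVneq i.+1 n; last first.
    by rewrite /w /= modn_small// ltn_neqAle ne ltn_ord.
  by rewrite /w /= e modnn /a [in RHS]rotv_turn//; lia.
have turn x y : s * (x * (2 * a)) - s * (y * (2 * a)) = s * (2 * ((x - y) * a)).
  by ring.
have distr (N x y z : R) : s * (N * (x + y - z)) = N * (s * x + s * y - s * z).
  by ring.
rewrite wS /w cross_rotv !turn distr !sin_sign//.
pose B := (j%:R - i%:R) * a.
have -> : (j%:R - i.+1%:R) * a = B - a by rewrite -natr1 /B; ring.
have -> : (i.+1%:R - i%:R) * a = a by rewrite -natr1; ring.
rewrite -/B sin_triple_product edist_sqr !subr0 mulrC ler_wpM2l//.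
  by rewrite addr_ge0 ?sqr_ge0.
have -> : 4 * sin a ^+ 3 = 4 * sin a * (sin a * sin a) by ring.
rewrite ler_pM2l ?mulr_gt0//.
have lower (k l : nat) : (0 < k < n)%N -> (0 < l < n)%N ->
    sin a * sin a <= sin (k%:R * a) * sin (l%:R * a).
  by move=> hk hl; apply: ler_pM; rewrite ?(ltW sa)//; exact: sin_step_ge.
have [ij|ji'] := ltnP i j.
  have ijS : (i.+1 < j)%N.
    rewrite ltn_neqAle ij andbT; apply: contra jSi => /eqP e; apply/eqP/val_inj.
    by rewrite /= e modn_small.
  have jn := ltn_ord j.
  have -> : B = (j - i)%:R * a by rewrite natrB// ltnW.
  have -> : (j - i)%:R * a - a = (j - i.+1)%:R * a.
    by rewrite !natrB//; [rewrite -natr1; ring|exact: ltnW].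
  by apply: lower; lia.
have jlt : (j < i)%N by rewrite ltn_neqAle ji' andbT; apply: contra ji => /eqP/val_inj ->.
have iS : (i - j).+1 != n.
  apply: contra jSi => /eqP e; apply/eqP/val_inj => /=.
  have j0 : j = 0%N :> nat by have := ltn_ord i; lia.
  by rewrite j0 (_ : i.+1 = n) ?modnn//; lia.
have -> : B = - ((i - j)%:R * a) by rewrite natrB 1?ltnW// /B; ring.
have -> : - ((i - j)%:R * a) - a = - ((i - j).+1%:R * a).
  by rewrite -natr1; ring.
by rewrite !sinN mulrNN; apply: lower; have := ltn_ord i; lia.
Qed.

(** Coordinates of differences are at most [2 rho] and change by at most [2 E], so a cross product
    changes by at most [16 rho E + 8 E^2]. The factor 12 keeps this below the minimum
    [4 sin^3 a rho^2] for the regular polygon. *)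
Lemma near_regular_convex :
  (forall j : 'I_n, edist (w j) (P j) ^+ 2 <= E ^+ 2) ->
  12 * E < sin a ^+ 3 * edist 0 p -> strictly_convex s P.
Proof.
move=> hw hE i j ji jSi.
have sa : 0 < sin a by apply: sin_step_gt0; lia.
set rho := edist 0 p in hE *.
have rho0 : 0 <= rho := edist_ge0 _ _.
have sa3 : sin a ^+ 3 <= 1 by rewrite exprn_ile1 ?(ltW sa) ?sin_le1.
have rho1 : 12 * E < rho by rewrite (lt_le_trans hE)// ler_piMl.
have coord k := edist_coord E0 (hw k).
have wq k : `|(w k).1 - q.1| <= rho /\ `|(w k).2 - q.2| <= rho.
  by apply: edist_coord => //; rewrite edist_rotv.
have diff1 (u v : R * R) : (u - v).1 = u.1 - v.1 by [].
have diff2 (u v : R * R) : (u - v).2 = u.2 - v.2 by [].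
have step k l : `|(w k - w l).1| <= 2 * rho /\ `|(w k - w l).2| <= 2 * rho.
  have [/ler_normlP[a1 a2] /ler_normlP[a3 a4]] := wq k.
  have [/ler_normlP[b1 b2] /ler_normlP[b3 b4]] := wq l.
  by split; apply/ler_normlP; rewrite ?diff1 ?diff2; split; lra.
have err (k l : 'I_n) : `|(P k - P l).1 - (w k - w l).1| <= 2 * E /\
    `|(P k - P l).2 - (w k - w l).2| <= 2 * E.
  have [/ler_normlP[a1 a2] /ler_normlP[a3 a4]] := coord k.
  have [/ler_normlP[b1 b2] /ler_normlP[b3 b4]] := coord l.
  by split; apply/ler_normlP; rewrite ?diff1 ?diff2; split; lra.
have [u1 u2] := step (ordS i) i; have [v1 v2] := step j i.
have [h1 h2] := err (ordS i) i; have [h3 h4] := err j i.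
have := cross_perturb u1 u2 v1 v2 h1 h2 h3 h4.
set c' := cross (P _ - _) _; set c := cross (w _ - _) _ => hc.
have hreg := regular_cross ji jSi; rewrite -/c -/rho in hreg.
have sc : s * c - s * c' <= `|c' - c|.
  by case: s1 => ->; have /ler_normlP[] := lexx `|c' - c|; lra.
have rE : rho * E * 12 <= sin a ^+ 3 * rho ^+ 2.
  by have := ler_wpM2l rho0 (ltW hE); lra.
have rho_gt : 0 < rho by rewrite (le_lt_trans _ rho1)// mulr_ge0.
have sp : 0 < sin a ^+ 3 * rho ^+ 2 by rewrite mulr_gt0 ?exprn_gt0.
have EE : E ^+ 2 * 12 <= rho * E.
  by have := ler_wpM2l E0 (ltW rho1); lra.
by move: hc hreg sc rE; lra.
Qed.

End Polygon.
End NearRegularConvex.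

(** * Strictly convex polygons have no pocket *)

Section ConvexPolygonHasNoPocket.
Context {R : realType}.
Implicit Types (p q u v x y : R * R).

Lemma crossDr u v v' : cross u (v + v') = cross u v + cross u v'.
Proof. by rewrite /cross /=; ring. Qed.

Lemma crossZr u v (t : R) : cross u (t *: v) = t * cross u v.
Proof. by rewrite /cross /= /GRing.scale/=; ring. Qed.

Lemma crossvv u : cross u u = 0.
Proof. by rewrite /cross; ring. Qed.

Lemma sumsq_gt0 u : u.1 != 0 \/ u.2 != 0 -> 0 < u.1 ^+ 2 + u.2 ^+ 2.
Proof.
case=> h; [rewrite ltr_wpDr ?sqr_ge0//|rewrite ltr_wpDl ?sqr_ge0//].
  by rewrite lt_neqAle sqr_ge0 andbT eq_sym sqrf_eq0.
by rewrite lt_neqAle sqr_ge0 andbT eq_sym sqrf_eq0.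
Qed.

Lemma cross_neq0 u v : cross u v != 0 -> u.1 != 0 \/ u.2 != 0.
Proof.
move=> h; have [e1|] := eqVneq u.1 0; last by left.
right; apply: contra_neq h => e2; rewrite /cross e1 e2; ring.
Qed.

Lemma parallel_scale u v : 0 < u.1 ^+ 2 + u.2 ^+ 2 -> cross u v = 0 ->
  exists t : R, v = t *: u.
Proof.
move=> u0 c0; exists ((v.1 * u.1 + v.2 * u.2) / (u.1 ^+ 2 + u.2 ^+ 2)).
have n0 : u.1 ^+ 2 + u.2 ^+ 2 != 0 by rewrite gt_eqF.
have c1 : u.1 * v.2 = u.2 * v.1 by apply/eqP; rewrite -subr_eq0; exact/eqP.
rewrite [LHS]surjective_pairing; congr pair; rewrite /= /GRing.scale/=.
  apply: (mulIf n0); rewrite [RHS]mulrAC divfK//.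
  transitivity (v.1 * u.1 ^+ 2 + u.2 * (u.2 * v.1)); first by ring.
  by rewrite -c1; ring.
apply: (mulIf n0); rewrite [RHS]mulrAC divfK//.
transitivity (u.1 * (u.1 * v.2) + v.2 * u.2 ^+ 2); first by ring.
by rewrite c1; ring.
Qed.

Variables (n : nat) (P : polygon R n) (s : R).
Hypotheses (n3 : (3 <= n)%N) (s1 : s = 1 \/ s = -1).
Hypothesis sc : strictly_convex s P.

Lemma ordS_neq (i : 'I_n) : ordS i != i.
Proof.
apply/eqP => /(congr1 val)/=; have := ltn_ord i => i_n.
have [e|ne] := eqVneq i.+1 n; first by rewrite e modnn; lia.
by rewrite modn_small; lia.
Qed.

Lemma ordSS_neq (i : 'I_n) : ordS (ordS i) != i.
Proof.
apply/eqP => /(congr1 val)/=; have := ltn_ord i => i_n.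
have [e|ne] := eqVneq i.+1 n; first by rewrite e modnn modn_small; lia.
rewrite (modn_small (_ : i.+1 < n)%N); last by lia.
have [e'|ne'] := eqVneq i.+2 n; first by rewrite e' modnn; lia.
by rewrite modn_small; lia.
Qed.

Let g (i : 'I_n) x : R := s * cross (P (ordS i) - P i) (x - P i).

Definition halfplanes : set (R * R) := [set x | forall i, 0 <= g i x].

Lemma g_comb i (t : R) x y : g i ((1 - t) *: x + t *: y) =
  (1 - t) * g i x + t * g i y.
Proof. by rewrite /g /cross/= /GRing.scale/=; ring. Qed.

Lemma halfplanes_segment x y : halfplanes x -> halfplanes y ->
  segment x y `<=` halfplanes.
Proof.
move=> hx hy _ [t /= + <-] i; rewrite in_itv/= => /andP[t0 t1].
by rewrite g_comb addr_ge0// mulr_ge0 ?subr_ge0.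
Qed.

Lemma halfplanes_vertex j : halfplanes (P j).
Proof.
move=> i; have [->|ji] := eqVneq j i.
  by rewrite /g subrr /cross /= !mulr0 subrr mulr0.
have [->|jSi] := eqVneq j (ordS i); first by rewrite /g crossvv mulr0.
exact/ltW/sc.
Qed.

Lemma curve_halfplanes : curve P `<=` halfplanes.
Proof.
by move=> x [i _]; apply: halfplanes_segment; exact: halfplanes_vertex.
Qed.

Lemma next_turn i : 0 < s * cross (P (ordS i) - P i)
  (P (ordS (ordS i)) - P (ordS i)).
Proof.
set e := P (ordS i) - P i.
have : 0 < g i (P (ordS (ordS i))).
  by apply: sc; [exact: ordSS_neq|exact: ordS_neq].
rewrite /g (_ : P (ordS (ordS i)) - P i =
  (P (ordS (ordS i)) - P (ordS i)) + e).
  by rewrite crossDr crossvv addr0.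
by rewrite /e addrA subrK.
Qed.

Lemma edge_gt0 i :
  0 < (P (ordS i) - P i).1 ^+ 2 + (P (ordS i) - P i).2 ^+ 2.
Proof.
apply: sumsq_gt0; apply: (@cross_neq0 _ (P (ordS (ordS i)) - P (ordS i))).
by apply: contraTneq (next_turn i) => ->; rewrite mulr0 ltxx.
Qed.

(** On the line of edge [i], the half-plane of the previous edge forces the parameter to be at least
    0, that of the next edge at most 1. *)
Lemma halfplane_boundary i x : halfplanes x -> g i x = 0 -> curve P x.
Proof.
move=> hx gx; exists i => //; rewrite /side.
set e := P (ordS i) - P i.
have [j Sj] : exists j, ordS j = i by exists (ord_pred i); rewrite ord_predK.
have ge : g j (P (ordS i)) = s * cross (P i - P j) e.
  rewrite /g Sj (_ : P (ordS i) - P j = e + (P i - P j)).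
    by rewrite crossDr crossvv addr0.
  by rewrite /e addrA subrK.
have gj : 0 < s * cross (P i - P j) e.
  rewrite -ge; apply: sc; last by rewrite Sj ordS_neq.
  by rewrite -Sj ordSS_neq.
have gS := next_turn i; rewrite -/e in gS.
have e0 := edge_gt0 i; rewrite -/e in e0.
have cx : cross e (x - P i) = 0.
  apply/eqP; move/eqP: gx; rewrite /g mulf_eq0 => /orP[/eqP s0|//].
  by case: s1 => s1'; move/eqP: s0; rewrite s1' ?oppr_eq0 oner_eq0.
have [t xE] := parallel_scale e0 cx.
have t0 : 0 <= t.
  have := hx j; rewrite /g Sj (_ : x - P j = t *: e + (P i - P j)).
    by rewrite crossDr crossvv addr0 crossZr mulrCA pmulr_lge0.
  by rewrite -xE addrA subrK.
have t1 : t <= 1.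
  have := hx (ordS i); rewrite /g (_ : x - P (ordS i) = (t - 1) *: e).
    set f := P (ordS (ordS i)) - _ in gS *.
    rewrite crossZr (_ : s * _ = (1 - t) * (s * cross e f)).
      by rewrite pmulr_lge0// subr_ge0.
    by rewrite /cross; ring.
  by rewrite scalerBl scale1r -xE /e opprB addrA subrK.
exists t; first by rewrite /= in_itv/= t0.
have -> : x = P i + t *: e by rewrite -xE addrC subrK.
rewrite [LHS]surjective_pairing [RHS]surjective_pairing.
by congr pair; rewrite /e /= /GRing.scale/=; ring.
Qed.

(** A point beyond edge [i] escapes along the outward normal [v]: the value of [g i] only decreases
    there, so the ray never meets the curve. *)
Lemma region_halfplanes : region P `<=` halfplanes.
Proof.
move=> x [|[Cx bx]]; first exact: curve_halfplanes.
apply: contrapT => /existsNP[i /negP]; rewrite -ltNge => gx.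
set e := P (ordS i) - P i in gx *.
pose v : R * R := (s * e.2, - (s * e.1)).
have s0 : s != 0 by case: s1 => ->; rewrite ?oppr_eq0 oner_eq0.
have ev : s * cross e v = - (e.1 ^+ 2 + e.2 ^+ 2).
  have s2 : s * s = 1 by case: s1 => ->; rewrite ?mulrNN mulr1.
  have ann u : s * cross u (s * u.2, - (s * u.1)) =
    - (s * s * (u.1 ^+ 2 + u.2 ^+ 2)) by rewrite /cross /=; ring.
  by rewrite ann s2 mul1r.
apply: (@unbounded_along_ray _ (~` curve P) x v _ _ bx).
  have : e.1 != 0 \/ e.2 != 0.
    apply: contrapT => /not_orP[/negP/negPn/eqP e1 /negP/negPn/eqP e2].
    by have := edge_gt0 i; rewrite -/e e1 e2 expr0n addr0 ltxx.
  by case=> h; [right|left]; rewrite /v /= ?oppr_eq0 mulf_neq0.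
move=> t t0 /curve_halfplanes/(_ i).
rewrite leNgt => /negP; apply.
rewrite /g (_ : x + t *: v - P i = (x - P i) + t *: v); last by rewrite addrAC.
rewrite crossDr crossZr mulrDr mulrCA -/e ev.
have : 0 <= t * (e.1 ^+ 2 + e.2 ^+ 2) by rewrite mulr_ge0// addr_ge0 ?sqr_ge0.
by move: gx; rewrite /g -/e; lra.
Qed.

(** The edges sum to zero, so the functions [g i] have a constant sum [K]; being nonnegative, each
    is at most [K]. Two consecutive edges are not parallel, and their two bounds confine both
    coordinates. *)
Lemma halfplanes_bounded : exists M : R, forall x, halfplanes x ->
  `|x.1| <= M /\ `|x.2| <= M.
Proof.
have n0 : (0 < n)%N by lia.
pose i0 := Ordinal n0.
pose e (i : 'I_n) := P (ordS i) - P i.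
have sume x : \sum_i cross (e i) x = 0.
  rewrite /e /cross sumrB -!mulr_suml.
  have z1 : \sum_i (P (ordS i) - P i).1 = 0.
    rewrite (eq_bigr (fun i => (P (ordS i)).1 - (P i).1))// sumrB.
    by rewrite [X in _ - X](reindex (@ordS n)) /= ?subrr//; apply: onW_bij; exact: ordS_bij.
  have z2 : \sum_i (P (ordS i) - P i).2 = 0.
    rewrite (eq_bigr (fun i => (P (ordS i)).2 - (P i).2))// sumrB.
    by rewrite [X in _ - X](reindex (@ordS n)) /= ?subrr//; apply: onW_bij; exact: ordS_bij.
  by rewrite z1 z2 !mul0r subrr.
pose K := - \sum_i s * cross (e i) (P i).
have gK x i : halfplanes x -> g i x <= K.
  move=> hx; have : \sum_i g i x = K.
    rewrite (eq_bigr (fun i => s * cross (e i) x - s * cross (e i) (P i))).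
      by rewrite sumrB -mulr_sumr sume mulr0 sub0r.
    by move=> j _; rewrite /g /e /cross /=; ring.
  move=> <-; rewrite (bigD1 i)//= lerDl; apply: sumr_ge0 => j _; exact: hx.
have bc i : exists B, forall x, halfplanes x -> `|cross (e i) x| <= B.
  exists (K + `|cross (e i) (P i)|) => x hx.
  have -> : cross (e i) x = cross (e i) (x - P i) + cross (e i) (P i).
    by rewrite -crossDr subrK.
  rewrite (le_trans (ler_normD _ _))// lerD2r.
  have <- : `|g i x| = `|cross (e i) (x - P i)|.
    by rewrite /g normrM; case: s1 => ->; rewrite ?normrN normr1 mul1r.
  by rewrite ger0_norm ?gK//; exact: hx.
have [B0 hB0] := bc i0; have [B1 hB1] := bc (ordS i0).
set u := e i0 in hB0; set v := e (ordS i0) in hB1.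
have uv : cross u v != 0.
  by apply: contraTneq (next_turn i0); rewrite -/(e i0) -/(e (ordS i0)) => ->;
    rewrite mulr0 ltxx.
pose D := `|cross u v|.
have D0 : 0 < D by rewrite normr_gt0.
exists ((`|u.1| + `|u.2| + `|v.1| + `|v.2|) * (`|B0| + `|B1|) / D) => x hx.
have x0 := le_trans (hB0 x hx) (ler_norm B0).
have x1 := le_trans (hB1 x hx) (ler_norm B1).
have bound (a b : R) : `|a| <= `|u.1| + `|u.2| + `|v.1| + `|v.2| ->
    `|b| <= `|u.1| + `|u.2| + `|v.1| + `|v.2| ->
    `|a * cross u x + b * cross v x| <=
    (`|u.1| + `|u.2| + `|v.1| + `|v.2|) * (`|B0| + `|B1|).
  move=> ha hb; rewrite (le_trans (ler_normD _ _))// !normrM mulrDr.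
  by apply: lerD; apply: ler_pM.
have nn := fun t : R => normr_ge0 t.
split; rewrite ler_pdivlMr// -normrM.
  rewrite (_ : x.1 * _ = v.1 * cross u x + (- u.1) * cross v x).
    by apply: bound; rewrite ?normrN; have := nn u.1; have := nn u.2;
      have := nn v.1; have := nn v.2; lra.
  by rewrite /cross; ring.
rewrite (_ : x.2 * _ = v.2 * cross u x + (- u.2) * cross v x).
  by apply: bound; rewrite ?normrN; have := nn u.1; have := nn u.2;
    have := nn v.1; have := nn v.2; lra.
by rewrite /cross; ring.
Qed.

(** Off the curve, lying in all half-planes is locally constant: inside, no [g i] vanishes. A
    component that starts inside therefore stays in a bounded set. *)
Lemma halfplanes_region : halfplanes `<=` region P.
Proof.
move=> x hx; have [cx|ncx] := pselect (curve P x); [by left|right; split => //].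
have [M hM] := halfplanes_bounded.
apply/bounded_setP; exists M => y xy; apply: hM.
apply: (connected_locally_constant (component_connected (A := ~` curve P) (x := x))
  (P := halfplanes) _ _ xy hx); last exact: connected_component_refl.
move=> u /connected_component_sub Cu.
have gE i v : g i v = (- s * (P (ordS i) - P i).2) * v.1 +
    (s * (P (ordS i) - P i).1) * v.2 + g i 0.
  by rewrite /g /cross /=; ring.
have g_near i : g i u != 0 -> \forall v \near u, (0 < g i v) = (0 < g i u).
  rewrite gE => /near_sign_affine h; near=> v; rewrite (gE i v); near: v.
  exact: h.
have [hu|nu] := pselect (halfplanes u).
  have gu i : g i u != 0.
    by apply/eqP => g0; apply: Cu; exact: halfplane_boundary hu g0.
  have : \forall v \near u, forall i : 'I_n, (0 < g i v) = (0 < g i u).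
    by apply: near_forall_ord => i; exact: g_near.
  move=> h; near=> v => _; split=> // _ i.
  have -> : (0 <= g i v) = true; last by [].
  apply/ltW; have -> : (0 < g i v) = (0 < g i u) by move: i; near: v.
  by rewrite lt_neqAle eq_sym gu hu.
have [i /negP gi] : exists i, ~ 0 <= g i u by apply/existsNP.
rewrite -ltNge in gi.
have : (s * (P (ordS i) - P i).2) * u.1 + (- s * (P (ordS i) - P i).1) * u.2 +
    - g i 0 != 0.
  rewrite (_ : _ + _ = - g i u) ?oppr_eq0 ?ltr0_neq0//.
  by rewrite [in RHS]gE; ring.
move=> /near_sign_affine h; near=> v => _; split=> // hv; exfalso.
have gN w : (s * (P (ordS i) - P i).2) * w.1 + (- s * (P (ordS i) - P i).1) * w.2 +
    - g i 0 = - g i w by rewrite [in RHS]gE; ring.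
have : (0 < - g i v) = (0 < - g i u) by rewrite -(gN v) -(gN u); near: v.
by rewrite !oppr_gt0 gi ltNge hv.
Unshelve. all: by end_near. Qed.

(** The intersection of the half-planes is convex and equals the region, so the hull adds nothing
    and a pocket would have no point. *)
Lemma no_flip B : ~ flip P B.
Proof.
move=> [_ [K [i [m [[x [+ nx] _] _ _]]]]] => /interior_subset.
move=> hx; apply: nx; apply: halfplanes_region; apply: hx; split.
  move=> y z t; rewrite !inE => hy hz j.
  have := g_comb j (t%:num) z y; rewrite addrC => gE.
  rewrite [X in g j X](_ : _ = t%:num *: y + (1 - t%:num) *: z) ?gE//.
  by rewrite addr_ge0// mulr_ge0 ?hy ?hz// subr_ge0 le1.
exact: region_halfplanes.
Qed.

End ConvexPolygonHasNoPocket.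

(** * Deficit, variation and flips *)

Section VertexSequence.
Context {R : realType} {n : nat}.
Variables (n3 : (3 <= n)%N).
Implicit Types (P A B : polygon R n).

Let n0 : (0 < n)%N.
Proof. by apply: leq_trans n3. Qed.

Definition vertex_seq P (j : nat) : R * R := P (Ordinal (ltn_pmod j n0)).

Lemma vertex_seq_ord P (i : 'I_n) : vertex_seq P i = P i.
Proof. by congr P; apply/val_inj; rewrite /= modn_small. Qed.

Lemma vertex_seqS P (i : 'I_n) : vertex_seq P i.+1 = P (ordS i).
Proof. by congr P; apply/val_inj. Qed.

Lemma vertex_seq_closed P : vertex_seq P n = vertex_seq P 0%N.
Proof. by congr P; apply/val_inj; rewrite /= modnn mod0n. Qed.

Lemma closed_sum_vertex_seq P f :
  closed_sum f n (vertex_seq P) = \sum_(i < n) f (P i) (P (ordS i)).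
Proof.
rewrite /closed_sum big_mkord; apply: eq_bigr => i _.
by rewrite vertex_seq_ord vertex_seqS.
Qed.

Lemma perimeterE P : perimeter P = plen n (vertex_seq P).
Proof. by rewrite /plen closed_sum_vertex_seq. Qed.

Lemma sum_sq_sidesE P : sum_sq_sides P = psumsq n (vertex_seq P).
Proof. by rewrite /psumsq closed_sum_vertex_seq. Qed.

Lemma polyline_vertex_seq P : polyline n (vertex_seq P) = curve P.
Proof.
apply/seteqP; split => [x [j /= jn]|x [i _]].
  by rewrite (vertex_seq_ord P (Ordinal jn)) (vertex_seqS P (Ordinal jn)); exists (Ordinal jn).
by rewrite /side -vertex_seq_ord -vertex_seqS; exists (i : nat) => /=.
Qed.

Lemma filled_vertex_seq P : filled n (vertex_seq P) = region P.
Proof. by rewrite /filled /region polyline_vertex_seq. Qed.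

Lemma simple_vertex_seq P : simple_polygon P -> simple_seq n (vertex_seq P).
Proof.
move=> [Pinj Psimple]; split => i j i_n j_n.
  rewrite (vertex_seq_ord P (Ordinal i_n)) (vertex_seq_ord P (Ordinal j_n)).
  by move=> /Pinj/(congr1 val).
move=> ij; rewrite (vertex_seq_ord P (Ordinal i_n)) (vertex_seq_ord P (Ordinal j_n)).
rewrite (vertex_seqS P (Ordinal i_n)) (vertex_seqS P (Ordinal j_n)).
by apply: Psimple; apply/eqP => /(congr1 val).
Qed.

Lemma vertex_seq_bounded P : exists M : R, forall j,
  `|(vertex_seq P j).1| <= M /\ `|(vertex_seq P j).2| <= M.
Proof.
exists (\sum_i (`|(P i).1| + `|(P i).2|)) => j; rewrite /vertex_seq.
set i := Ordinal _; rewrite (bigD1 i)//=.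
have : 0 <= \sum_(k < n | k != i) (`|(P k).1| + `|(P k).2|).
  by apply: sumr_ge0 => k _; exact: addr_ge0.
by have := normr_ge0 (P i).1; have := normr_ge0 (P i).2; split; lra.
Qed.

Lemma polygon_area_shoelace P : simple_polygon P ->
  exists2 s : R, s = 1 \/ s = -1 &
    polygon_area P = s * (parea2 n (vertex_seq P) / 2).
Proof.
move=> /simple_vertex_seq sP; have [M hM] := vertex_seq_bounded P.
have [s s1 h] := area_filled n3 (vertex_seq_closed P) hM sP.
exists s; first exact: s1.
by rewrite /polygon_area -filled_vertex_seq; exact: h.
Qed.

Lemma polygon_area_le P : simple_polygon P ->
  polygon_area P <= iso_const n * perimeter P ^+ 2 / 2.
Proof.
move=> /polygon_area_shoelace[s s1 ->]; rewrite mulrA ler_pM2r// perimeterE.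
by apply: isoperimetric_signed => //; [exact: leq_trans n3|exact: vertex_seq_closed].
Qed.

Lemma perimeter_gt0 P : simple_polygon P -> 0 < perimeter P.
Proof.
move=> [Pinj _]; rewrite perimeterE lt_neqAle plen_ge0 andbT eq_sym.
apply/eqP => l0; have n1 : (1 < n)%N by exact: leq_trans n3.
have := edist_le_plen (vertex_seq P) (ltnW n1); rewrite l0 => d0.
have : vertex_seq P 0%N = vertex_seq P 1%N.
  by apply: edist_eq0; apply/le_anti; rewrite d0 edist_ge0.
rewrite (vertex_seq_ord P (Ordinal n0)) (vertex_seq_ord P (Ordinal n1)).
by move=> /Pinj/(congr1 val).
Qed.

(** The halving in the shoelace formula turns [4 n tan (pi / n)] into [2 n tan (pi / n)], the
    inverse of [iso_const n]. *)
Lemma deficitE P (s : R) :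
  polygon_area P = s * (parea2 n (vertex_seq P) / 2) ->
  deficit P = (iso_const n)^-1 * (iso_const n * plen n (vertex_seq P) ^+ 2 -
    s * parea2 n (vertex_seq P)).
Proof.
move=> aE; have k0 := iso_const_gt0 n3 (R := R).
have kV : (iso_const n)^-1 = 2 * n%:R * tan (pi / n%:R) :> R.
  by rewrite /iso_const leqNgt n3/= invrK.
rewrite [RHS]mulrBr mulKf ?gt_eqF// kV /deficit aE perimeterE.
by congr (_ - _); field.
Qed.

Lemma measurable_region P : measurable (region P).
Proof. by rewrite -filled_vertex_seq; exact: measurable_filled. Qed.

Lemma area2_region_fin P : area2 (region P) \is a fin_num.
Proof.
have [M hM] := vertex_seq_bounded P.
rewrite ge0_fin_numE; last exact: measure_ge0.
apply: (@le_lt_trans _ _ (area2 (`[- M, M]%classic `*` `[- M, M]%classic))).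
  rewrite /area2; apply: le_measure; rewrite ?inE.
  - exact: measurable_region.
  - by apply: measurableX; exact: measurable_itv.
  - move=> x; rewrite -filled_vertex_seq => /(filled_box hM)[].
    by rewrite !ler_norml => x1 x2; split; rewrite /= in_itv.
have fin : (lebesgue_measure (`[(- M)%R, M]%classic : set R) < +oo)%E.
  by rewrite lebesgue_measure_itv /=; case: ifP => _; rewrite -?EFinD ltry.
rewrite /area2 product_measure1E; [|exact: measurable_itv|exact: measurable_itv].
by apply: lte_mul_pinfty => //; rewrite ge0_fin_numE.
Qed.

Lemma c_asymmetry_le P A :
  c_asymmetry P A <= polygon_area P + polygon_area A.
Proof.
have mP := measurable_region P; have mA := measurable_region A.
have fP := area2_region_fin P; have fA := area2_region_fin A.
rewrite /c_asymmetry /polygon_area /area -(fineD fP fA).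
have le : (area2 (region P `+` region A) <= area2 (region P) + area2 (region A))%E.
  apply: (@le_trans _ _ (area2 (region P `|` region A))).
    rewrite /area2; apply: le_measure; rewrite ?inE.
    - by apply: measurableU; apply: measurableD.
    - exact: measurableU.
    - by move=> x [[? _]|[? _]]; [left|right].
  exact: measureU2.
have fin_add (x y : \bar R) : x \is a fin_num -> y \is a fin_num ->
    (x + y)%E \is a fin_num by move=> hx hy; rewrite fin_numD hx hy.
have fin2 := fin_add _ _ fP fA.
have ge0 : (0 <= area2 (region P `+` region A))%E by exact: measure_ge0.
have fin1 : area2 (region P `+` region A) \is a fin_num.
  by rewrite (ge0_fin_numE ge0) (le_lt_trans le)// ltey_eq fin2.
exact: fine_le fin1 fin2 le.
Qed.

Lemma side_varianceE P : side_variance P = (n%:R ^+ 2)^-1 *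
  (n%:R * psumsq n (vertex_seq P) - plen n (vertex_seq P) ^+ 2).
Proof.
rewrite /side_variance sum_sq_sidesE perimeterE; field.
by rewrite pnatr_eq0; lia.
Qed.

End VertexSequence.

(** * Invariance of the perimeter under flips *)

Section FlipPerimeter.
Context {R : realType} {n : nat}.
Implicit Types (P A B : polygon R n) (a b p q : R * R).

Lemma edist_reflect a b p q : a != b ->
  edist (reflect_across a b p) (reflect_across a b q) = edist p q.
Proof.
move=> ab; apply: eqr_of_sqr; rewrite ?edist_ge0// !edist_sqr.
rewrite /reflect_across /dot /=.
have d0 : (b.1 - a.1) ^+ 2 + (b.2 - a.2) ^+ 2 != 0.
  rewrite -edist_sqr expf_neq0//; apply: contra_neq ab; exact: edist_eq0.
rewrite -!expr2; rewrite /GRing.scale/=.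
by field.
Qed.

Lemma reflect_left a b : reflect_across a b a = a.
Proof.
by rewrite /reflect_across subrr /dot /= !mul0r addr0 mulr0 mul0r scale0r subr0 addr0.
Qed.

Lemma reflect_right a b : a != b -> reflect_across a b b = b.
Proof.
move=> ab; rewrite /reflect_across.
have d0 : dot (b - a) (b - a) != 0.
  have := edist_sqr a b; rewrite /dot /= -!expr2 => <-.
  by rewrite expf_neq0//; apply: contra_neq ab; exact: edist_eq0.
rewrite mulfK// scaler_nat mulr2n addrA addrK addrC subrK//.
Qed.

Lemma val_iter_ordS (i : 'I_n) k : val (iter k (@ordS n) i) = ((i + k) %% n)%N.
Proof.
elim: k => [|k ih]; first by rewrite addn0 modn_small.
by rewrite iterS /= ih addnS -addn1 modnDml addn1.
Qed.

Lemma chain_end_neq (i : 'I_n) m : (0 < m < n)%N -> chain_end i m != i.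
Proof.
move=> /andP[m0 mn]; apply/eqP => /(congr1 val); rewrite val_iter_ordS.
have i_n := ltn_ord i; have [h|h] := ltnP (i + m) n.
  by rewrite modn_small//= => im; have := addnI (etrans im (esym (addn0 _))); lia.
by rewrite -(subnK h) modnDr modn_small /=; lia.
Qed.

(** Both ends of the subchain are fixed by the reflection, so every side either is reflected as a
    whole or stays unchanged. *)
Lemma perimeter_reflect_chain A (i : 'I_n) m : injective A -> (1 < m < n)%N ->
  perimeter (reflect_chain A i m) = perimeter A.
Proof.
move=> Ainj /andP[m1 mn]; set B := reflect_chain A i m.
have ab : A i != A (chain_end i m).
  by rewrite eq_sym (inj_eq Ainj) chain_end_neq//; lia.
have in_chain j : j \in traject (@ordS n) i m.+1 ->
    B j = reflect_across (A i) (A (chain_end i m)) (A j).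
  by rewrite /B /reflect_chain => ->.
have Bi : B i = A i by rewrite in_chain ?reflect_left// in_cons eqxx.
have Bend : B (chain_end i m) = A (chain_end i m).
  rewrite in_chain ?reflect_right//; apply/trajectP; by exists m.
apply: eq_bigr => j _; rewrite /side_length.
(* Only the first [m] of the [m.+1] vertices of the subchain start a side belonging to it. *)
have [/trajectP[k km jE]|jn] := boolP (j \in traject (@ordS n) i m).
  rewrite !in_chain ?edist_reflect//; apply/trajectP.
    by exists k.+1 => //; rewrite jE.
  by exists k => //; apply: ltnW.
have Bj : B j = A j.
  have [jm|jm] := boolP (j \in traject (@ordS n) i m.+1).
    move: jm; rewrite trajectSr mem_rcons in_cons (negbTE jn) orbF => /eqP ->.
    exact: Bend.
  by rewrite /B /reflect_chain (negbTE jm).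
have BSj : B (ordS j) = A (ordS j).
  have [/trajectP[[|k] km jE]|jm] := boolP (ordS j \in traject (@ordS n) i m.+1).
  - by rewrite jE /= Bi.
  - move: jE; rewrite iterS => /ordS_inj jE.
    by move: jn; rewrite jE; case/negP; apply/trajectP; exists k.
  - by rewrite /B /reflect_chain (negbTE jm).
by rewrite Bj BSj.
Qed.

Lemma perimeter_flips A B : flips_to A B -> perimeter B = perimeter A.
Proof.
elim=> // {}A {}B C [[Ainj _] [K [i [m [_ [mn _ _] BE]]]]] _ ->.
by rewrite BE perimeter_reflect_chain.
Qed.

Lemma flips_to_eq A B : (forall C, ~ flip A C) -> flips_to A B -> B = A.
Proof. by move=> nf AB; case: AB nf => // {}A C D fAC _ /(_ C). Qed.

End FlipPerimeter.

(** * Estimates for large and for small deficit *)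

Section TwoRegimes.
Context {R : realType} {n : nat}.
Variable hn : (3 <= n)%N.
Implicit Types (P A : polygon R n).

(** The asymmetry is at most the sum of both areas, each at most [k L^2 / 2] for the common
    perimeter; the side variance adds [L^2] and the radius variance [9 L^2]. *)
Lemma crude_bound P A : simple_polygon P -> convexification P A ->
  c_asymmetry P A + polygon_variation P <=
  (iso_const n + 10) * plen n (vertex_seq hn P) ^+ 2.
Proof.
move=> sP [flips [sA _]]; set z := vertex_seq hn P.
have n0 : (0 : R) < n%:R by rewrite ltr0n; lia.
have n1 : (1 : R) <= n%:R by rewrite ler1n; lia.
have L0 : 0 < plen n z by rewrite -perimeterE perimeter_gt0.
have cas : c_asymmetry P A <= iso_const n * plen n z ^+ 2.
  apply: (le_trans (c_asymmetry_le hn P A)).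
  have hP := polygon_area_le hn sP; have := polygon_area_le hn sA.
  rewrite (perimeter_flips flips) => hA.
  rewrite (le_trans (lerD hP hA))// -(perimeterE hn) le_eqVlt.
  by apply/orP; left; apply/eqP; field.
have sv : side_variance P <= plen n z ^+ 2.
  rewrite (side_varianceE hn) -/z ler_pdivrMl ?exprn_gt0//.
  have h1 : n%:R * psumsq n z <= n%:R * plen n z ^+ 2.
    by rewrite ler_pM2l// psumsq_le.
  have h2 : n%:R * plen n z ^+ 2 <= n%:R ^+ 2 * plen n z ^+ 2.
    by rewrite ler_wpM2r ?sqr_ge0// expr2 ler_peMl// ltW.
  rewrite (le_trans _ h2)// (le_trans _ h1)// gerBl; exact: sqr_ge0.
have rv : radius_variance P <= 9 * plen n z ^+ 2.
  (* The comparison polygon degenerates to the single point [z 0], from which no vertex is farther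
     than the perimeter. *)
  apply: (radius_variance_le (p := 0) (q := z 0%N) hn (or_introl erefl) (ltW L0)) => j.
  rewrite (_ : z 0%N + _ = z 0%N); last first.
    rewrite /rotv [RHS]surjective_pairing [LHS]surjective_pairing.
    by congr pair; rewrite /= !mulr0 ?subr0 !addr0.
  rewrite -(vertex_seq_ord hn P) -/z ler_sqr ?nnegrE ?edist_ge0 ?(ltW L0)//.
  by apply: edist_le_plen; exact: ltnW.
have -> : (iso_const n + 10) * plen n z ^+ 2 = iso_const n * plen n z ^+ 2 +
  (plen n z ^+ 2 + 9 * plen n z ^+ 2) by ring.
by rewrite lerD// /polygon_variation lerD.
Qed.

(** The sides give [L <= n (2 E + 2 rho)], and [n E <= L / 96] then gives [L <= 4 n rho]. The
    constant 96 turns the hypothesis on [E] into [12 E <= sin^3 rho / 2], twice as good as strict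
    convexity requires. *)
Lemma near_regular_strictly_convex P (s E : R) (p q : R * R) :
  s = 1 \/ s = -1 -> 0 <= E -> 0 < plen n (vertex_seq hn P) ->
  E <= sin (step_angle n) ^+ 3 / (96 * n%:R) * plen n (vertex_seq hn P) ->
  (forall j, (j <= n)%N ->
    edist (q + rotv (s * (j%:R * (2 * step_angle n))) p) (vertex_seq hn P j) ^+ 2
    <= E ^+ 2) ->
  strictly_convex s P.
Proof.
move=> s1 E0; set z := vertex_seq hn P; set L := plen n z => L0.
set sn := sin (step_angle n); set th := _ / _ => Eth near.
have n0 : (0 : R) < n%:R by rewrite ltr0n; lia.
have nu : n%:R != 0 :> R by rewrite gt_eqF.
have sa : 0 < sn by apply: sin_step_gt0; lia.
have sn1 : sn <= 1 by exact: sin_le1.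
have th0 : 0 < th by rewrite divr_gt0 ?exprn_gt0// mulr_gt0.
set rho := edist 0 p.
pose w j := q + rotv (s * (j%:R * (2 * step_angle n))) p.
have wz j : (j <= n)%N -> edist (w j) (z j) <= E.
  by move=> jn; apply: ler_of_sqr => //; exact: near.
have qw j : edist q (w j) = rho by exact: edist_rotv.
have side j : (j < n)%N -> edist (z j) (z j.+1) <= 2 * E + 2 * rho.
  move=> jn; apply: (le_trans (edist_triangle (w j) _ _)).
  rewrite (_ : 2 * E + _ = E + ((rho + rho) + E)); last by ring.
  apply: lerD; first by rewrite edistC wz// ltnW.
  apply: (le_trans (edist_triangle (w j.+1) _ _)); rewrite lerD ?wz//.
  by rewrite (le_trans (edist_triangle q _ _))// edistC !qw.
have Lle : L <= n%:R * (2 * E + 2 * rho).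
  rewrite /L /plen /closed_sum big_mkord -[n in n%:R]card_ord mulr_natl.
  by rewrite -sumr_const; apply: ler_sum => j _; exact: side.
have nE : n%:R * E <= L / 96.
  apply: (le_trans (ler_wpM2l (ltW n0) Eth)).
  rewrite (_ : n%:R * (th * L) = sn ^+ 3 * (L / 96)); last by rewrite /th; field.
  rewrite ler_piMl ?divr_ge0 ?(ltW L0)//.
  by rewrite exprn_ile1 ?(ltW sa).
have Lp : L <= 4 * n%:R * rho by move: Lle nE L0; clear; lra.
apply: (@near_regular_convex _ _ _ s p q E hn s1 E0).
  by move=> j; rewrite -(vertex_seq_ord hn P); apply: near; exact: ltnW.
rewrite -/sn -/rho.
have rho0 : 0 < rho.
  have c0 : 0 < 4 * n%:R :> R by rewrite mulr_gt0.
  by rewrite -(pmulr_rgt0 _ c0) (lt_le_trans L0).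
have sn3 : 0 < sn ^+ 3 by rewrite exprn_gt0.
apply: (@le_lt_trans _ _ (sn ^+ 3 * (rho / 2))); last first.
  by rewrite ltr_pM2l// ltr_pdivrMr// ltr_pMr// ltr1n.
apply: (@le_trans _ _ (12 * (th * (4 * n%:R * rho)))).
  by rewrite ler_pM2l// (le_trans Eth)// ler_pM2l.
by rewrite /th le_eqVlt; apply/orP; left; apply/eqP; field.
Qed.

End TwoRegimes.

Theorem corollary1p2 (R : realType) (n : nat) (hn : (3 <= n)%N) :
  exists C : R, 0 < C /\
    forall P Pc : polygon R n,
      simple_polygon P ->
      convexification P Pc ->
      c_asymmetry P Pc + polygon_variation P <= C * deficit P.
Proof.
have hn2 : (2 <= n)%N by exact: ltnW.
have [e [C [e0 C0 stab]]] := stability_signed hn (R := R).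
have n0 : (0 : R) < n%:R by rewrite ltr0n (ltn_trans _ hn2).
have sa : (0 : R) < sin (step_angle n) by exact: sin_step_gt0.
pose k : R := iso_const n; have k0 : 0 < k := iso_const_gt0 hn.
pose th : R := sin (step_angle n) ^+ 3 / (96 * n%:R).
have th0 : 0 < th by rewrite divr_gt0 ?exprn_gt0// mulr_gt0.
(* Below [e] stability applies; below [th ^ 2 / C] the distance [E = sqrt (C d)] is at most [th L],
   as strict convexity requires. *)
pose e' := Num.min e (th ^+ 2 / C).
have e'0 : 0 < e' by rewrite lt_min e0 divr_gt0// exprn_gt0.
(* [C1] serves the small deficits: [C d] for the side variance plus [9 C d] for the radius variance,
   with [d = k deficit]. [C2] serves the large ones, where [L^2 < d / e']. *)
pose C1 := 10 * C * k; pose C2 := (k + 10) * k / e'.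
have C10 : 0 < C1 by rewrite !mulr_gt0.
have C20 : 0 < C2 by rewrite divr_gt0// mulr_gt0// addr_gt0.
exists (C1 + C2); split => [|P Pc sP cPc]; first exact: addr_gt0.
have [s s1 aE] := polygon_area_shoelace hn sP.
set z := vertex_seq hn P in aE.
have zn : z n = z 0%N := vertex_seq_closed hn P.
have L0 : 0 < plen n z by rewrite -perimeterE perimeter_gt0.
set L := plen n z in L0.
have L20 : 0 < L ^+ 2 by rewrite exprn_gt0.
pose d := k * L ^+ 2 - s * parea2 n z.
have d0 : 0 <= d by rewrite subr_ge0; exact: isoperimetric_signed.
have kd : k * deficit P = d by rewrite (deficitE aE) mulVKf// gt_eqF.
have def0 : 0 <= deficit P by rewrite -(pmulr_rge0 _ k0) kd.
rewrite mulrDl.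
have [dle|dgt] := leP d (e' * L ^+ 2); last first.
  apply: (@le_trans _ _ (C2 * deficit P)).
    apply: (le_trans (crude_bound hn sP cPc)); rewrite -/z -/L -/k.
    rewrite /C2 mulrAC -[(k + 10) * k * _]mulrA kd -mulrA ler_pM2l ?addr_gt0//.
    by rewrite ler_pdivlMr// mulrC ltW.
  by rewrite lerDr mulr_ge0// ltW.
apply: (@le_trans _ _ (C1 * deficit P)); last by rewrite lerDl mulr_ge0// ltW.
have de : d <= e * L ^+ 2.
  by rewrite (le_trans dle)// ler_pM2r// ge_min lexx.
have [sideE [p [q near]]] := stab s z s1 zn L0 de.
rewrite -/k -/L -/d in sideE near.
have Cd0 : 0 <= C * d by rewrite mulr_ge0// ltW.
pose E := Num.sqrt (C * d); have E0 : 0 <= E by exact: sqrtr_ge0.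
have EE : E ^+ 2 = C * d by rewrite sqr_sqrtr.
have Eth : E <= th * L.
  apply: ler_of_sqr; first by rewrite mulr_ge0// ltW.
  rewrite EE exprMn mulrC -ler_pdivlMr//.
  by rewrite (le_trans dle)// [leRHS]mulrAC ler_pM2r// ge_min lexx orbT.
rewrite -EE in near.
have conv := near_regular_strictly_convex s1 E0 L0 Eth near.
have -> : Pc = P.
  by apply: flips_to_eq cPc.1 => B; exact: (no_flip hn s1 conv).
rewrite /c_asymmetry setYK /area /area2 measure0 add0r.
have nearP (j : 'I_n) :
    edist (q + rotv (s * (j%:R * (2 * step_angle n))) p) (P j) ^+ 2 <= E ^+ 2.
  by rewrite -(vertex_seq_ord hn P); apply: near; exact: ltnW.
have rv := radius_variance_le hn s1 E0 nearP.
have n1 : (1 : R) <= n%:R ^+ 2 by rewrite exprn_ege1// ler1n (ltn_trans _ hn2).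
have sv : side_variance P <= C * d.
  rewrite (side_varianceE hn) -/z -/L ler_pdivrMl ?exprn_gt0//.
  by rewrite (le_trans sideE)// ler_peMl.
rewrite EE in rv.
have -> : C1 * deficit P = C * d + 9 * (C * d) by rewrite /C1 -mulrA kd; ring.
by rewrite /polygon_variation lerD.
Qed.
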